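(* A non-degenerate map $(f,\hat f):M\to Z=S^n\times S^n\setminus\Delta$ of a manifold $M$ (non-degenerate meaning that both $f$ and $\hat f$ are immersions) is a curved flat in the symmetric space $Z$ if and only if $(f,\hat f)$ is a Darboux pair of isothermic surfaces.
   Context: $C\ell_n$ is the real Clifford algebra of Euclidean $\mathbb{R}^n$, with $vw+wv=-2(v,w)1$; $\Gamma_n\subset C\ell_n^\times$ is the group generated by nonzero vectors; $a\mapsto a^t$ is the anti-involution of $C\ell_n$ fixing vectors. $SL(\Gamma_n)$ is the group of matrices $\begin{pmatrix}a&b\\ c&d\end{pmatrix}$ with $a,b,c,d\in\Gamma_n\cup\{0\}$, $ac^t,bd^t,a^tb,c^td\in\mathbb{R}^n$ and $ad^t-bc^t=1$. It acts on $S^n=\mathbb{R}^n\cup\{\infty\}$ by conformal diffeomorphisms $x\mapsto(ax+b)(cx+d)^{-1}$, $\infty\mapsto ac^{-1}$. Its Lie algebra is $\mathfrak{g}=\left\{\begin{pmatrix}\xi&x\\ y&-\xi^t\end{pmatrix}:x,y\in\mathbb{R}^n,\ \xi\in[\mathbb{R}^n,\mathbb{R}^n]\oplus\mathbb{R}\right\}=\mathfrak{k}\oplus\mathfrak{p}$, with $\mathfrak{k}$ the diagonal and $\mathfrak{p}$ the off-diagonal matrices. $Z=S^n\times S^n\setminus\Delta$ is the space of pairs of distinct points of $S^n$. $SL(\Gamma_n)$ acts on it transitively (diagonally), the stabiliser of $(0,\infty)$ being the group $K$ of diagonal matrices in $SL(\Gamma_n)$, so $Z=SL(\Gamma_n)/K$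 is a symmetric space with symmetric decomposition $\mathfrak{g}=\mathfrak{k}\oplus\mathfrak{p}$. The tangent space at $gK$ is identified with $\mathrm{Ad}(g)\mathfrak{p}\subset\mathfrak{g}$. An immersion $\phi:M\to Z$ of a manifold $M$ is a curved flat if each $d\phi(T_pM)\subset\mathfrak{g}$ is an abelian subalgebra; equivalently, for any local frame $F:M\to SL(\Gamma_n)$ with $\phi=FK$ (i.e. $F\cdot0=f$, $F\cdot\infty=\hat f$ when $\phi=(f,\hat f)$), the $\mathfrak{p}$-part $A_{\mathfrak{p}}$ of $F^{-1}dF$ satisfies $[A_{\mathfrak{p}}(X),A_{\mathfrak{p}}(Y)]=0$ for all $X,Y$. Non-constant maps $f,\hat f:M\to\mathbb{R}^n$, with $g=\hat f-f$ nowhere zero, form a Darboux pair if $df\wedge g^{-1}d\hat f\, g^{-1}=0$, where $(\alpha\wedge\beta)(X,Y)=\alpha(X)\beta(Y)-\alpha(Y)\beta(X)$ with products in $C\ell_n$. This condition is invariant under conformal diffeomorphisms of $S^n$, so it makes sense for $S^n$-valued maps, by first applying (locally) a conformal diffeomorphism making both maps finite. An immersion $f:M\to\mathbb{R}^n$ of a surface is isothermic if, locally, there is a non-constant map $f^c$ into $\mathbb{R}^n$ with $df\wedge df^c=0$.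
   Formalization: The manifold M is assumed non-empty and of dimension at least 2: a pair of immersed curves is always a curved flat but never a pair of surfaces, and the empty map is a curved flat but not non-constant. *)

(* Defs.v *)
From HB Require Import structures.
From mathcomp Require Import all_boot all_order all_algebra.
From mathcomp Require Import all_classical all_reals all_analysis.
From mathcomp Require Import ring.
Set Implicit Arguments.
Unset Strict Implicit.
Unset Printing Implicit Defensive.
Import Order.TTheory GRing.Theory Num.Theory.
Import numFieldNormedType.Exports.
Local Open Scope classical_set_scope.
Local Open Scope ring_scope.

Definition sdiff n (S T : {set 'I_n}) : {set 'I_n} :=
  ((S :\: T) :|: (T :\: S))%SET.

(* e_S e_T = clsign S T e_(sdiff S T), where e_S is the product of the e_i, i
   in S, in increasing order: a pair i > j contributes the -1 of a
   transposition, a pair i = j the -1 of e_i ^ 2 = -1. *)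
Definition clsign (R : comNzRingType) n (S T : {set 'I_n}) : R :=
  (-1) ^+ (\sum_(i in S) \sum_(j in T) (j <= i)%N).

(* An element is the family of its coordinates in the basis (e_S). This is an
   alias because {ffun _ -> R} already carries the pointwise product. *)
Definition cliff (R : comNzRingType) (n : nat) : Type :=
  {ffun {set 'I_n} -> R}.

HB.instance Definition _ (R : comNzRingType) n :=
  GRing.Zmodule.copy (cliff R n) {ffun {set 'I_n} -> R}.

Definition clcoef (R : comNzRingType) n (x : cliff R n) (S : {set 'I_n}) : R :=
  (x : {ffun {set 'I_n} -> R}) S.

Definition cl1 (R : comNzRingType) n : cliff R n :=
  [ffun S => (S == finset.set0)%:R].

Definition clmul (R : comNzRingType) n (x y : cliff R n) : cliff R n :=
  [ffun U => \sum_S clsign R S (sdiff S U) * clcoef x S * clcoef y (sdiff S U)].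

Lemma in_sdiff n (S T : {set 'I_n}) i : (i \in sdiff S T) = (i \in S) (+) (i \in T).
Proof. by rewrite !inE; case: (i \in S); case: (i \in T). Qed.

Lemma sdiffA n : associative (@sdiff n).
Proof. by move=> S T U; apply/setP => i; rewrite !in_sdiff addbA. Qed.

Lemma sdiffC n : commutative (@sdiff n).
Proof. by move=> S T; apply/setP => i; rewrite !in_sdiff addbC. Qed.

Lemma sdiffK n (S : {set 'I_n}) : involutive (sdiff S).
Proof. by move=> T; apply/setP => i; rewrite !in_sdiff addKb. Qed.

Lemma sdiff0 n (S : {set 'I_n}) : sdiff S finset.set0 = S.
Proof. by apply/setP => i; rewrite in_sdiff finset.in_set0 addbF. Qed.

Lemma sdiff_eq0 n (S T : {set 'I_n}) : (sdiff S T == finset.set0) = (S == T).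
Proof.
apply/eqP/eqP => [/setP h|->].
  by apply/setP => i; move: (h i); rewrite in_sdiff finset.in_set0; do 2 case: (_ \in _).
by apply/setP => i; rewrite in_sdiff finset.in_set0 addbb.
Qed.

Lemma prod_sdiff (R : comNzRingType) n (S T : {set 'I_n}) (a : 'I_n -> R) :
  (forall i, a i * a i = 1) ->
  \prod_(i in sdiff S T) a i = (\prod_(i in S) a i) * \prod_(i in T) a i.
Proof.
move=> aa; rewrite big_mkcond [in RHS]big_mkcond [X in _ * X]big_mkcond -big_split /=.
by apply: eq_bigr => i _; rewrite in_sdiff; case: (i \in S); case: (i \in T);
  rewrite /= ?mulr1 ?mul1r ?aa.
Qed.

Lemma clsignE (R : comNzRingType) n (S T : {set 'I_n}) :
  clsign R S T = \prod_(i in S) \prod_(j in T) (-1) ^+ (j <= i)%N.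
Proof.
rewrite /clsign (big_morph (fun k => (-1 : R) ^+ k) (@exprD _ _) (expr0 _)).
apply: eq_bigr => i _.
by rewrite (big_morph (fun k => (-1 : R) ^+ k) (@exprD _ _) (expr0 _)).
Qed.

Lemma signsq (R : comNzRingType) (b : bool) : ((-1) ^+ b : R) * (-1) ^+ b = 1.
Proof. by rewrite -exprD -signr_odd oddD addbb. Qed.

Lemma clsignDl (R : comNzRingType) n (S T U : {set 'I_n}) :
  clsign R (sdiff S T) U = clsign R S U * clsign R T U.
Proof.
rewrite !clsignE prod_sdiff // => i.
by rewrite -big_split big1 // => j _; exact: signsq.
Qed.

Lemma clsignDr (R : comNzRingType) n (S T U : {set 'I_n}) :
  clsign R S (sdiff T U) = clsign R S T * clsign R S U.
Proof.
rewrite !clsignE -big_split; apply: eq_bigr => i _.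
by rewrite prod_sdiff // => j; exact: signsq.
Qed.

Lemma clsign0 (R : comNzRingType) n (S : {set 'I_n}) : clsign R S finset.set0 = 1.
Proof. by rewrite clsignE big1 // => i _; rewrite finset.big_set0. Qed.

Lemma clsign0l (R : comNzRingType) n (S : {set 'I_n}) : clsign R finset.set0 S = 1.
Proof. by rewrite clsignE finset.big_set0. Qed.

Lemma clmulA (R : comNzRingType) n : associative (@clmul R n).
Proof.
move=> x y z; apply/ffunP => W; rewrite !ffunE; symmetry.
under eq_bigr => U _ do
  rewrite /clcoef ffunE mulr_sumr mulr_suml.
rewrite exchange_big /=; apply: eq_bigr => S _.
rewrite /clcoef ffunE mulr_sumr.
rewrite (reindex_inj (inv_inj (sdiffK S))) /=; apply: eq_bigr => T _.
rewrite sdiffK /clcoef clsignDl.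
have -> : sdiff (sdiff S T) W = sdiff T (sdiff S W) by rewrite (sdiffC S) sdiffA.
have -> : clsign R S (sdiff S W) =
    clsign R S T * clsign R S (sdiff T (sdiff S W)) by rewrite -clsignDr sdiffK.
ring.
Qed.

Lemma clmul1l (R : comNzRingType) n : left_id (cl1 R n) (@clmul R n).
Proof.
move=> x; apply/ffunP => U; rewrite ffunE (bigD1 finset.set0) //= big1 ?addr0.
  by rewrite sdiffC sdiff0 clsign0l /clcoef ffunE eqxx !mul1r.
by move=> S /negbTE h; rewrite /clcoef ffunE h mulr0 mul0r.
Qed.

Lemma clmul1r (R : comNzRingType) n : right_id (cl1 R n) (@clmul R n).
Proof.
move=> x; apply/ffunP => U; rewrite ffunE (bigD1 U) //= big1 ?addr0.
  by rewrite (eqP (_ : sdiff U U == finset.set0)) ?sdiff_eq0 // clsign0 /clcoef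
    ffunE eqxx mulr1 mul1r.
by move=> S /negbTE h; rewrite /clcoef [X in _ * X]ffunE sdiff_eq0 h mulr0.
Qed.

Lemma clmulDl (R : comNzRingType) n : left_distributive (@clmul R n) +%R.
Proof.
move=> x y z; apply/ffunP => U; rewrite !ffunE -big_split /=.
by apply: eq_bigr => S _; rewrite /clcoef ffunE mulrDr mulrDl.
Qed.

Lemma clmulDr (R : comNzRingType) n : right_distributive (@clmul R n) +%R.
Proof.
move=> x y z; apply/ffunP => U; rewrite !ffunE -big_split /=.
by apply: eq_bigr => S _; rewrite /clcoef ffunE mulrDr.
Qed.

Lemma cl1_neq0 (R : comNzRingType) n : cl1 R n != 0.
Proof.
by apply/eqP => /ffunP/(_ finset.set0)/eqP; rewrite !ffunE eqxx oner_eq0.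
Qed.

HB.instance Definition _ (R : comNzRingType) n :=
  GRing.Zmodule_isNzRing.Build (cliff R n) (@clmulA R n) (@clmul1l R n)
    (@clmul1r R n) (@clmulDl R n) (@clmulDr R n) (@cl1_neq0 R n).

Definition clvec (R : comNzRingType) n (v : 'rV[R]_n) : cliff R n :=
  [ffun S : {set 'I_n} => \sum_i v 0 i *+ (S == [set i]%SET)].

Definition vecpart (R : comNzRingType) n (x : cliff R n) : 'rV[R]_n :=
  \row_i clcoef x [set i]%SET.

(* Reversing the product of k basis vectors takes k (k - 1) / 2 transpositions. *)
Definition cltr (R : comNzRingType) n (x : cliff R n) : cliff R n :=
  [ffun S : {set 'I_n} => (-1) ^+ 'C(#|S|, 2) * clcoef x S].

Definition dotv (R : comNzRingType) n (v w : 'rV[R]_n) : R :=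
  \sum_i v 0 i * w 0 i.

Lemma clsign11 (R : comNzRingType) n (i j : 'I_n) :
  clsign R [set i]%SET [set j]%SET = (-1) ^+ (j <= i)%N.
Proof. by rewrite /clsign !finset.big_set1. Qed.

Lemma clvecM (R : comNzRingType) n (v w : 'rV[R]_n) U :
  clcoef (clvec v * clvec w) U =
  \sum_(i < n) \sum_(j < n) (-1) ^+ (j <= i)%N * v 0 i * w 0 j *+
     (U == sdiff [set i]%SET [set j]%SET).
Proof.
rewrite [LHS]ffunE.
under eq_bigr => S _ do rewrite {1}/clcoef ffunE mulr_sumr mulr_suml.
rewrite exchange_big /=; apply: eq_bigr => i _.
rewrite (bigD1 [set i]%SET) //= big1 ?addr0; last first.
  by move=> S /negbTE ->; rewrite mulr0n mulr0 mul0r.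
rewrite eqxx /clcoef ffunE mulr_sumr; apply: eq_bigr => j _.
have -> : (U == sdiff [set i]%SET [set j]%SET) = (sdiff [set i]%SET U == [set j]%SET).
  by apply/eqP/eqP => [->|<-]; rewrite sdiffK.
by case: eqP => [->|_]; rewrite ?mulr0n ?mulr0 // clsign11.
Qed.

Lemma clvec_anticomm (R : comNzRingType) n (v w : 'rV[R]_n) U :
  clcoef (clvec v * clvec w + clvec w * clvec v) U =
  - (dotv v w *+ 2) *+ (U == finset.set0).
Proof.
rewrite {1}/clcoef ffunE -![fun_of_fin _ U]/(clcoef _ U) !clvecM.
rewrite [X in _ + X]exchange_big -big_split /dotv /= -sumrMnl -sumrN -sumrMnl.
apply: eq_bigr => i _; rewrite -big_split (bigD1 i) //= big1 ?addr0 => [|j ji].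
  have -> : sdiff [set i]%SET [set i]%SET = finset.set0.
    by apply/eqP; rewrite sdiff_eq0.
  by rewrite leqnn expr1 -mulrnDl; congr (_ *+ _); ring.
rewrite [sdiff [set j]%SET _]sdiffC -mulrnDl.
rewrite (_ : _ + _ = 0) ?mul0rn //.
case: (ltngtP j i) => h; last by rewrite (val_inj h) eqxx in ji.
  by rewrite expr1 expr0; ring.
by rewrite expr1 expr0; ring.
Qed.

(* The two-sided inverse when there is one, 0 otherwise. *)
Definition rinv (A : pzRingType) (x : A) : A :=
  xget 0 [set y | x * y = 1 /\ y * x = 1].

Inductive Gamma (R : comNzRingType) n : cliff R n -> Prop :=
| Gamma_vec v : v != 0 -> Gamma (clvec v)
| Gamma_1 : Gamma 1
| Gamma_mul a b : Gamma a -> Gamma b -> Gamma (a * b)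
| Gamma_inv a : Gamma a -> Gamma (rinv a).

Definition Gamma0 (R : comNzRingType) n (a : cliff R n) : Prop :=
  Gamma a \/ a = 0.

Definition is_vec (R : comNzRingType) n (x : cliff R n) : Prop :=
  exists v : 'rV[R]_n, x = clvec v.

Definition SLGamma (R : comNzRingType) n (g : 'M[cliff R n]_2) : Prop :=
  let a := g 0 0 in let b := g 0 1 in let c := g 1 0 in let d := g 1 1 in
  [/\ [/\ Gamma0 a, Gamma0 b, Gamma0 c & Gamma0 d],
      [/\ is_vec (a * cltr c), is_vec (b * cltr d),
          is_vec (cltr a * b) & is_vec (cltr c * d)]
    & a * cltr d - b * cltr c = 1].

Definition sphere (R : realType) (n : nat) : Type :=
  one_point_compactification 'rV[R]_n.
HB.instance Definition _ (R : realType) n :=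
  Topological.copy (sphere R n) (one_point_compactification 'rV[R]_n).

Definition fin_pt (R : realType) n (x : 'rV[R]_n) : sphere R n := Some x.
Definition infty (R : realType) n : sphere R n := None.

(* For g in SL(Gamma_n) the quotients below are vectors, or their denominator
   vanishes; vecpart only converts them to row vectors. *)
Definition act (R : realType) n (g : 'M[cliff R n]_2) (s : sphere R n) :
    sphere R n :=
  let a := g 0 0 in let b := g 0 1 in let c := g 1 0 in let d := g 1 1 in
  let quot num den := if den == 0 then infty R n
                      else fin_pt (vecpart (num * rinv den)) in
  if s is Some x then quot (a * clvec x + b) (c * clvec x + d) else quot a c.

(* C^k on the open set U; f is total but only its values on U matter. *)
Fixpoint Ck (R : realType) m n (k : nat) (U : set 'rV[R]_m)
    (f : 'rV[R]_m -> 'rV[R]_n) : Prop :=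
  if k is k'.+1 then
    (forall x, U x -> differentiable f x) /\ (forall v, Ck k' U ('D_v f))
  else forall x, U x -> {for x, continuous f}.

Definition smooth (R : realType) m n (U : set 'rV[R]_m)
    (f : 'rV[R]_m -> 'rV[R]_n) : Prop := forall k, Ck k U f.

Record chart (R : realType) (T : Type) (m : nat) := Chart {
  cdom : set T;
  cmap : T -> 'rV[R]_m;
  cinv : 'rV[R]_m -> T }.

Record manifold (R : realType) (m : nat) := Manifold {
  mcarrier :> topologicalType;
  atlas : set (chart R mcarrier m);
  mfd_hausdorff : hausdorff_space mcarrier;
  mfd_second_countable : @second_countable mcarrier;
  atlas_cover : forall p, exists2 c, atlas c & cdom c p;
  atlas_dom : forall c, atlas c -> open (cdom c);
  atlas_img : forall c, atlas c -> open (cmap c @` cdom c);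
  atlas_cancel : forall c, atlas c -> {in cdom c, cancel (cmap c) (cinv c)};
  atlas_cmap_cont : forall c, atlas c ->
    forall p, cdom c p -> {for p, continuous (cmap c)};
  atlas_cinv_cont : forall c, atlas c ->
    forall x, (cmap c @` cdom c) x -> {for x, continuous (cinv c)};
  atlas_compat : forall c c', atlas c -> atlas c' ->
    smooth (cmap c @` (cdom c `&` cdom c')) (cmap c' \o cinv c) }.

(* Inversion in the unit sphere; note that the norm of 'rV[R]_n in the library
   is the sup norm, not the Euclidean one. *)
Definition inversion (R : realType) n (x : 'rV[R]_n) : 'rV[R]_n :=
  (dotv x x)^-1 *: x.

Definition sphere_chart0 (R : realType) n : chart R (sphere R n) n :=
  Chart [set s : sphere R n | s <> infty R n]
        (fun s => if s is Some x then x else 0)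
        (fun x => fin_pt x).

Definition sphere_chart1 (R : realType) n : chart R (sphere R n) n :=
  Chart [set s : sphere R n | s <> fin_pt 0]
        (fun s => if s is Some x then inversion x else 0)
        (fun x => if x == 0 then infty R n else fin_pt (inversion x)).

Definition sphere_atlas (R : realType) n : set (chart R (sphere R n) n) :=
  [set sphere_chart0 R n; sphere_chart1 R n].

Definition smooth_map (R : realType) m n (M : manifold R m)
    (f : M -> sphere R n) : Prop :=
  continuous f /\
  forall c psi, atlas c -> sphere_atlas psi ->
    smooth (cmap c @` (cdom c `&` f @^-1` cdom psi)) (cmap psi \o f \o cinv c).

Definition smooth_on (R : realType) m n (M : manifold R m) (U : set M)
    (h : M -> 'rV[R]_n) : Prop :=
  forall c, atlas c -> smooth (cmap c @` (cdom c `&` U)) (h \o cinv c).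

(* The differential at p of h; tangent vectors at p are given by their
   components X in a chart c at p. *)
Definition dchart (R : realType) m n (T : Type) (c : chart R T m) (p : T)
    (h : T -> 'rV[R]_n) (X : 'rV[R]_m) : 'rV[R]_n :=
  'D_X (h \o cinv c) (cmap c p).

(* The differential of a sphere-valued map, a tangent vector to the sphere being
   the family of its components in the charts at its base point. *)
Definition dsphere (R : realType) m n (T : Type) (c : chart R T m) (p : T)
    (f : T -> sphere R n) (X : 'rV[R]_m) (psi : chart R (sphere R n) n) :
    'rV[R]_n :=
  dchart c p (cmap psi \o f) X.

Definition immersion (R : realType) m n (M : manifold R m)
    (f : M -> sphere R n) : Prop :=
  smooth_map f /\
  forall p c psi, atlas c -> cdom c p -> sphere_atlas psi -> cdom psi (f p) ->
    forall X, dsphere c p f X psi = 0 -> X = 0.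

(* A map into Z is given by its two components f and fh, with f p <> fh p;
   it is an immersion when the kernels of the differentials of f and fh meet
   trivially. *)
Definition immersion_Z (R : realType) m n (M : manifold R m)
    (f fh : M -> sphere R n) : Prop :=
  [/\ smooth_map f, smooth_map fh, (forall p, f p <> fh p)
    & forall p c psi psih, atlas c -> cdom c p ->
        sphere_atlas psi -> cdom psi (f p) ->
        sphere_atlas psih -> cdom psih (fh p) ->
      forall X, dsphere c p f X psi = 0 -> dsphere c p fh X psih = 0 -> X = 0].

Definition ppart (A : nzRingType) (xi : 'M[A]_2) : 'M[A]_2 :=
  \matrix_(i, j) if i == j then 0 else xi i j.

Definition lie (A : nzRingType) (xi eta : 'M[A]_2) : 'M[A]_2 :=
  xi * eta - eta * xi.

Definition is_velocity (R : realType) n (s : R -> sphere R n)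
    (v : chart R (sphere R n) n -> 'rV[R]_n) : Prop :=
  forall psi, sphere_atlas psi -> cdom psi (s 0) ->
    is_derive (0 : R) (1 : R) (cmap psi \o s) (v psi).

Definition is_mx_derivative (R : realType) n (gam : R -> 'M[cliff R n]_2)
    (A : 'M[cliff R n]_2) : Prop :=
  forall i j S,
    is_derive (0 : R) (1 : R) (fun t => clcoef (gam t i j) S) (clcoef (A i j) S).

(* The identification of the tangent space of Z at (z, zh) = g K with Ad(g) p:
   the velocity at 0 of t |-> gam t K, where gam is a curve in SL(Gamma_n) with
   gam 0 = g, corresponds to Ad(g) of the p-part of g^-1 gam'(0). *)
Definition tangent_repr (R : realType) n (z zh : sphere R n)
    (v vh : chart R (sphere R n) n -> 'rV[R]_n) (xi : 'M[cliff R n]_2) : Prop :=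
  exists (gam : R -> 'M[cliff R n]_2) (A : 'M[cliff R n]_2),
    let g := gam 0 in
    [/\ (\forall t \near 0, SLGamma (gam t)) /\ is_mx_derivative gam A,
        act g (fin_pt 0) = z /\ act g (infty R n) = zh,
        is_velocity (fun t => act (gam t) (fin_pt 0)) v,
        is_velocity (fun t => act (gam t) (infty R n)) vh
      & xi = g * ppart (rinv g * A) * rinv g].

(* d phi (T_p M) for phi = (f, fh), as a subset of the Lie algebra. *)
Definition dphi_image (R : realType) m n (M : manifold R m)
    (f fh : M -> sphere R n) (c : chart R M m) (p : M) :
    set 'M[cliff R n]_2 :=
  [set xi | exists X : 'rV[R]_m,
     tangent_repr (f p) (fh p) (dsphere c p f X) (dsphere c p fh X) xi].

(* As the image of a linear map, dphi_image is a linear subspace: being an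
   abelian subalgebra amounts to the vanishing of the brackets. *)
Definition curved_flat (R : realType) m n (M : manifold R m)
    (f fh : M -> sphere R n) : Prop :=
  immersion_Z f fh /\
  forall p c, atlas c -> cdom c p ->
    forall xi eta, dphi_image f fh c p xi -> dphi_image f fh c p eta ->
      lie xi eta = 0.

Definition wedge (A : nzRingType) (V : Type) (alpha beta : V -> A) (X Y : V) : A :=
  alpha X * beta Y - alpha Y * beta X.

Definition dcl (R : realType) m n (T : Type) (c : chart R T m) (p : T)
    (h : T -> 'rV[R]_n) (X : 'rV[R]_m) : cliff R n := clvec (dchart c p h X).

Definition darboux_on (R : realType) m n (M : manifold R m) (U : set M)
    (f fh : M -> 'rV[R]_n) : Prop :=
  forall q c, U q -> atlas c -> cdom c q ->
    let ginv := rinv (clvec (fh q - f q)) in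
    fh q - f q != 0 /\
    forall X Y,
      wedge (dcl c q f) (fun Z => ginv * dcl c q fh Z * ginv) X Y = 0.

(* f0 is the map f moved to Euclidean space by the conformal diffeomorphism T. *)
Definition finite_via (R : realType) m n (M : manifold R m) (U : set M)
    (T : 'M[cliff R n]_2) (f : M -> sphere R n) (f0 : M -> 'rV[R]_n) : Prop :=
  forall q, U q -> act T (f q) = fin_pt (f0 q).

Definition nonconstant_on (T T' : Type) (U : set T) (f : T -> T') : Prop :=
  exists p q, [/\ U p, U q & f p <> f q].

(* Sphere-valued maps are first made finite, locally, by an element of
   SL(Gamma_n), i.e. by a conformal diffeomorphism of the sphere. *)
Definition darboux_pair (R : realType) m n (M : manifold R m)
    (f fh : M -> sphere R n) : Prop :=
  [/\ nonconstant_on setT f, nonconstant_on setT fh, (forall p, f p <> fh p)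
    & forall p, exists (U : set M) (T : 'M[cliff R n]_2) (f0 fh0 : M -> 'rV[R]_n),
        [/\ open U /\ U p, SLGamma T, finite_via U T f f0, finite_via U T fh fh0
          & darboux_on U f0 fh0]].

(* The condition m = 2 says that f is a surface. U is connected in order that a
   non-constant fc is not merely locally constant with different values on the
   components of U. *)
Definition isothermic (R : realType) m n (M : manifold R m)
    (f : M -> sphere R n) : Prop :=
  [/\ m = 2%N, immersion f
    & forall p, exists (U : set M) (T : 'M[cliff R n]_2) (f0 fc : M -> 'rV[R]_n),
        [/\ [/\ open U, connected U & U p],
            SLGamma T /\ finite_via U T f f0,
            smooth_on U fc /\ nonconstant_on U fc
          & forall q c, U q -> atlas c -> cdom c q ->
              forall X Y, wedge (dcl c q f0) (dcl c q fc) X Y = 0]].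

(* Main.v *)
(* After an element of SL(Gamma_n) both maps take values z = f and zh = fh in R^n;
   put g = zh - z. A frame F with F 0 = z and F oo = zh is (zh z; 1 1) times a
   diagonal matrix, so the tangent vector attached to F^-1 dF depends only on
   dz and dzh: it is the conjugate by (zh z; 1 1) of the off-diagonal matrix with
   entries g^-1 dz and - g^-1 dzh. Hence brackets of tangent vectors vanish exactly
   when dz(X) g^-1 dzh(Y) is symmetric in X and Y, which is the Darboux relation.

   This relation implies dz(Y) dz(X) dz(Z) = dz(Z) dz(X) dz(Y) for all X, Y, Z,
   which is impossible for three orthogonal values of dz; so M is a surface. It
   also implies that the R^n-valued form g^-1 dzh g^-1 is closed, and a local
   primitive of it is a Christoffel dual of f. The relation is symmetric in f and
   fh up to the transposition of the Clifford algebra, which settles fh. *)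

From HB Require Import structures.
Require Import Defs.
From mathcomp Require Import all_boot all_order all_algebra.
From mathcomp Require Import all_classical all_reals all_analysis.
From mathcomp Require Import ring lra zify.
Set Implicit Arguments.
Unset Strict Implicit.
Unset Printing Implicit Defensive.
Import Order.TTheory GRing.Theory Num.Theory.
Import numFieldNormedType.Exports.
Local Open Scope classical_set_scope.
Local Open Scope ring_scope.

(** * The Clifford algebra and the Clifford group *)

(** The encoding of tangent vectors shapes the proof: [tangent_repr] is existential, over all curves
    in SL(Gamma_n) with given velocities, and velocities are read in two charts of the sphere. So
    two facts are needed: all representatives of a tangent vector agree, and one exists, since
    otherwise the bracket condition could hold vacuously. The first comes from differentiating the
    columns of a curve of frames, the second from an explicit curve.

    Points of the sphere are handled in homogeneous coordinates, where the action is linear and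
    infinity is no special case. In the Clifford group an inverse is a real multiple of the
    transpose, so the action is rational, hence smooth, in the charts.

    A vanishing bracket gives two equations, transposes of each other. Closedness of the dual form
    uses the symmetry of second derivatives, and its primitive is an integral along the rays of a
    ball in a chart; the ball also makes the domain of the dual connected. The dual is not constant
    because the other map is an immersion. *)

Definition clscale (R : comNzRingType) n (r : R) (x : cliff R n) : cliff R n :=
  [ffun S => r * clcoef x S].

Section Scaling.
Variables (R : comNzRingType) (n : nat).

Lemma clscaleA (r s : R) (x : cliff R n) : clscale r (clscale s x) = clscale (r * s) x.
Proof. by apply/ffunP => S; rewrite /clscale /clcoef !ffunE mulrA. Qed.

Lemma clscale1 : left_id 1 (@clscale R n).
Proof. by move=> x; apply/ffunP => S; rewrite /clscale /clcoef !ffunE mul1r. Qed.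

Lemma clscaleDr : right_distributive (@clscale R n) +%R.
Proof. by move=> r x y; apply/ffunP => S; rewrite /clscale /clcoef !ffunE mulrDr. Qed.

Lemma clscaleDl (x : cliff R n) : {morph (@clscale R n)^~ x : r s / r + s}.
Proof. by move=> r s; apply/ffunP => S; rewrite /clscale /clcoef !ffunE mulrDl. Qed.
End Scaling.

HB.instance Definition _ (R : comNzRingType) n :=
  GRing.Zmodule_isLmodule.Build R (cliff R n) (@clscaleA R n) (@clscale1 R n)
    (@clscaleDr R n) (@clscaleDl R n).

Section Clifford.
Variables (R : comNzRingType) (n : nat).
Implicit Types (x y z : cliff R n) (u v w : 'rV[R]_n) (r : R) (S T U : {set 'I_n}).

Lemma clcoefD x y S : clcoef (x + y) S = clcoef x S + clcoef y S.
Proof. by rewrite /clcoef ffunE. Qed.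

Lemma clcoefN x S : clcoef (- x) S = - clcoef x S.
Proof. by rewrite /clcoef ffunE. Qed.

Lemma clcoefZ r x S : clcoef (r *: x) S = r * clcoef x S.
Proof. by rewrite /clcoef ffunE. Qed.

Lemma clcoef0 S : clcoef (0 : cliff R n) S = 0.
Proof. by rewrite /clcoef ffunE. Qed.

Lemma clcoef_sum I (s : seq I) (P : pred I) (F : I -> cliff R n) S :
  clcoef (\sum_(i <- s | P i) F i) S = \sum_(i <- s | P i) clcoef (F i) S.
Proof. by apply: (big_morph (fun x => clcoef x S)) => [x y|]; rewrite (clcoefD, clcoef0). Qed.

Lemma clcoef1 S : clcoef (1 : cliff R n) S = (S == finset.set0)%:R.
Proof. by rewrite /clcoef ffunE. Qed.

Lemma clcoefM x y U :
  clcoef (x * y) U = \sum_S clsign R S (sdiff S U) * clcoef x S * clcoef y (sdiff S U).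
Proof. by rewrite /clcoef ffunE. Qed.

Lemma cliffP x y : (forall S, clcoef x S = clcoef y S) -> x = y.
Proof. by move=> h; apply/ffunP. Qed.

Lemma clscaleAl r x y : r *: (x * y) = r *: x * y.
Proof.
apply: cliffP => U; rewrite clcoefZ !clcoefM mulr_sumr; apply: eq_bigr => S _.
by rewrite clcoefZ; ring.
Qed.

Lemma clscaleAr r x y : r *: (x * y) = x * (r *: y).
Proof.
apply: cliffP => U; rewrite clcoefZ !clcoefM mulr_sumr; apply: eq_bigr => S _.
by rewrite clcoefZ; ring.
Qed.
End Clifford.

HB.instance Definition _ (R : comNzRingType) n :=
  GRing.Lmodule_isLalgebra.Build R (cliff R n) (@clscaleAl R n).
HB.instance Definition _ (R : comNzRingType) n :=
  GRing.Lalgebra_isAlgebra.Build R (cliff R n) (@clscaleAr R n).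

Section CliffordTheory.
Variables (R : comNzRingType) (n : nat).
Implicit Types (x y z : cliff R n) (u v w : 'rV[R]_n) (r : R) (S T U : {set 'I_n}).

Lemma clvec_is_linear : linear (@clvec R n).
Proof.
move=> r u v; apply: cliffP => S; rewrite clcoefD clcoefZ /clcoef !ffunE.
rewrite mulr_sumr -big_split; apply: eq_bigr => i _ /=.
by rewrite !mxE mulrnDl mulrnAr.
Qed.
HB.instance Definition _ := GRing.isLinear.Build R 'rV[R]_n (cliff R n) _ (@clvec R n) clvec_is_linear.

Lemma vecpart_is_linear : linear (@vecpart R n).
Proof. by move=> r x y; apply/rowP => i; rewrite !mxE clcoefD clcoefZ. Qed.
HB.instance Definition _ := GRing.isLinear.Build R (cliff R n) 'rV[R]_n _ (@vecpart R n) vecpart_is_linear.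

Lemma clvecK : cancel (@clvec R n) (@vecpart R n).
Proof.
move=> v; apply/rowP => i; rewrite !mxE /clcoef ffunE (bigD1 i) //= eqxx mulr1n.
rewrite big1 ?addr0 // => j ji.
by rewrite eq_sym (inj_eq finset.set1_inj) (negbTE ji).
Qed.

Lemma clvec_inj : injective (@clvec R n).
Proof. exact: can_inj clvecK. Qed.

Lemma clvec_eq0 v : (clvec v == 0) = (v == 0).
Proof. by rewrite -(raddf0 (@clvec R n)) (inj_eq clvec_inj). Qed.

Lemma clvec_polar v w :
  clvec v * clvec w + clvec w * clvec v = (- (dotv v w *+ 2)) *: 1.
Proof. by apply: cliffP => S; rewrite clvec_anticomm clcoefZ clcoef1 mulr_natr. Qed.

Lemma clvec1 v S : #|S| != 1%N -> clcoef (clvec v) S = 0.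
Proof.
move=> h; rewrite /clcoef ffunE big1 // => i _.
by case: (S =P [set i]%SET) h => [->|_ _]; rewrite ?finset.cards1 ?eqxx.
Qed.

Lemma bin2D (a b : nat) : 'C(a + b, 2) = ('C(a, 2) + 'C(b, 2) + a * b)%N.
Proof.
elim: a => [|a IH]; first by rewrite add0n mul0n bin0n addn0.
by rewrite addSn !binS !bin1 IH mulSn; lia.
Qed.

(** Sign bookkeeping behind (e_S e_T)^t = e_T^t e_S^t. Only parities matter: |S| + |T| exceeds the
    size of the symmetric difference by twice |S :&: T|, and the sign exponents of (S, T) and (T, S)
    add up to |S| |T| + |S :&: T|. *)
Lemma signr_bin2_sdiff S T :
  (-1) ^+ 'C(#|sdiff S T|, 2) * clsign R S T =
  (-1) ^+ 'C(#|S|, 2) * (-1) ^+ 'C(#|T|, 2) * clsign R T S.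
Proof.
have card_sdiff : (#|S| + #|T| = #|sdiff S T| + #|(S :&: T)%SET|.*2)%N.
  rewrite /sdiff cardsU (_ : _ :&: _ = finset.set0)%SET.
    rewrite cards0 subn0 !cardsD (finset.setIC T S).
    have := subset_leq_card (finset.subsetIl S T); have := subset_leq_card (finset.subsetIr S T).
    by lia.
  by apply/setP => i; rewrite !inE; case: (i \in S); case: (i \in T).
pose k := (#|S| * #|T| + #|(S :&: T)%SET|)%N.
(* A pair of distinct indices is counted in exactly one of the two sums, a common index in both. *)
have expo : (\sum_(i in S) \sum_(j in T) (j <= i)%N +
    \sum_(i in T) \sum_(j in S) (j <= i)%N = k)%N.
  rewrite [X in (_ + X)%N]exchange_big -big_split /=.
  under eq_bigr => i _ do rewrite -big_split /=.
  have step (i : 'I_n) : (\sum_(j in T) ((j <= i) + (i <= j)) = #|T| + (i \in T))%N.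
    rewrite -sum1_card (_ : (i \in T : nat) = \sum_(j in T) (j == i))%N; last first.
      rewrite big_mkcond (bigD1 i) //= big1 => [|j /negbTE ->]; last by case: ifP.
      by rewrite eqxx addn0; case: ifP.
    rewrite -big_split; apply: eq_bigr => j _ /=.
    by case: (ltngtP j i) => [h|h|/val_inj ->]; rewrite ?eqxx //;
      case: eqP h => // ->; rewrite ltnn.
  under eq_bigr => i _ do rewrite step.
  rewrite /k big_split /= sum_nat_const; congr (_ + _)%N.
  rewrite -sum1_card [RHS]big_mkcond [LHS]big_mkcond; apply: eq_bigr => i _ /=.
  by rewrite inE; case: (i \in S); case: (i \in T).
have binE : (-1) ^+ 'C(#|S|, 2) * (-1) ^+ 'C(#|T|, 2) =
    (-1) ^+ 'C(#|sdiff S T|, 2) * (-1) ^+ k :> R.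
  rewrite /k -!exprD -signr_odd -[in RHS]signr_odd; congr (_ ^+ nat_of_bool _).
  (* The binomial of |S| + |T| is expanded in two ways, the second time as the symmetric difference
     plus twice the intersection, and the results are compared modulo 2. *)
  have := bin2D #|S| #|T|; rewrite card_sdiff bin2D -addnn bin2D => h.
  have {h} := congr1 odd h; rewrite !oddD !oddM !oddD.
  by do 8 case: (odd _).
rewrite binE -expo exprD -/(clsign R S T) -/(clsign R T S) -!mulrA; congr (_ * _).
by rewrite -expr2 sqrr_sign mulr1.
Qed.

Lemma clcoef_tr x S : clcoef (cltr x) S = (-1) ^+ 'C(#|S|, 2) * clcoef x S.
Proof. by rewrite /clcoef ffunE. Qed.

Lemma cltr_is_linear : linear (@cltr R n).
Proof.
by move=> r x y; apply: cliffP => S; rewrite !(clcoef_tr, clcoefD, clcoefZ); ring.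
Qed.
HB.instance Definition _ :=
  GRing.isLinear.Build R (cliff R n) (cliff R n) _ (@cltr R n) cltr_is_linear.

Lemma cltrM x y : cltr (x * y) = cltr y * cltr x.
Proof.
apply: cliffP => U; rewrite clcoefM clcoef_tr clcoefM mulr_sumr.
(* Replacing S by [sdiff U S] exchanges the two factors of each term. *)
rewrite [RHS](reindex_inj (inv_inj (sdiffK U))) /=; apply: eq_bigr => S _.
rewrite (sdiffC U S) !clcoef_tr.
have -> : sdiff (sdiff S U) U = S.
  by rewrite (sdiffC S) -{2}(sdiffK U S) (sdiffC U (sdiff U S)).
have := signr_bin2_sdiff S (sdiff S U); rewrite sdiffK => h.
rewrite !mulrA h; ring.
Qed.

Lemma cltrK : involutive (@cltr R n).
Proof. by move=> x; apply: cliffP => S; rewrite !clcoef_tr mulrA -expr2 sqrr_sign mul1r. Qed.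

Lemma cltr_vec v : cltr (clvec v) = clvec v.
Proof.
apply: cliffP => S; rewrite clcoef_tr; have [h|h] := eqVneq #|S| 1%N.
  by rewrite h bin_small // expr0 mul1r.
by rewrite clvec1 ?mulr0.
Qed.

Lemma cltr1 : cltr (1 : cliff R n) = 1.
Proof.
apply: cliffP => S; rewrite clcoef_tr clcoef1; case: eqP => [->|_]; last by rewrite mulr0.
by rewrite cards0 bin0n mul1r.
Qed.

Lemma dotvC v w : dotv v w = dotv w v.
Proof. by apply: eq_bigr => i _; rewrite mulrC. Qed.

Lemma dotvDl u v w : dotv (u + v) w = dotv u w + dotv v w.
Proof. by rewrite /dotv -big_split; apply: eq_bigr => i _; rewrite mxE mulrDl. Qed.

Lemma dotvZl r v w : dotv (r *: v) w = r * dotv v w.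
Proof. by rewrite /dotv mulr_sumr; apply: eq_bigr => i _; rewrite mxE mulrA. Qed.

Lemma dotvZr r v w : dotv v (r *: w) = r * dotv v w.
Proof. by rewrite !(dotvC v) dotvZl. Qed.

Lemma is_vec_clvec v : is_vec (clvec v).
Proof. by exists v. Qed.

Lemma is_vecD x y : is_vec x -> is_vec y -> is_vec (x + y).
Proof. by move=> [v ->] [w ->]; exists (v + w); rewrite linearD. Qed.

Lemma is_vecZ r x : is_vec x -> is_vec (r *: x).
Proof. by move=> [v ->]; exists (r *: v); rewrite linearZ. Qed.

Lemma is_vecN x : is_vec x -> is_vec (- x).
Proof. by move=> [v ->]; exists (- v); rewrite linearN. Qed.

Lemma is_vec0 : is_vec (0 : cliff R n).
Proof. by exists 0; rewrite linear0. Qed.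

Lemma is_vec_tr x : is_vec x -> cltr x = x.
Proof. by move=> [v ->]; rewrite cltr_vec. Qed.

Lemma rinvE (A : nzRingType) (x y : A) : x * y = 1 -> y * x = 1 -> rinv x = y.
Proof.
move=> xy yx; rewrite /rinv; case: xgetP => [z _ [xz zx]|/(_ y)/=[]//].
by rewrite -[z]mul1r -yx -mulrA xz mulr1.
Qed.
End CliffordTheory.

Section CliffordField.
Variables (R : realFieldType) (n : nat).
Implicit Types (a b x y z : cliff R n) (u v w : 'rV[R]_n) (r : R).

Lemma clvec_sqr v : clvec v * clvec v = (- dotv v v) *: 1.
Proof.
have h := clvec_polar v v; apply: (@scalerI _ _ (2 : R)); first by rewrite pnatr_eq0.
by rewrite scalerA mulrN mulr_natl scaler_nat mulr2n h.
Qed.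

Lemma clvec_swap v w : clvec v * clvec w = - (clvec w * clvec v) - (dotv v w *+ 2) *: 1.
Proof. by rewrite -scaleNr -clvec_polar addrCA addNr addr0. Qed.

Lemma dotv_eq0 v : (dotv v v == 0) = (v == 0).
Proof.
apply/eqP/eqP => [h|->]; last by rewrite /dotv big1 // => i _; rewrite mxE mul0r.
apply/rowP => i; rewrite mxE; apply/eqP; rewrite -sqrf_eq0.
move/eqP: h; rewrite psumr_eq0 => [/allP/(_ i)|j _]; last by rewrite -expr2 sqr_ge0.
by rewrite mem_index_enum expr2 => /(_ isT).
Qed.

(** Up to the factor [dotv v v], the reflection of w in the hyperplane orthogonal to v. This is why
    conjugation by products of vectors, with transposes in place of inverses, preserves vectors. *)
Lemma clvec_conj v w :
  clvec v * clvec w * clvec v = clvec (dotv v v *: w - (dotv v w *+ 2) *: v).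
Proof.
rewrite clvec_swap mulrDl mulNr -mulrA clvec_sqr -scalerAr mulr1 scaleNr opprK.
by rewrite mulNr -scalerAl mul1r linearB !linearZ.
Qed.

(** The norm is multiplicative because scalars are central, and it is [- dotv v v] on a vector. It
    makes the inverse of a a real multiple of [cltr a]. *)
Lemma Gamma_norm a : Gamma a ->
  exists2 r, r != 0 & a * cltr a = r *: 1 /\ cltr a * a = r *: 1.
Proof.
elim=> {a} [v v0||a b _ [r r0 [ra ra']] _ [s s0 [sb sb']]|a _ [r r0 [ra ra']]].
- exists (- dotv v v); first by rewrite oppr_eq0 dotv_eq0.
  by rewrite cltr_vec clvec_sqr.
- by exists 1; rewrite ?oner_eq0 // cltr1 mulr1 scale1r.
- exists (r * s); first by rewrite mulf_neq0.
  rewrite cltrM; split.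
    by rewrite mulrA -(mulrA a) sb -scalerAr mulr1 -scalerAl ra scalerA mulrC.
  by rewrite mulrA -(mulrA (cltr b)) ra' -scalerAr mulr1 -scalerAl sb' scalerA.
- have -> : rinv a = r^-1 *: cltr a.
    apply: rinvE; first by rewrite -scalerAr ra scalerA mulVf // scale1r.
    by rewrite -scalerAl ra' scalerA mulVf // scale1r.
  exists (r^-1); first by rewrite invr_eq0.
  rewrite linearZ /= cltrK -!scalerAl -!scalerAr ra ra' !scalerA.
  by rewrite -[r^-1 * _ * _]mulrA mulVf ?mulr1.
Qed.

Lemma Gamma_rinv a : Gamma a -> a * rinv a = 1 /\ rinv a * a = 1.
Proof.
move=> /Gamma_norm[r r0 [ra ra']].
have l : a * (r^-1 *: cltr a) = 1 by rewrite -scalerAr ra scalerA mulVf // scale1r.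
have l' : (r^-1 *: cltr a) * a = 1 by rewrite -scalerAl ra' scalerA mulVf // scale1r.
by rewrite (rinvE l l').
Qed.

Lemma Gamma_conj a : Gamma a -> forall v,
  is_vec (a * clvec v * cltr a) /\ is_vec (cltr a * clvec v * a).
Proof.
elim=> {a} [v v0|u|a b _ iha _ ihb u|a ga iha u].
- by move=> u; rewrite cltr_vec clvec_conj; split; exists (dotv v v *: u - (dotv v u *+ 2) *: v).
- by rewrite cltr1 mulr1 mul1r; split; exists u.
- rewrite cltrM !mulrA; have [[v hv] _] := ihb u; have [_ [w hw]] := iha u; split.
    by rewrite -[a * b * _]mulrA -[a * _ * _]mulrA hv; have [] := iha v.
  by rewrite -[cltr b * _ * _]mulrA -[cltr b * _ * _]mulrA hw; have [] := ihb w.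
- have [r r0 [ra ra']] := Gamma_norm ga.
  have -> : rinv a = r^-1 *: cltr a.
    apply: rinvE; first by rewrite -scalerAr ra scalerA mulVf // scale1r.
    by rewrite -scalerAl ra' scalerA mulVf // scale1r.
  rewrite linearZ /= cltrK -!scalerAl -!scalerAr.
  by have [h1 h2] := iha u; split; do 2 apply: is_vecZ.
Qed.
End CliffordField.

(** * Two by two matrices and SL(Gamma_n) *)

Section Matrix2.
Variable A : nzRingType.

Definition mat2 (a b c d : A) : 'M[A]_2 :=
  \matrix_(i, j) if i == 0 then (if j == 0 then a else b) else (if j == 0 then c else d).

Lemma mat2_00 a b c d : mat2 a b c d 0 0 = a. Proof. by rewrite mxE. Qed.
Lemma mat2_01 a b c d : mat2 a b c d 0 1 = b. Proof. by rewrite mxE. Qed.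
Lemma mat2_10 a b c d : mat2 a b c d 1 0 = c. Proof. by rewrite mxE. Qed.
Lemma mat2_11 a b c d : mat2 a b c d 1 1 = d. Proof. by rewrite mxE. Qed.

Lemma ord2P (i : 'I_2) : i = 0 \/ i = 1.
Proof. by case: i => [[|[|]]] // h; [left|right]; apply: val_inj. Qed.

Lemma matrix2P (g h : 'M[A]_2) : g 0 0 = h 0 0 -> g 0 1 = h 0 1 -> g 1 0 = h 1 0 ->
  g 1 1 = h 1 1 -> g = h.
Proof. by move=> *; apply/matrixP => i j; case: (ord2P i) => ->; case: (ord2P j) => ->. Qed.

Lemma mat2_eta (g : 'M[A]_2) : g = mat2 (g 0 0) (g 0 1) (g 1 0) (g 1 1).
Proof. by apply: matrix2P; rewrite mxE. Qed.

Lemma mulmx2E (g h : 'M[A]_2) i j : (g * h) i j = g i 0 * h 0 j + g i 1 * h 1 j.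
Proof.
rewrite mxE big_ord_recl big_ord1; congr (_ + g i _ * h _ j); exact: val_inj.
Qed.

Lemma mat2M a b c d a' b' c' d' : mat2 a b c d * mat2 a' b' c' d' =
  mat2 (a * a' + b * c') (a * b' + b * d') (c * a' + d * c') (c * b' + d * d').
Proof.
by apply: matrix2P; rewrite mulmx2E !(mat2_00, mat2_01, mat2_10, mat2_11).
Qed.

Lemma mat2_1 : 1 = mat2 1 0 0 1.
Proof. by apply: matrix2P; rewrite !mxE. Qed.

Lemma mat2D a b c d a' b' c' d' : mat2 a b c d + mat2 a' b' c' d' =
  mat2 (a + a') (b + b') (c + c') (d + d').
Proof. by apply: matrix2P; rewrite !mxE. Qed.

Lemma mat2B a b c d a' b' c' d' : mat2 a b c d - mat2 a' b' c' d' =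
  mat2 (a - a') (b - b') (c - c') (d - d').
Proof. by apply: matrix2P; rewrite !mxE. Qed.

Lemma mat2_0 : mat2 0 0 0 0 = 0.
Proof. by apply: matrix2P; rewrite !mxE. Qed.

Lemma ppart_mat2 a b c d : ppart (mat2 a b c d) = mat2 0 b c 0.
Proof. by apply: matrix2P; rewrite !mxE. Qed.

Definition mat2_entry := (mat2_00, mat2_01, mat2_10, mat2_11).
End Matrix2.

(** * SL(Gamma_n) is a group *)

Section GammaTheory.
Variables (R : realFieldType) (n : nat).
Implicit Types (a b c d u w x y z : cliff R n) (v : 'rV[R]_n) (r : R)
  (g h : 'M[cliff R n]_2).

Lemma Gamma_neq0 a : Gamma a -> a != 0.
Proof.
move=> /Gamma_rinv[h _]; apply/eqP => a0; move: h; rewrite a0 mul0r => /eqP.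
by rewrite eq_sym oner_eq0.
Qed.

Lemma Gamma0_Gamma a : Gamma0 a -> a != 0 -> Gamma a.
Proof. by move=> [//|->]; rewrite eqxx. Qed.

Lemma Gamma0_vec v : Gamma0 (clvec v).
Proof.
by have [->|h] := eqVneq v 0; [right; rewrite linear0|left; exact: Gamma_vec].
Qed.

Lemma Gamma0M a b : Gamma0 a -> Gamma0 b -> Gamma0 (a * b).
Proof.
move=> [ga|->]; last by right; rewrite mul0r.
by move=> [gb|->]; [left; exact: Gamma_mul|right; rewrite mulr0].
Qed.

Lemma Gamma_tr a : Gamma a -> Gamma (cltr a).
Proof.
elim=> {a} [v v0||a b _ ha _ hb|a ga ha].
- by rewrite cltr_vec; exact: Gamma_vec.
- by rewrite cltr1; exact: Gamma_1.
- by rewrite cltrM; exact: Gamma_mul.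
- rewrite (_ : cltr (rinv a) = rinv (cltr a)); first exact: Gamma_inv.
  have [h h'] := Gamma_rinv ga.
  by symmetry; apply: rinvE; rewrite -cltrM (h, h') cltr1.
Qed.

Lemma Gamma0_tr a : Gamma0 a -> Gamma0 (cltr a).
Proof. by move=> [h|->]; [left; exact: Gamma_tr|right; rewrite linear0]. Qed.

(** -1 is the square of a unit vector. For n = 0 there is no nonzero vector and the Clifford group
    is trivial; hence the condition [0 < n] wherever inverse matrices must lie in SL(Gamma_n). *)
Lemma GammaN1 : (0 < n)%N -> Gamma (-1 : cliff R n).
Proof.
move=> n0; pose v := delta_mx 0 (Ordinal n0) : 'rV[R]_n.
have v1 : dotv v v = 1.
  rewrite /dotv (bigD1 (Ordinal n0)) //= big1 ?addr0 => [|i /negbTE h].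
    by rewrite mxE !eqxx mulr1.
  by rewrite mxE h andbF mul0r.
have v0 : v != 0 by rewrite -dotv_eq0 v1 oner_eq0.
rewrite -(_ : clvec v * clvec v = -1); first by apply: Gamma_mul; exact: Gamma_vec.
by rewrite clvec_sqr v1 scaleN1r.
Qed.

Lemma Gamma0N a : (0 < n)%N -> Gamma0 a -> Gamma0 (- a).
Proof. by move=> n0 h; rewrite -mulN1r; apply: Gamma0M => //; left; exact: GammaN1. Qed.

Lemma Gamma_scal a : Gamma a -> exists2 r, r != 0 & rinv a = r *: cltr a.
Proof.
move=> ga; have [r r0 [h h']] := Gamma_norm ga; exists r^-1; first by rewrite invr_eq0.
by apply: rinvE; rewrite -(scalerAl, scalerAr) (h, h') scalerA mulVf // scale1r.
Qed.

Lemma Gamma0_norm a : Gamma0 a -> exists r, a * cltr a = r *: 1 /\ cltr a * a = r *: 1.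
Proof.
move=> [/Gamma_norm[r _ h]|->]; first by exists r.
by exists 0; rewrite mul0r linear0 mul0r scale0r.
Qed.

Lemma Gamma0_conj a x : Gamma0 a -> is_vec x ->
  is_vec (a * x * cltr a) /\ is_vec (cltr a * x * a).
Proof.
move=> [ga [v ->]|-> _]; first exact: Gamma_conj.
by rewrite linear0 !mulr0; split; exact: is_vec0.
Qed.

(** Conjugating the transpose of a^t b by a gives a b^t times the norm of a. For each row and column
    of a matrix the definition of SL(Gamma_n) imposes one of the two orders; this supplies the
    other. *)
Lemma is_vec_tr_swap a b : Gamma0 a -> is_vec (cltr a * b) -> is_vec (a * cltr b).
Proof.
move=> [ga h|-> _]; last by rewrite mul0r; exact: is_vec0.
have [r r0 [ra _]] := Gamma_norm ga.
have -> : a * cltr b = r^-1 *: (a * cltr (cltr a * b) * cltr a).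
  rewrite cltrM cltrK -!mulrA ra -!scalerAr mulr1 scalerA mulVf // scale1r //.
by apply: is_vecZ; rewrite (is_vec_tr h); apply: (Gamma0_conj (or_introl ga) h).1.
Qed.

Lemma is_vec_tr_swapV a b : Gamma0 a -> is_vec (a * cltr b) -> is_vec (cltr a * b).
Proof.
move=> ga h; rewrite -{1}(cltrK b).
by apply: is_vec_tr_swap; [exact: Gamma0_tr|rewrite cltrK].
Qed.

Lemma is_vec_comm a b : is_vec (a * cltr b) -> b * cltr a = a * cltr b.
Proof. by move=> /is_vec_tr <-; rewrite cltrM cltrK. Qed.

Lemma is_vec_commV a b : is_vec (cltr a * b) -> cltr b * a = cltr a * b.
Proof. by move=> /is_vec_tr <-; rewrite cltrM cltrK. Qed.

Lemma vec_quotient a c : Gamma c -> is_vec (a * cltr c) -> is_vec (a * rinv c).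
Proof. by move=> /Gamma_scal[r _ ->] h; rewrite -scalerAr; exact: is_vecZ. Qed.

Lemma Gamma_mulKr a c : Gamma c -> a * rinv c * c = a.
Proof. by move=> /Gamma_rinv[_ h]; rewrite -mulrA h mulr1. Qed.

(** For a in Gamma, a x + b = a (x + a^-1 b) where a^-1 b is a vector, so the sum is a product in
    Gamma or zero. *)
Lemma Gamma0_affine a b x : Gamma0 a -> Gamma0 b -> is_vec (cltr a * b) ->
  is_vec x -> Gamma0 (a * x + b).
Proof.
move=> [ga|->]; last by rewrite mul0r add0r.
move=> _ h [v ->]; have [r r0 [ra _]] := Gamma_norm ga; have [w hw] := h.
have -> : b = a * (r^-1 *: (cltr a * b)).
  by rewrite -scalerAr mulrA ra -scalerAl mul1r scalerA mulVf // scale1r.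
by rewrite hw -linearZ -mulrDr -linearD; apply: Gamma0M (Gamma0_vec _); left.
Qed.

(** Homogeneous coordinates of u w^-1, except that the zero column is allowed; nonvanishing is
    carried separately. *)
Definition column u w := [/\ Gamma0 u, Gamma0 w & is_vec (u * cltr w)].

Section Action.
Variables (g : 'M[cliff R n]_2) (sg : SLGamma g).
Let a := g 0 0.
Let b := g 0 1.
Let c := g 1 0.
Let d := g 1 1.

Lemma SL_bottom_neq0 : c != 0 -> Gamma c /\ is_vec (c * cltr d).
Proof.
case: sg; rewrite -/a -/b -/c -/d => -[_ _ gc _] [_ _ _ vcd] _ c0.
by split; [exact: Gamma0_Gamma|exact: is_vec_tr_swap].
Qed.

Lemma SL_vec_quotient x : is_vec x -> is_vec ((a * x + b) * cltr (c * x + d)).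
Proof.
case: sg; rewrite -/a -/b -/c -/d => -[ga gb gc gd] [vac vbd vab vcd] det vx.
(* When c = 0, the determinant makes d^t a multiple of a^t, and a x d^t is a multiple of a conjugate
   of x. *)
have [c0|c0] := eqVneq c 0.
  rewrite c0 mul0r add0r mulrDl; apply: is_vecD => //.
  move: det; rewrite c0 linear0 mulr0 subr0 => det.
  have {}ga : Gamma a.
    apply: Gamma0_Gamma => //; apply/eqP => a0; move: det; rewrite a0 mul0r => /eqP.
    by rewrite eq_sym oner_eq0.
  have [r r0 [_ ra]] := Gamma_norm ga.
  have -> : cltr d = r^-1 *: cltr a.
    rewrite -[X in _ *: X]mulr1 -det mulrA ra -scalerAl mul1r scalerA mulVf //.
    by rewrite scale1r.
  by rewrite -scalerAr; apply: is_vecZ; case: (Gamma0_conj (or_introl ga) vx).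
have [{}gc vcd'] := SL_bottom_neq0 c0.
have [r r0 [rc rc']] := Gamma_norm gc.
(* p = a c^-1 is the image of infinity. The determinant gives a x + b = p (c x + d) - (c^t)^-1, with
   (c^t)^-1 = [r^-1 *: c]. *)
pose p := r^-1 *: (a * cltr c).
have vp : is_vec p by apply: is_vecZ.
have ap : a = p * c.
  by rewrite /p -scalerAl -mulrA rc' -scalerAr mulr1 scalerA mulVf // scale1r.
pose X := c * x + d.
have -> : a * x + b = p * X - r^-1 *: c.
  rewrite /X mulrDr mulrA -ap -addrA; congr (_ + _).
  have e : (b - p * d) * cltr c = -1.
    rewrite mulrBl -mulrA (is_vec_comm vcd') mulrA -ap.
    by apply: oppr_inj; rewrite opprB det opprK.
  have : (b - p * d) * cltr c * c = - c by rewrite e mulN1r.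
  rewrite -mulrA rc' -scalerAr mulr1 => /(congr1 (fun y => r^-1 *: y)).
  rewrite scalerA mulVf // scale1r scalerN => /eqP.
  by rewrite subr_eq addrC => /eqP.
rewrite -/X mulrBl -mulrA; apply: is_vecD.
  have [s [-> _]] := Gamma0_norm (Gamma0_affine (or_introl gc) gd vcd vx).
  by rewrite -scalerAr mulr1; apply: is_vecZ.
apply: is_vecN; rewrite -scalerAl; apply: is_vecZ.
rewrite /X linearD /= cltrM (is_vec_tr vx) mulrDr mulrA; apply: is_vecD => //.
by case: (Gamma0_conj (or_introl gc) vx).
Qed.

(** A nonzero w factors out on the right, which reduces to the affine point u w^-1; for w = 0 only
    the first column of g counts. *)
Lemma SL_column u w : column u w -> column (a * u + b * w) (c * u + d * w).
Proof.
case: sg; rewrite -/a -/b -/c -/d => -[ga gb gc gd] [vac vbd vab vcd] det [gu gw vuw].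
have [w0|w0] := eqVneq w 0.
  rewrite w0 !mulr0 !addr0; split; [exact: Gamma0M|exact: Gamma0M|].
  rewrite cltrM mulrA -(mulrA a); have [r [-> _]] := Gamma0_norm gu.
  by rewrite -scalerAr mulr1 -scalerAl; apply: is_vecZ.
have {}gw := Gamma0_Gamma gw w0.
have vx := vec_quotient gw vuw.
have ux := Gamma_mulKr u gw.
rewrite -ux; move: (u * rinv w) vx => x vx.
rewrite !mulrA -!mulrDl; split.
- by apply: Gamma0M (or_introl gw); exact: Gamma0_affine.
- by apply: Gamma0M (or_introl gw); exact: Gamma0_affine.
- have [r _ [rw _]] := Gamma_norm gw.
  rewrite cltrM mulrA -(mulrA _ w) rw -scalerAr mulr1 -scalerAl.
  by apply/is_vecZ/SL_vec_quotient.
Qed.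
End Action.

(** The inverse of an element of SL(Gamma_n), written without inverting entries. It reverses
    products of arbitrary matrices, as transposition does. *)
Definition adj2 (g : 'M[cliff R n]_2) : 'M[cliff R n]_2 :=
  mat2 (cltr (g 1 1)) (- cltr (g 0 1)) (- cltr (g 1 0)) (cltr (g 0 0)).

Lemma adj2M g h : adj2 (g * h) = adj2 h * adj2 g.
Proof.
rewrite /adj2 mat2M !mulmx2E !linearD /= !cltrM.
by congr mat2; rewrite ?mulrN ?mulNr ?opprK ?opprD // addrC.
Qed.

Lemma SL_adj2r g : SLGamma g -> g * adj2 g = 1.
Proof.
move=> [[ga gb gc gd] [vac vbd vab vcd] det].
rewrite {1}[g]mat2_eta /adj2 mat2M mat2_1 !mulrN.
have vab' := is_vec_tr_swap ga vab; have vcd' := is_vec_tr_swap gc vcd.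
congr mat2 => //; first by rewrite (is_vec_comm vab') addNr.
  by rewrite (is_vec_comm vcd') subrr.
by rewrite -cltr1 -det linearB /= !cltrM !cltrK addrC.
Qed.

Lemma SL_adj2l g : SLGamma g -> adj2 g * g = 1.
Proof.
move=> [[ga gb gc gd] [vac vbd vab vcd] det].
have vca := is_vec_commV (is_vec_tr_swapV ga vac).
have vdb := is_vec_commV (is_vec_tr_swapV gb vbd).
(* The entries do not commute, so the second determinant relation needs a proof: either d = 0 and b,
   c are proportional, or multiplication by d^t on the right reduces it to the first relation and
   d^t is cancelled. *)
have key : cltr (g 1 1) * g 0 0 - cltr (g 0 1) * g 1 0 = 1.
  have [d0|d0] := eqVneq (g 1 1) 0.
    move: det; rewrite d0 linear0 mulr0 mul0r !sub0r => det.
    have gb' : Gamma (g 0 1).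
      apply: Gamma0_Gamma => //; apply/eqP => b0; move: det; rewrite b0 mul0r oppr0.
      by move/eqP; rewrite eq_sym oner_eq0.
    have [r r0 [_ rb]] := Gamma_norm gb'.
    have h : - cltr (g 1 0) = r^-1 *: cltr (g 0 1).
      rewrite -[X in _ *: X]mulr1 -det mulrN mulrA rb -scalerAl mul1r scalerN scalerA.
      by rewrite mulVf // scale1r.
    have {}h : - g 1 0 = r^-1 *: g 0 1 by rewrite -[LHS]cltrK linearN /= h linearZ /= cltrK.
    by rewrite -mulrN h -scalerAr rb scalerA mulVf // scale1r.
  have gd' := Gamma0_Gamma gd d0.
  have [r r0 [rd rd']] := Gamma_norm gd'.
  have vcd' := is_vec_tr_swap gc vcd.
  have e : (cltr (g 1 1) * g 0 0 - cltr (g 0 1) * g 1 0) * cltr (g 1 1) = cltr (g 1 1).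
    rewrite mulrBl -!mulrA -(is_vec_comm vcd') [in X in _ - X]mulrA -vdb.
    by rewrite -mulrA -mulrBr det mulr1.
  have := congr1 (fun y => r^-1 *: (y * g 1 1)) e.
  by rewrite -!mulrA rd' -!scalerAr mulr1 !scalerA mulVf // !scale1r.
rewrite {2}[g]mat2_eta /adj2 mat2M mat2_1 !mulNr.
congr mat2 => //; first by rewrite vdb subrr.
  by rewrite vca addNr.
by rewrite -cltr1 -key linearB /= !cltrM !cltrK addrC.
Qed.

Lemma SL_rinv g : SLGamma g -> rinv g = adj2 g.
Proof. by move=> sg; apply: rinvE; [exact: SL_adj2r|exact: SL_adj2l]. Qed.

Hypothesis n_gt0 : (0 < n)%N.

Lemma SL_adj2 g : SLGamma g -> SLGamma (adj2 g).
Proof.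
move=> sg; have det := congr1 (fun M : 'M[cliff R n]_2 => M 0 0) (SL_adj2l sg).
move: sg => [[ga gb gc gd] [vac vbd vab vcd] _].
rewrite /SLGamma /adj2 !mat2_entry; split.
- by split; rewrite ?linearN; try apply: Gamma0N => //; exact: Gamma0_tr.
- rewrite !linearN /= !cltrK !mulrN !mulNr.
  split; apply: is_vecN; [by rewrite is_vec_commV|by rewrite is_vec_commV| |].
    by rewrite is_vec_comm.
  by rewrite is_vec_comm.
- by rewrite !cltrK linearN /= cltrK mulNr mulrN opprK; move: det; rewrite mulmx2E /adj2 !mat2_entry mxE mulNr.
Qed.

Lemma SL_column0 g : SLGamma g -> column (g 0 0) (g 1 0).
Proof. by move=> [[ga gb gc gd] [vac vbd vab vcd] _]. Qed.

Lemma SL_column1 g : SLGamma g -> column (g 0 1) (g 1 1).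
Proof. by move=> [[ga gb gc gd] [vac vbd vab vcd] _]. Qed.

(** Multiplication by g preserves columns, which gives the entries and the two column conditions.
    The row conditions of g h are column conditions of [adj2 (g * h)], and the determinant is an
    entry of the product of g h with its [adj2]. *)
Lemma SLGammaM g h : SLGamma g -> SLGamma h -> SLGamma (g * h).
Proof.
move=> sg sh.
have [ga gc vac] := SL_column sg (SL_column0 sh).
have [gb gd vbd] := SL_column sg (SL_column1 sh).
have [_ _ h1] := SL_column (SL_adj2 sh) (SL_column0 (SL_adj2 sg)).
have [_ _ h2] := SL_column (SL_adj2 sh) (SL_column1 (SL_adj2 sg)).
have adjE := adj2M g h.
have det : (g * h) * adj2 (g * h) = 1.
  by rewrite adjE mulrA -(mulrA g) SL_adj2r // mulr1 SL_adj2r.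
split.
- by split; rewrite mulmx2E.
- move: h1 h2; rewrite -!mulmx2E -adjE /adj2 !mat2_entry !linearN /= !cltrK !mulrN !mulNr.
  move=> /is_vecN; rewrite opprK => h1 /is_vecN; rewrite opprK => h2.
  split; [by rewrite !mulmx2E|by rewrite !mulmx2E| |].
    by rewrite is_vec_commV.
  by rewrite is_vec_commV.
- have := congr1 (fun M : 'M[cliff R n]_2 => M 0 0) det.
  by rewrite mulmx2E [RHS]mxE /adj2 !mat2_entry mulrN.
Qed.
End GammaTheory.

(** * The action on the sphere in homogeneous coordinates *)

Section Sphere.
Variables (R : realType) (n : nat).
Implicit Types (b : bool) (u w x y z : cliff R n) (v : 'rV[R]_n) (r : R)
  (g h : 'M[cliff R n]_2) (s : sphere R n).

(* (u, w) are homogeneous coordinates of the point u w^-1 of the sphere. *)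
Definition hcoord u w s : Prop :=
  if s is Some x then Gamma w /\ u = clvec x * w else Gamma u /\ w = 0.

Lemma hcoord_inj u w s s' : hcoord u w s -> hcoord u w s' -> s = s'.
Proof.
case: s => [x|]; case: s' => [x'|] //=.
- move=> [gw ->] [_ e]; congr Some; apply: clvec_inj.
  by have [h _] := Gamma_rinv gw; rewrite -[LHS]mulr1 -h mulrA e -mulrA h mulr1.
- by move=> [/Gamma_neq0/eqP gw _] [_ w0].
- by move=> [_ w0] [/Gamma_neq0/eqP gw _].
Qed.

Lemma hcoordMr u w k s : Gamma k -> hcoord u w s -> hcoord (u * k) (w * k) s.
Proof.
move=> gk; case: s => [x|] /= [g ->]; last by rewrite mul0r; split=> //; exact: Gamma_mul.
by rewrite mulrA; split=> //; exact: Gamma_mul.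
Qed.

Lemma column_hcoord u w : column u w -> (u != 0) || (w != 0) ->
  hcoord u w (if w == 0 then infty R n else fin_pt (vecpart (u * rinv w))).
Proof.
move=> [gu gw vuw]; case: (w =P 0) => [->|/eqP w0] /=.
  by rewrite orbF => u0; split => //; exact: Gamma0_Gamma.
move=> _; have {}gw := Gamma0_Gamma gw w0; split => //.
have [v hv] := vec_quotient gw vuw.
by rewrite hv clvecK -hv Gamma_mulKr.
Qed.

Lemma SL_column_inj g u w : SLGamma g ->
  (u != 0) || (w != 0) -> (g 0 0 * u + g 0 1 * w != 0) || (g 1 0 * u + g 1 1 * w != 0).
Proof.
move=> sg; apply: contraTT; rewrite !negb_or !negbK => /andP[/eqP h0 /eqP h1].
have e (i : 'I_2) : (adj2 g * g) i 0 * u + (adj2 g * g) i 1 * w = 0.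
  rewrite !mulmx2E !mulrDl addrACA -!mulrA -!mulrDr.
  by rewrite h0 h1 !mulr0 addr0.
have := e 0; have := e 1; rewrite SL_adj2l // !mxE /=.
by rewrite !mul1r !mul0r addr0 add0r => -> ->; rewrite eqxx.
Qed.

(** In homogeneous coordinates the action is linear, so that composing actions becomes matrix
    multiplication, with no cases for vanishing denominators. *)
Lemma act_hcoord g u w s : SLGamma g -> hcoord u w s ->
  hcoord (g 0 0 * u + g 0 1 * w) (g 1 0 * u + g 1 1 * w) (act g s).
Proof.
move=> sg; case: s => [x|] [gu hu].
  have cx : column (clvec x) 1.
    by split; [exact: Gamma0_vec|left; exact: Gamma_1|rewrite cltr1 mulr1; exists x].
  have h0 : (clvec x != 0) || ((1 : cliff R n) != 0) by rewrite oner_eq0 orbT.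
  have := column_hcoord (SL_column sg cx) (SL_column_inj sg h0).
  rewrite !mulr1 -/(act g (Some x)) => /(hcoordMr gu).
  by rewrite !mulrDl -!mulrA -hu.
have cx : column 1 (0 : cliff R n).
  by split; [left; exact: Gamma_1|right|rewrite linear0 mulr0; exact: is_vec0].
have h0 : ((1 : cliff R n) != 0) || ((0 : cliff R n) != 0) by rewrite oner_eq0.
have := column_hcoord (SL_column sg cx) (SL_column_inj sg h0).
rewrite !mulr1 !mulr0 !addr0 -/(act g None) => /(hcoordMr gu).
by rewrite hu !mulr0 !addr0.
Qed.

Lemma hcoord_fin v : hcoord (clvec v) 1 (fin_pt v).
Proof. by split; [exact: Gamma_1|rewrite mulr1]. Qed.

Lemma hcoord_infty : hcoord 1 0 (infty R n).
Proof. by split; [exact: Gamma_1|]. Qed.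

Lemma actM g h s : SLGamma g -> SLGamma h -> SLGamma (g * h) ->
  act (g * h) s = act g (act h s).
Proof.
move=> sg sh sgh.
have key u w : hcoord u w s -> act (g * h) s = act g (act h s).
  move=> hs; apply: (hcoord_inj (act_hcoord sgh hs)).
  rewrite !mulmx2E; have := act_hcoord sg (act_hcoord sh hs).
  by rewrite !mulrDr !mulrDl !mulrA [X in hcoord X]addrACA [X in hcoord _ X]addrACA.
by case: s key => [x|] key; [exact: (key _ _ (hcoord_fin x))|exact: (key _ _ hcoord_infty)].
Qed.

Lemma SL1 : SLGamma (1 : 'M[cliff R n]_2).
Proof.
rewrite /SLGamma !mxE /= !linear0 !mulr0 !cltr1 !mul0r !mulr1 subr0.
split=> //; last by split; exact: is_vec0.
by split; [left; exact: Gamma_1|right|right|left; exact: Gamma_1].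
Qed.

Lemma act1 s : act 1 s = s.
Proof.
have key u w : hcoord u w s -> act 1 s = s.
  move=> hs; apply: (hcoord_inj (act_hcoord SL1 hs)).
  by rewrite !mxE /= !mul1r !mul0r addr0 add0r.
by case: s key => [x|] key; [exact: (key _ _ (hcoord_fin x))|exact: (key _ _ hcoord_infty)].
Qed.

Lemma actK g : (0 < n)%N -> SLGamma g -> cancel (act g) (act (adj2 g)).
Proof.
move=> n0 sg s; rewrite -actM ?SL_adj2l ?act1 //; first exact: SL_adj2.
exact: SL1.
Qed.

(** A boolean index, so that one statement about a pair of charts covers all four combinations. *)
Definition schart (b : bool) : chart R (sphere R n) n :=
  if b then sphere_chart1 R n else sphere_chart0 R n.

Lemma schart_atlas b : sphere_atlas (schart b).
Proof. by case: b; [right|left]. Qed.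

Lemma sphere_atlasP psi : sphere_atlas psi -> exists b, psi = schart b.
Proof. by case=> ->; [exists false|exists true]. Qed.

Lemma cover_schart s : exists b, cdom (schart b) s.
Proof. by case: s => [x|]; [exists false|exists true]. Qed.

(** With [chw]: homogeneous coordinates of the point with coordinate v in chart b. In the Clifford
    algebra [inversion v] is - v^-1, hence the column (1, - v) for the chart around infinity. *)
Definition chu (b : bool) v : cliff R n := if b then 1 else clvec v.
Definition chw (b : bool) v : cliff R n := if b then - clvec v else 1.

Lemma inversion_clvec v : v != 0 -> clvec (inversion v) * clvec v = -1.
Proof.
rewrite -dotv_eq0 => v0.
by rewrite /inversion linearZ -scalerAl clvec_sqr scalerA mulrN mulVf // scaleN1r.
Qed.

Lemma hcoord_cinv b v : hcoord (chu b v) (chw b v) (cinv (schart b) v).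
Proof.
case: b => /=; last exact: hcoord_fin.
have [->|v0] := eqVneq v 0; first by rewrite linear0 oppr0; exact: hcoord_infty.
split; first by rewrite -linearN; apply: Gamma_vec; rewrite oppr_eq0.
by rewrite mulrN inversion_clvec // opprK.
Qed.

(** With [chden]: the coordinate of u w^-1 in chart b as a quotient. Around infinity it is - (u
    w^-1)^-1 = - w u^-1. *)
Definition chnum (b : bool) u w : cliff R n := if b then - w else u.
Definition chden (b : bool) u w : cliff R n := if b then u else w.

Lemma hcoord_chartP b u w s : hcoord u w s ->
  if chden b u w == 0 then ~ cdom (schart b) s
  else [/\ cdom (schart b) s, Gamma (chden b u w) &
        chnum b u w = clvec (cmap (schart b) s) * chden b u w].
Proof.
case: b; case: s => [x|] /= [g hu].
- have [x0|x0] := eqVneq x 0; first by rewrite hu x0 linear0 mul0r eqxx /=; apply.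
  have gu : Gamma u by rewrite hu; apply: Gamma_mul => //; exact: Gamma_vec.
  rewrite (negbTE (Gamma_neq0 gu)); split=> //; first by move=> [] /eqP; rewrite (negbTE x0).
  by rewrite hu mulrA inversion_clvec // mulN1r.
- by rewrite (negbTE (Gamma_neq0 g)); split=> //; rewrite hu oppr0 linear0 mul0r.
- by rewrite (negbTE (Gamma_neq0 g)).
- by rewrite hu eqxx /=; apply.
Qed.

Lemma inversionK v : inversion (inversion v) = v.
Proof.
have [->|v0] := eqVneq v 0; first by rewrite /inversion !scaler0.
rewrite /inversion dotvZl dotvZr; rewrite -dotv_eq0 in v0.
rewrite scalerA (_ : _ * _ = 1) ?scale1r //.
by field.
Qed.

Lemma schartK b s : cdom (schart b) s -> cinv (schart b) (cmap (schart b) s) = s.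
Proof.
case: b; case: s => [x|] //=.
- have [->|x0] := eqVneq x 0; first by move=> [].
  move=> _; rewrite inversionK ifN //.
  by apply: contraNneq x0 => h; rewrite -(inversionK x) h /inversion scaler0.
- by rewrite eqxx.
Qed.

Definition clnorm x : R := clcoef (x * cltr x) finset.set0.
(** The vector x y^-1, through y^-1 = y^t / (y y^t). Unlike [rinv], which is picked by choice, this
    is visibly rational in the coefficients. *)
Definition clquot x y : 'rV[R]_n := (clnorm y)^-1 *: vecpart (x * cltr y).

Lemma clnorm_Gamma x : Gamma x -> clnorm x != 0 /\ x * cltr x = clnorm x *: 1.
Proof.
move=> /Gamma_norm[r r0 [h _]].
by rewrite /clnorm h clcoefZ clcoef1 eqxx mulr1.
Qed.

Lemma clquotE v y : Gamma y -> clquot (clvec v * y) y = v.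
Proof.
move=> /clnorm_Gamma[y0 h].
by rewrite /clquot -mulrA h -scalerAr mulr1 linearZ /= clvecK scalerA mulVf // scale1r.
Qed.

(* In the charts b and b' the action of g is v |-> trnum v * (trden v)^-1. *)
Definition trnum g (b b' : bool) v := chnum b'
  (g 0 0 * chu b v + g 0 1 * chw b v) (g 1 0 * chu b v + g 1 1 * chw b v).
Definition trden g (b b' : bool) v := chden b'
  (g 0 0 * chu b v + g 0 1 * chw b v) (g 1 0 * chu b v + g 1 1 * chw b v).
Definition transition g b b' v := clquot (trnum g b b' v) (trden g b b' v).

Lemma transition_dom g b b' s : SLGamma g -> cdom (schart b) s ->
  cdom (schart b') (act g s) <-> clnorm (trden g b b' (cmap (schart b) s)) != 0.
Proof.
move=> sg ds; have := hcoord_cinv b (cmap (schart b) s); rewrite schartK // => hs.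
have := hcoord_chartP b' (act_hcoord sg hs); rewrite -/(trden _ _ _ _).
case: eqP => [->|_ [dom gd _]]; last by split=> // _; case: (clnorm_Gamma gd).
by rewrite /clnorm mul0r clcoef0 eqxx.
Qed.

Lemma transitionE g b b' s : SLGamma g -> cdom (schart b) s -> cdom (schart b') (act g s) ->
  cmap (schart b') (act g s) = transition g b b' (cmap (schart b) s).
Proof.
move=> sg ds ds'; have := hcoord_cinv b (cmap (schart b) s); rewrite schartK // => hs.
have := hcoord_chartP b' (act_hcoord sg hs); rewrite /transition -/(trden _ _ _ _).
case: eqP => [_ /(_ ds')//|_ [_ gd e]].
by rewrite /trnum e clquotE.
Qed.
End Sphere.

(** * Brackets of tangent vectors *)

Section MovingFrame.
Variable A : nzRingType.
Implicit Types (a b c d z i : A) (g h k : 'M[A]_2).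

Definition frame (z zh : A) := mat2 zh z 1 1.
(** The inverse of [frame z zh] when i is the inverse of zh - z. *)
Definition frameV (z zh i : A) := mat2 i (- (i * z)) (- i) (i * zh).

Section Frame.
Variables (z zh i : A).
Hypotheses (zi : (zh - z) * i = 1) (iz : i * (zh - z) = 1).

Lemma frameV_mul : frameV z zh i * frame z zh = 1.
Proof.
rewrite mat2M mat2_1 !mulr1 -mulrBr iz subrr !mulNr addNr.
by rewrite addrC -mulrBr iz.
Qed.

(* Ad(g0) of the p-part of g0^-1 dg0, for g0 = frame z zh and points z, zh moving with
   velocities dz, dzh. *)
Definition frame_tangent (dz dzh : A) : 'M[A]_2 :=
  frame z zh * mat2 0 (i * dz) (- (i * dzh)) 0 * frameV z zh i.

(** Here k is the inverse of the frame h and B its derivative: the conditions on B are the Leibniz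
    rule applied to h00 = zh h10 and h01 = z h11. The derivative of the diagonal factor of h
    contributes only diagonal terms, which [ppart] removes, and the conjugation cancels the factor
    itself. *)
Lemma frame_ppart h k (dz dzh c' d' : A) :
  h * k = 1 -> k * h = 1 ->
  h 0 0 = zh * h 1 0 -> h 0 1 = z * h 1 1 ->
  h 1 0 * c' = 1 -> c' * h 1 0 = 1 -> h 1 1 * d' = 1 -> d' * h 1 1 = 1 ->
  forall B : 'M[A]_2, B 0 0 = dzh * h 1 0 + zh * B 1 0 -> B 0 1 = dz * h 1 1 + z * B 1 1 ->
  h * ppart (k * B) * k = frame_tangent dz dzh.
Proof.
move=> hk kh; set c := h 1 0; set d := h 1 1 => h00 h01 cc c'c dd d'd B B00 B01.
have hE : h = frame z zh * mat2 c 0 0 d.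
  by rewrite [LHS]mat2_eta h00 h01 mat2M !mulr0 !mul1r !add0r !addr0.
have kE : k = mat2 c' 0 0 d' * frameV z zh i.
  have e : mat2 c' 0 0 d' * frameV z zh i * h = 1.
    rewrite hE mulrA -(mulrA _ (frameV z zh i)) frameV_mul mulr1 mat2M.
    by rewrite !mulr0 !mul0r !addr0 !add0r c'c d'd mat2_1.
  by rewrite -[RHS]mulr1 -hk mulrA e mul1r.
(* The first summand comes from the derivative of [frame z zh], the second from that of the diagonal
   factor. *)
have BE : B = frame z zh * (mat2 (i * dzh) (i * dz) (- (i * dzh)) (- (i * dz)) * mat2 c 0 0 d +
    mat2 (B 1 0) 0 0 (B 1 1)).
  have N : frame z zh * mat2 (i * dzh) (i * dz) (- (i * dzh)) (- (i * dz)) = mat2 dzh dz 0 0.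
    by rewrite mat2M !mulrN !mul1r !subrr !mulrA -!mulrBl zi !mul1r.
  rewrite mulrDr mulrA N !mat2M mat2D [LHS]mat2_eta B00 B01.
  by rewrite !(mulr0, mul0r, addr0, add0r, mul1r).
have kBE : ppart (k * B) = mat2 0 (c' * (i * dz) * d) (- (d' * (i * dzh) * c)) 0.
  rewrite kE BE -mulrA (mulrA (frameV _ _ _)) frameV_mul mul1r.
  rewrite mat2M mat2D mat2M ppart_mat2 !(mulr0, mul0r, addr0, add0r).
  by rewrite mulNr mulrN !mulrA.
rewrite kBE {1}hE kE /frame_tangent -!mulrA; congr (_ * _).
rewrite !mulrA; congr (_ * _); rewrite !mat2M.
rewrite !(mulr0, mul0r, addr0, add0r) !mulrA cc mul1r -(mulrA _ d) dd mulr1.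
by rewrite mulrN mulNr !mulrA dd mul1r -[_ * c * c']mulrA cc mulr1.
Qed.

Lemma lie_frame_tangent a a' b b' :
  lie (frame_tangent a b) (frame_tangent a' b') = 0 <->
  a * i * b' = a' * i * b /\ b * i * a' = b' * i * a.
Proof.
pose N a b := mat2 0 (i * a) (- (i * b)) 0.
have E : lie (frame_tangent a b) (frame_tangent a' b') =
    frame z zh * lie (N a b) (N a' b') * frameV z zh i.
  rewrite /lie /frame_tangent mulrBr mulrBl; congr (_ - _);
    by rewrite -!mulrA (mulrA (frameV _ _ _)) frameV_mul mul1r.
(* The bracket of two off-diagonal matrices is diagonal; the unit i will be cancelled from its
   entries. *)
have L : lie (N a b) (N a' b') = mat2 (i * (a' * i * b - a * i * b')) 0 0 (i * (b' * i * a - b * i * a')).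
  rewrite /lie /N !mat2M mat2B !(mulr0, mul0r, addr0, add0r, oppr0).
  congr (mat2 _ 0 0 _); first by rewrite mulrBr !mulrN opprK addrC !mulrA.
  by rewrite mulrBr !mulNr opprK addrC !mulrA.
have i_inj x : i * x = 0 -> x = 0 by move=> h; rewrite -[x]mul1r -zi -mulrA h mulr0.
rewrite E L; split.
  move=> /(congr1 (fun M => frameV z zh i * M * frame z zh)).
  rewrite !mulrA frameV_mul mul1r -mulrA frameV_mul mulr1 mulr0 mul0r => H.
  have := congr1 (fun M : 'M[A]_2 => M 0 0) H; have := congr1 (fun M : 'M[A]_2 => M 1 1) H.
  by rewrite !mxE /= => /i_inj/subr0_eq -> /i_inj/subr0_eq ->.
by move=> [-> ->]; rewrite !subrr !mulr0 mat2_0 mulr0 mul0r.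
Qed.

Lemma lie_conj g k x y : k * g = 1 -> lie (g * x * k) (g * y * k) = g * lie x y * k.
Proof.
move=> kg; rewrite /lie mulrBr mulrBl; congr (_ - _);
  by rewrite !mulrA -(mulrA _ k) kg mulr1.
Qed.
End Frame.
End MovingFrame.

(** * Differential calculus and the Poincare lemma *)

Section Differentials.
Variables (R : realType) (V W : normedModType R).
Implicit Types (f g : V -> W) (x v : V).

Lemma diff_littleoP f (df : {linear V -> W}) x : continuous df ->
  (forall e, 0 < e -> \forall h \near 0, `|f (h + x) - f x - df h| <= e * `|h|) ->
  differentiable f x.
Proof.
move=> cdf fdf.
have E : f \o shift x = cst (f x) + df +o_ 0 id.
  apply/eqaddoP => e e0; near=> h => /=.
  rewrite !fctE /= opprD addrA.
  by near: h; exact: fdf.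
apply/diff_locallyP; have := diff_unique cdf E => dE.
by rewrite !dE.
Unshelve. all: by end_near. Qed.

(** Functions here are total but matter only on an open set, where another formula may replace
    them. *)
Lemma near_eq_differentiable f g x : (\near x, f x = g x) ->
  differentiable f x -> differentiable g x.
Proof.
move=> fg df; have /diff_locallyP[cdf /eqaddoP fE] := df.
apply: (@diff_littleoP g ('d f x)) => // e e0.
have fgx := nbhs_singleton fg.
have fg' : \forall h \near 0, f (h + x) = g (h + x).
  have := fg; rewrite (near_shift 0) subr0.
  by apply: filterS => y /=; rewrite /shift.
near=> h.
rewrite -(near fg' h) // -fgx.
have H : `|(f \o shift x - (cst (f x) + 'd f x)) h| <= e * `|h|.
  by near: h; exact: fE.
by move: H; rewrite !fctE /= opprD addrA.
Unshelve. all: by end_near. Qed.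

(** Only the derivative in the direction v is assumed, so the chain rule does not apply; the
    difference quotients are literally equal. *)
Lemma is_derive_line f (y v : V) (a : R) d : is_derive (y + a *: v) v f d ->
  is_derive a 1 (fun s : R => f (y + s *: v)) d.
Proof.
move=> [/cvg_ex[l fl] <-].
have E : (fun h : R => h^-1 *: (f (y + (h *: 1 + a) *: v) - f (y + a *: v))) =
    (fun h : R => h^-1 *: (f (h *: v + (y + a *: v)) - f (y + a *: v))).
  apply/funext => h; congr (_ *: (f _ - _)).
  by rewrite [h *: 1]mulr1 scalerDl addrCA.
split; first by apply/cvg_ex; exists l; rewrite /= E.
by rewrite /derive /= E.
Qed.

Lemma differentiable_is_derive f x v : differentiable f x -> is_derive x v f ('d f x v).
Proof. by move=> df; split; [exact: diff_derivable|rewrite deriveE]. Qed.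

End Differentials.

Section Components.
Variables (R : realType) (V : normedModType R) (n : nat).
Implicit Types (f : V -> 'rV[R]_n) (x v : V).

Lemma differentiable_rVP f x :
  differentiable f x <-> forall j, differentiable (fun y => f y 0 j) x.
Proof.
split=> [df j|df].
  exact: (@differentiable_comp _ _ _ _ f (fun M : 'rV[R]_n => M 0 j) _ df
    (differentiable_coord _ _ _)).
rewrite (_ : f = \sum_j (fun y => f y 0 j *: delta_mx 0 j)); last first.
  apply/funext => y; rewrite fct_sumE [LHS]row_sum_delta; exact: eq_bigr.
by apply: differentiable_sum => j; exact: differentiableZl.
Qed.

Lemma derive_rV f x v j : derivable f x v -> ('D_v f x) 0 j = 'D_v (fun y => f y 0 j) x.
Proof. by move=> df; rewrite derive_mx // mxE. Qed.

Lemma is_derive_rVP f x v d :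
  is_derive x v f d <-> forall j, is_derive x v (fun y => f y 0 j) (d 0 j).
Proof.
split=> [[df <-] j|df].
  by rewrite derive_rV //; apply/derivableP; have /derivable_mxP := df; apply.
have df' : derivable f x v by apply/derivable_mxP => i j; rewrite ord1; case: (df j).
split => //; apply/rowP => j; rewrite derive_rV //; by case: (df j).
Qed.

End Components.

Lemma near_open (T : topologicalType) (U : set T) (x : T) : open U -> U x -> nbhs x U.
Proof. by move=> oU Ux; exact: open_nbhs_nbhs. Qed.

(** * Smoothness of scalar functions and of components *)

Section Smooth.
Variables (R : realType) (m : nat).
Implicit Types (U : set 'rV[R]_m) (h : 'rV[R]_m -> R) (k : nat).

(** The scalar counterpart of [Ck], for which products and inverses make sense; [CkP] returns to
    vector-valued maps componentwise. *)
Fixpoint CkS k U h : Prop :=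
  if k is k'.+1 then
    (forall x, U x -> differentiable h x) /\ (forall v, CkS k' U ('D_v h))
  else forall x, U x -> {for x, continuous h}.

Lemma CkS_ext k U h h' : open U -> (forall x, U x -> h x = h' x) -> CkS k U h -> CkS k U h'.
Proof.
move=> oU; elim: k h h' => [|k IH] h h' hh' /= H; last first.
  case: H => dh H; split=> [x Ux|v].
    apply: near_eq_differentiable (dh x Ux).
    by have := near_open oU Ux; apply: filterS => y /hh'.
  apply: IH (H v) => x Ux; apply: near_eq_derive.
  by have := near_open oU Ux; apply: filterS => y /hh'.
move=> x Ux; have E : {near x, h =1 h'} by move: (near_open oU Ux); apply: filterS => y /hh'.
by apply: (cvg_trans (near_eq_cvg E)); rewrite -hh' //; exact: H.
Qed.

Lemma CkS_W k U h : CkS k.+1 U h -> CkS k U h.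
Proof.
elim: k h => [|k IH] h [dh H]; first by move=> x Ux; exact/differentiable_continuous/dh.
by split=> // v; exact/IH/H.
Qed.

Lemma CkS_sub k U U' h : U' `<=` U -> CkS k U h -> CkS k U' h.
Proof.
move=> sU; elim: k h => [|k IH] h /=; first by move=> H x /sU; exact: H.
by move=> [dh H]; split=> [x /sU|v]; [exact: dh|exact/IH/H].
Qed.

Lemma CkS_local k U h : (forall x, U x -> exists2 U', U' x & CkS k U' h) -> CkS k U h.
Proof.
elim: k h => [|k IH] h H /=; first by move=> x /H[U' U'x]; apply.
split=> [x /H[U' U'x [dh _]]|v]; first exact: dh.
by apply: IH => x /H[U' U'x [_ /(_ v) Hv]]; exists U'.
Qed.

Lemma CkS_cst k U c : CkS k U (fun=> c).
Proof.
elim: k c => [|k IH] c /=; first by move=> x _; exact: cst_continuous.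
split=> [x _|v]; first exact: differentiable_cst.
by rewrite (_ : 'D_v _ = fun=> 0) //; apply/funext => x; exact: derive_cst.
Qed.

Lemma CkS_D k U h h' : open U -> CkS k U h -> CkS k U h' -> CkS k U (fun x => h x + h' x).
Proof.
move=> oU; elim: k h h' => [|k IH] h h' /=.
  by move=> H H' x Ux; exact: (continuousD (H x Ux) (H' x Ux)).
move=> [dh H] [dh' H']; split=> [x Ux|v].
  by apply: differentiableD; [exact: dh|exact: dh'].
apply: CkS_ext (IH _ _ (H v) (H' v)) => // x Ux.
by rewrite -(@deriveD _ _ _ h h') //; apply: diff_derivable; [exact: dh|exact: dh'].
Qed.

Lemma CkS_M k U h h' : open U -> CkS k U h -> CkS k U h' -> CkS k U (fun x => h x * h' x).
Proof.
move=> oU; elim: k h h' => [|k IH] h h'.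
  by move=> H H' x Ux; exact: (continuousM (H x Ux) (H' x Ux)).
move=> Hh Hh'; have [dh H] := Hh; have [dh' H'] := Hh'; split=> [x Ux|v].
  by apply: differentiableM; [exact: dh|exact: dh'].
have := CkS_D oU (IH _ _ (CkS_W Hh) (H' v)) (IH _ _ (CkS_W Hh') (H v)).
apply: CkS_ext => // x Ux.
by rewrite -[RHS]/('D_v (h * h') x) deriveM //; apply: diff_derivable; [exact: dh|exact: dh'].
Qed.

Lemma CkS_N k U h : open U -> CkS k U h -> CkS k U (fun x => - h x).
Proof.
move=> oU H; apply: CkS_ext (CkS_M oU (CkS_cst k U (-1)) H) => // x _; exact: mulN1r.
Qed.

Lemma CkS_sum k U (I : Type) (s : seq I) (P : pred I) (F : I -> 'rV[R]_m -> R) : open U ->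
  (forall i, P i -> CkS k U (F i)) -> CkS k U (fun x => \sum_(i <- s | P i) F i x).
Proof.
move=> oU H; elim: s => [|i s IH].
  by apply: CkS_ext (CkS_cst k U 0) => // x _; rewrite big_nil.
have [Pi|nPi] := boolP (P i); last first.
  by apply: CkS_ext IH => // x _; rewrite big_cons (negbTE nPi).
by apply: CkS_ext (CkS_D oU (H i Pi) IH) => // x _; rewrite big_cons Pi.
Qed.

(** Induction on k: the derivative of 1/h is - (1/h)^2 h', in which 1/h is needed with one order of
    regularity less. *)
Lemma CkS_V k U h : open U -> (forall x, U x -> h x != 0) -> CkS k U h ->
  CkS k U (fun x => (h x)^-1).
Proof.
move=> oU h0; elim: k => [|k IH] Hh.
  by move=> x Ux; exact: (continuousV (h0 x Ux) (Hh x Ux)).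
have [dh H] := Hh; split=> [x Ux|v].
  by apply: differentiableV; [exact: dh|exact: h0].
have Hi := IH (CkS_W Hh).
apply: CkS_ext (CkS_N oU (CkS_M oU (CkS_M oU Hi Hi) (H v))) => // x Ux.
rewrite deriveV; [|exact: h0|exact/diff_derivable/dh].
by rewrite /= -expr2 exprVn -mulNr.
Qed.

Lemma CkS_coord k U (j : 'I_m) : CkS k U (fun x => x 0 j).
Proof.
case: k => [|k]; first by move=> x _; exact: coord_continuous.
split=> [x _|v]; first exact: differentiable_coord.
rewrite (_ : 'D_v _ = fun=> v 0 j); first exact: CkS_cst.
apply/funext => x; rewrite -derive_rV //.
by rewrite derive_id.
Qed.
End Smooth.

Lemma continuous_rVP (R : realType) (T : topologicalType) n (f : T -> 'rV[R]_n) x :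
  {for x, continuous f} <-> forall j, {for x, continuous (fun y => f y 0 j)}.
Proof.
split=> [cf j|cf].
  by apply: (@continuous_comp _ _ _ f (fun M : 'rV[R]_n => M 0 j)) => //; exact: coord_continuous.
apply/cvgrPdist_le => e e0; near=> y.
rewrite /Num.Def.normr/= mx_normrE (bigmax_le _ (ltW e0)) //= => -[i j] _.
rewrite !mxE /= ord1; move: j; near: y; apply: filter_forall => j.
exact: ((cvgrPdist_le _ _).1 (cf j)).
Unshelve. all: by end_near. Qed.

Section SmoothComp.
Variables (R : realType) (m p : nat).
Implicit Types (U : set 'rV[R]_m) (W : set 'rV[R]_p).

Lemma derive_comp_rV (h : 'rV[R]_p -> R) (g : 'rV[R]_m -> 'rV[R]_p) x v :
  differentiable g x -> differentiable h (g x) ->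
  'D_v (h \o g) x = \sum_j 'D_v (fun y => g y 0 j) x * 'D_(delta_mx 0 j) h (g x).
Proof.
move=> dg dh; rewrite deriveE; last exact: differentiable_comp.
rewrite diff_comp //= -(deriveE v dg) [X in 'd h _ X]row_sum_delta linear_sum /=.
apply: eq_bigr => j _; rewrite linearZ -deriveE // derive_rV //.
exact: diff_derivable.
Qed.

(** Induction on k through the chain rule: the derivatives of h in basis directions, composed with
    g, fall under the induction hypothesis. *)
Lemma CkS_comp k U W h (g : 'rV[R]_m -> 'rV[R]_p) : open U ->
  (forall x, U x -> W (g x)) -> (forall j, CkS k U (fun x => g x 0 j)) -> CkS k W h ->
  CkS k U (h \o g).
Proof.
move=> oU UW; elim: k h => [|k IH] h Hg Hh.
  move=> x Ux; apply: continuous_comp; last exact/Hh/UW.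
  by apply/continuous_rVP => j; exact: Hg.
have dg x : U x -> differentiable g x.
  by move=> Ux; apply/differentiable_rVP => j; case: (Hg j) => + _; apply.
have [dh H] := Hh.
split=> [x Ux|v]; first by apply: differentiable_comp; [exact: dg|exact/dh/UW].
have H2 : CkS k U (fun x => \sum_j 'D_v (fun y => g y 0 j) x * 'D_(delta_mx 0 j) h (g x)).
  apply: CkS_sum => // j _; apply: CkS_M => //; first by case: (Hg j) => _; apply.
  by apply: IH (H _) => i; exact/CkS_W/Hg.
apply: CkS_ext H2 => // x Ux.
by rewrite derive_comp_rV //; [exact: dg|exact/dh/UW].
Qed.

Lemma CkP k U (f : 'rV[R]_m -> 'rV[R]_p) : open U ->
  Ck k U f <-> forall j, CkS k U (fun x => f x 0 j).
Proof.
move=> oU; elim: k f => [|k IH] f /=.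
  split=> [H j x Ux|H x Ux].
    by move: j; apply/continuous_rVP/H.
  by apply/continuous_rVP => j; exact: H.
split=> [[df H] j|H].
  split=> [x Ux|v]; first by move: j; apply/differentiable_rVP/df.
  have /(IH _) /(_ j) := H v; apply: CkS_ext => // x Ux.
  by rewrite derive_rV //; exact/diff_derivable/df.
have df x : U x -> differentiable f x.
  by move=> Ux; apply/differentiable_rVP => j; case: (H j) => + _; apply.
split=> // v; apply/IH => j; have [_ /(_ v)] := H j; apply: CkS_ext => // x Ux.
by rewrite derive_rV //; exact/diff_derivable/df.
Qed.
End SmoothComp.

Lemma normr_coord (R : realType) n (v : 'rV[R]_n) j : `|v 0 j| <= `|v|.
Proof.
rewrite [leRHS]/Num.Def.normr/= mx_normrE.
exact: (le_bigmax _ (fun ij => `|v ij.1 ij.2|) (0, j)).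
Qed.

Lemma compact_normr_bound (R : realType) n (A : set 'rV[R]_n) (h : 'rV[R]_n -> R) :
  compact A -> (forall x, A x -> {for x, continuous h}) ->
  exists2 M, 0 <= M & forall x, A x -> `|h x| <= M.
Proof.
move=> cA ch; have [->|/set0P A0] := eqVneq A set0; first by exists 0.
have [x|c _ cmax] := EVT_max_rV (f := fun x => `|h x|) A0 cA.
  apply: continuous_in_subspaceT x => x /set_mem Ax.
  by apply: (@continuous_comp _ _ _ h Num.norm); [exact: ch|exact: norm_continuous].
by exists `|h c| => // x /mem_set; exact: cmax.
Qed.

(** * Symmetry of second derivatives *)

Section Schwarz.
Variables (R : realType) (m : nat).
Implicit Types (U : set 'rV[R]_m) (h : 'rV[R]_m -> R).

(** The second difference of h over the parallelogram with sides s v and s w, evaluated by the mean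
    value theorem along v and then along w. *)
Lemma MVT_second h x v w (s : R) : 0 < s ->
  (forall a b, 0 <= a <= s -> 0 <= b <= s -> differentiable h (x + b *: w + a *: v)) ->
  (forall a b, 0 <= a <= s -> 0 <= b <= s ->
    differentiable ('D_v h) (x + b *: w + a *: v)) ->
  exists a b, [/\ 0 <= a <= s, 0 <= b <= s &
    h (x + s *: w + s *: v) - h (x + s *: w) - (h (x + s *: v) - h x) =
    'D_w ('D_v h) (x + b *: w + a *: v) * s * s].
Proof.
move=> s0 dh ddh.
pose phi a := h (x + s *: w + a *: v) - h (x + a *: v).
have s_in : 0 <= s <= s by rewrite lexx ltW.
have z_in : 0 <= (0 : R) <= s by rewrite lexx ltW.
have dphi a : 0 <= a <= s ->
    is_derive a 1 phi ('D_v h (x + s *: w + a *: v) - 'D_v h (x + a *: v)).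
  move=> ha; apply: is_deriveB; apply: is_derive_line; apply/derivableP/diff_derivable.
    exact: dh.
  by have := dh a 0 ha z_in; rewrite scale0r addr0.
have [a /[!in_itv]/= /andP[a0 as_] phiE] : exists2 a, a \in `]0, s[ &
    phi s - phi 0 = ('D_v h (x + s *: w + a *: v) - 'D_v h (x + a *: v)) * (s - 0).
  apply: MVT => // [a|].
    by rewrite in_itv /= => /andP[a0 as_]; apply: dphi; rewrite !ltW.
  apply: derivable_within_continuous => a; rewrite in_itv /= => /andP[a0 as_].
  by have [] := dphi a; rewrite ?a0 ?as_.
have ha : 0 <= a <= s by rewrite !ltW.
pose psi b := 'D_v h (x + a *: v + b *: w).
have dpsi b : 0 <= b <= s -> is_derive b 1 psi ('D_w ('D_v h) (x + b *: w + a *: v)).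
  move=> hb; apply: (@is_derive_line _ _ _ ('D_v h)); rewrite addrAC.
  by apply/derivableP/diff_derivable/ddh.
have [b /[!in_itv]/= /andP[b0 bs] psiE] : exists2 b, b \in `]0, s[ &
    psi s - psi 0 = 'D_w ('D_v h) (x + b *: w + a *: v) * (s - 0).
  apply: (@MVT _ psi (fun b => 'D_w ('D_v h) (x + b *: w + a *: v)) _ _ s0) => [b|].
    by rewrite in_itv /= => /andP[b0 bs]; apply: dpsi; rewrite !ltW.
  apply: derivable_within_continuous => b; rewrite in_itv /= => /andP[b0 bs].
  by have [] := dpsi b; rewrite ?b0 ?bs.
exists a, b; split; rewrite ?ltW //.
move: phiE psiE; rewrite /phi /psi !scale0r !addr0 !subr0 => phiE psiE.
by rewrite -psiE (addrAC x (a *: v)) -phiE; ring.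
Qed.

(** The second difference taken in both orders equals s^2 times either mixed derivative at some
    point of a small parallelogram; continuity of these derivatives at x concludes. *)
Lemma Schwarz U h x v w : open U -> CkS 2 U h -> U x ->
  'D_v ('D_w h) x = 'D_w ('D_v h) x.
Proof.
move=> oU [dh H] Ux; have [dvh cvw] := H v; have [dwh cwv] := H w.
have key (A B C e : R) : `|A - C| <= e / 2 -> `|B - C| <= e / 2 -> `|A - B| <= e.
  move=> h1 h2; rewrite (_ : A - B = (A - C) - (B - C)); last by ring.
  by rewrite (le_trans (ler_normB _ _)) // (splitr e) lerD.
apply/eqP; rewrite -subr_eq0 -normr_le0; apply/ler_addgt0Pr => /= e e0; rewrite add0r.
have e2 : 0 < e / 2 by rewrite divr_gt0.
have /nbhs_ballP[r /= r0 rU] : nbhs x [set y | U y /\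
    (`|'D_v ('D_w h) x - 'D_v ('D_w h) y| <= e / 2 /\
     `|'D_w ('D_v h) x - 'D_w ('D_v h) y| <= e / 2)].
  apply: filterI; first exact: near_open.
  by apply: filterI; [exact: ((cvgrPdist_le _ _).1 (cwv v x Ux) _ e2)|exact: ((cvgrPdist_le _ _).1 (cvw w x Ux) _ e2)].
(* The parallelogram stays within distance r / 2 of x; the + 1 avoids a zero denominator when v = w
   = 0. *)
pose s := r / (`|v| + `|w| + 1) / 2.
have N0 : 0 < `|v| + `|w| + 1 by rewrite ltr_wpDl // addr_ge0.
have s0 : 0 < s by rewrite !divr_gt0.
have inball a b : 0 <= a <= s -> 0 <= b <= s -> ball x r (x + b *: w + a *: v).
  move=> /andP[a0 as_] /andP[b0 bs]; rewrite -ball_normE /= -addrA opprD addrA subrr.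
  rewrite sub0r normrN (le_lt_trans (ler_normD _ _)) // !normrZ !ger0_norm //.
  apply: (@le_lt_trans _ _ (s * (`|v| + `|w| + 1))).
    by rewrite !mulrDr addrC -addrA lerD ?ler_wpM2r // ler_wpDr ?ler_wpM2r // mulr1 ltW.
  by rewrite /s mulrAC divfK ?gt_eqF // gtr_pMr // invf_lt1 ?ltr1n.
have [a [b [ha hb E1]]] := MVT_second s0
   (fun a b ha hb => dh _ (rU _ (inball a b ha hb)).1)
   (fun a b ha hb => dvh _ (rU _ (inball a b ha hb)).1).
have inball' a' b' (ha' : 0 <= a' <= s) (hb' : 0 <= b' <= s) :
    ball x r (x + b' *: v + a' *: w) by rewrite addrAC; exact: inball.
have [a' [b' [ha' hb' E2]]] := MVT_second s0
   (fun a b ha hb => dh _ (rU _ (inball' a b ha hb)).1)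
   (fun a b ha hb => dwh _ (rU _ (inball' a b ha hb)).1).
have E : 'D_w ('D_v h) (x + b *: w + a *: v) = 'D_v ('D_w h) (x + b' *: v + a' *: w).
  have ss : s * s != 0 by rewrite mulf_neq0 // gt_eqF.
  apply: (mulIf ss); move: E1 E2; rewrite (addrAC x (s *: v)).
  move: ('D_w ('D_v h) _) ('D_v ('D_w h) _) (h _) (h _) (h _) (h _) => A B p q t u E1 E2.
  by rewrite ![_ * (s * s)]mulrA -E1 -E2; move: p q t u {E1 E2} => p q t u; ring.
have [_ [_ h1]] := rU _ (inball a b ha hb).
have [_ [h2 _]] := rU _ (inball' a' b' ha' hb').
rewrite -E in h2; exact: (key _ _ _ _ h2 h1).
Qed.

End Schwarz.

Lemma is_derive_lineP (R : realType) (V W : normedModType R) (f : V -> W) (y v : V) d :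
  is_derive (0 : R) (1 : R) (fun s : R => f (y + s *: v)) d -> is_derive y v f d.
Proof.
move=> [/cvg_ex[l fl] <-].
have E : (fun h : R => h^-1 *: (((fun s : R => f (y + s *: v)) \o shift 0) (h *: 1) -
    f (y + 0 *: v))) = (fun h : R => h^-1 *: ((f \o shift y) (h *: v) - f y)).
  apply/funext => h /=; rewrite scale0r addr0 [h *: 1]mulr1 addr0.
  by rewrite [h *: v + y]addrC.
rewrite E in fl.
split; first by apply/cvg_ex; exists l.
by rewrite /derive E.
Qed.

Lemma is_derive_affine (R : realType) (a b s : R) :
  is_derive s (1 : R) (fun s : R => a + s * b) b.
Proof.
rewrite (_ : (fun s => _) = cst a + b *: (id : R -> R)).
  apply: (is_derive_eq (is_deriveD (is_derive_cst a s 1) (is_deriveZ b (is_derive_id s 1)))).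
  by rewrite add0r [_ *: _]mulr1.
by apply/funext => u; rewrite !fctE mulrC.
Qed.

(** * Primitives of closed one-forms *)

Section Primitive.
Variables (R : realType) (m : nat).
Implicit Types (U : set 'rV[R]_m) (F : 'rV[R]_m -> R) (W : 'I_m -> 'rV[R]_m -> R).

Lemma derive_sum_coord F x v : differentiable F x ->
  'D_v F x = \sum_j v 0 j * 'D_(delta_mx 0 j) F x.
Proof.
move=> dF; rewrite deriveE // [X in 'd F _ X]row_sum_delta linear_sum /=.
by apply: eq_bigr => j _; rewrite linearZ -deriveE.
Qed.

(** Continuous partial derivatives give total differentiability: by the mean value theorem on the
    segment from x to x + h, the error compares the [W j] at two nearby points. *)
Lemma C1_differentiable U F W x : open U -> U x ->
  (forall y v, U y -> is_derive y v F (\sum_j v 0 j * W j y)) ->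
  (forall j, {for x, continuous (W j)}) ->
  differentiable F x.
Proof.
move=> oU Ux dF cW.
pose dfn (v : 'rV[R]_m) : R := \sum_j v 0 j * W j x.
have lin : linear dfn.
  move=> a u v; rewrite /dfn scaler_sumr -big_split; apply: eq_bigr => j _ /=.
  by rewrite !mxE mulrDl -mulrA.
pose df : {linear 'rV[R]_m -> R} := HB.pack dfn (GRing.isLinear.Build _ _ _ _ _ lin).
apply: (@diff_littleoP _ _ _ F df) => [v|e e0].
  have H : CkS 0 setT dfn.
    apply: CkS_sum => [|j _]; first exact: openT.
    by apply: CkS_M; [exact: openT|exact: CkS_coord|exact: CkS_cst].
  exact: H.
(* The m coordinates contribute at most e / (m + 1) each; the successor also covers m = 0. *)
have e1 : 0 < e / m.+1%:R by rewrite divr_gt0.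
have nb : nbhs x [set y | U y /\ forall j, `|W j x - W j y| <= e / m.+1%:R].
  apply: filterI; first exact: near_open.
  exact: (filter_forall _ (fun j => (cvgrPdist_le _ _).1 (cW j) _ e1)).
have [d /= d0 dU] := (nbhs_ballP _ _).1 nb.
apply/nbhs_ballP; exists d => //= h; rewrite -ball_normE /= sub0r normrN => hd.
have inU (a : R) : 0 <= a <= 1 -> ball x d (x + a *: h).
  move=> /andP[a0 a1]; rewrite -ball_normE /= opprD addrA subrr sub0r normrN normrZ.
  by rewrite ger0_norm // (le_lt_trans _ hd) // ler_piMl.
have dline (a : R) : 0 <= a <= 1 ->
    is_derive a 1 (fun s : R => F (x + s *: h)) (\sum_j h 0 j * W j (x + a *: h)).
  by move=> ha; apply: is_derive_line; apply: dF; have [] := dU _ (inU a ha).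
have [a /[!in_itv]/= ha E] : exists2 a, a \in `]0, 1[ & F (x + 1 *: h) - F (x + 0 *: h) =
    (\sum_j h 0 j * W j (x + a *: h)) * (1 - 0).
  apply: (@MVT _ (fun s : R => F (x + s *: h)) (fun a => \sum_j h 0 j * W j (x + a *: h)) _ _ ltr01) => [a|].
    by rewrite in_itv /= => /andP[a0 a1]; apply: dline; rewrite !ltW.
  apply: derivable_within_continuous => a; rewrite in_itv /= => ha.
  by have [] := dline a.
move: E; rewrite scale1r scale0r addr0 subr0 mulr1 [h + x]addrC => ->.
rewrite -sumrB (le_trans (ler_norm_sum _ _ _)) //.
have ha' : 0 <= a <= 1 by case/andP: ha => /ltW -> /ltW ->.
have [_ Wa] := dU _ (inU a ha').
apply: (@le_trans _ _ (\sum_(j < m) (`|h| * (e / m.+1%:R)))).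
  apply: ler_sum => j _; rewrite -mulrBr normrM ler_pM ?normr_coord //.
  by rewrite distrC; exact: Wa.
rewrite sumr_const card_ord -mulrnAr mulrC ler_wpM2r // -mulr_natr -mulrA.
by rewrite ler_piMr ?(ltW e0) // mulrC ler_pdivrMr // mul1r ler_nat.
Qed.

Local Notation mu := lebesgue_measure.

(** Differentiation under the integral sign, dominated by the constant M. *)
Lemma Leibniz_integral (K K' : R -> R -> R) (d M : R) : 0 < d ->
  (forall s t : R, - d < s < d -> 0 <= t <= 1 -> is_derive s 1 (K ^~ t) (K' s t)) ->
  (forall s : R, - d < s < d -> {within `[0, 1], continuous (K s)}) ->
  (forall s t : R, - d < s < d -> 0 <= t <= 1 -> `|K' s t| <= M) ->
  is_derive (0 : R) (1 : R) (fun s => \int[mu]_(t in `[0, 1]) K s t)%R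
    (\int[mu]_(t in `[0, 1]) K' 0 t)%R.
Proof.
move=> d0 dK cK MK.
have itv0 : `]-d, d[%classic (0 : R) by rewrite /= in_itv /= d0 oppr_lt0 d0.
have M0 : 0 <= M by have := MK 0 0; rewrite oppr_lt0 d0 lexx ler01 => /(_ isT isT); exact: le_trans.
have mB : measurable (`[0, 1]%classic : set (measurableTypeR R)) by [].
have intK s : `]-d, d[%classic s -> mu.-integrable `[0, 1] (EFin \o K s).
  rewrite /= in_itv /= => hs.
  by apply: continuous_compact_integrable; [exact: segment_compact|exact: cK].
have derK s t : `]-d, d[%classic s -> `[0, 1]%classic t -> derivable (K ^~ t) s 1.
  by rewrite /= !in_itv /= => hs ht; have [] := dK s t hs ht.
have intM : mu.-integrable `[0, 1] (EFin \o (fun=> M)).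
  apply: continuous_compact_integrable; first exact: segment_compact.
  by apply: continuous_subspaceT => x; exact: cst_continuous.
have ubK s t : `]-d, d[%classic s -> `[0, 1]%classic t -> `|partial1of2 K s t| <= M.
  rewrite /= !in_itv /= => hs ht; rewrite partial1of2E.
  by have [_ ->] := dK s t hs ht; exact: MK.
split; first exact: (derivable_under_integral mB itv0 intK derK (fun=> M0) intM ubK).
rewrite -derive1E (differentiation_under_integral mB itv0 intK derK (fun=> M0) intM ubK).
apply: eq_Rintegral => t; rewrite inE /= in_itv /= => ht; rewrite partial1of2E.
have z : - d < 0 < d by rewrite oppr_lt0 d0.
by have [_ ->] := dK 0 t z ht.
Qed.

(** The primitive integrates the form along rays from x0. After differentiation under the integral,
    closedness turns the integrand into the t-derivative of t times the form on v, whose integral is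
    the form at y. *)
Lemma Poincare W (x0 : 'rV[R]_m) (r : R) : (forall j, CkS 1 (ball x0 r) (W j)) ->
  (forall i j x, ball x0 r x ->
    'D_(delta_mx 0 i) (W j) x = 'D_(delta_mx 0 j) (W i) x) ->
  exists F, forall y v, ball x0 r y -> is_derive y v F (\sum_j v 0 j * W j y).
Proof.
move=> CW clW.
pose K (Y : 'rV[R]_m) (t : R) : R := \sum_j Y 0 j * W j (x0 + t *: Y).
exists (fun y => \int[mu]_(t in `[0, 1]) K (y - x0) t)%R => y v yB.
have dW j z : ball x0 r z -> differentiable (W j) z by case: (CW j) => + _; apply.
have cDW j u z : ball x0 r z -> {for z, continuous ('D_u (W j))} by case: (CW j) => _; apply.
have cW j z : ball x0 r z -> {for z, continuous (W j)} by move=> /dW /differentiable_continuous.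
(* Closedness on basis directions, extended to all directions by bilinearity. *)
have clDW (u w z : 'rV[R]_m) : ball x0 r z ->
    \sum_j w 0 j * 'D_u (W j) z = \sum_j u 0 j * 'D_w (W j) z.
  move=> zB; under eq_bigr => i _ do rewrite (derive_sum_coord _ (dW i z zB)) mulr_sumr.
  rewrite exchange_big; apply: eq_bigr => i _ /=.
  rewrite (derive_sum_coord _ (dW i z zB)) mulr_sumr; apply: eq_bigr => k _.
  by rewrite (clW i k z zB) mulrCA.
pose K' (s t : R) : R := \sum_j (v 0 j * W j (x0 + t *: (y + s *: v - x0)) +
   (y + s *: v - x0) 0 j * (t * 'D_v (W j) (x0 + t *: (y + s *: v - x0)))).
(* A radius strictly between |y - x0| and r. For |s| < d the rays to y + s v stay in the closed ball
   of radius rho, a compact part of the domain. *)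
pose rho := (`|y - x0| + r) / 2.
have yr : `|y - x0| < r by move: yB; rewrite -ball_normE /= distrC.
have yrho : `|y - x0| < rho by rewrite /rho; lra.
have rhor : rho < r by rewrite /rho; lra.
have rho0 : 0 < rho by rewrite (le_lt_trans _ yrho).
pose d := (rho - `|y - x0|) / (`|v| + 1).
have v1 : 0 < `|v| + 1 by rewrite ltr_wpDl.
have d0 : 0 < d by rewrite divr_gt0 // subr_gt0.
have Yrho (s : R) : - d < s < d -> `|y + s *: v - x0| <= rho.
  move=> hs; rewrite addrAC (le_trans (ler_normD _ _)) // -lerBrDl normrZ.
  have sd : `|s| <= d by rewrite ler_norml; case/andP: hs => /ltW -> /ltW ->.
  rewrite (le_trans (ler_wpM2r _ sd)) // /d mulrAC ler_pdivrMr // ler_wpM2l ?subr_ge0 ?(ltW yrho) //.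
  by rewrite lerDl.
have inA (s t : R) : - d < s < d -> 0 <= t <= 1 -> `|x0 - (x0 + t *: (y + s *: v - x0))| <= rho.
  move=> hs /andP[t0 t1]; rewrite opprD addrA subrr sub0r normrN normrZ ger0_norm //.
  by rewrite (le_trans _ (Yrho s hs)) // ler_piMl.
have inB (s t : R) : - d < s < d -> 0 <= t <= 1 -> ball x0 r (x0 + t *: (y + s *: v - x0)).
  by move=> hs ht; rewrite -ball_normE /= (le_lt_trans (inA s t hs ht)).
have z0 : - d < (0 : R) < d by rewrite oppr_lt0 d0.
have lineE (s t : R) : x0 + t *: (y + s *: v - x0) = (x0 + t *: (y - x0)) + s *: (t *: v).
  by rewrite addrAC scalerDr addrA !scalerA mulrC.
have dK s t : - d < s < d -> 0 <= t <= 1 ->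
    is_derive s 1 (fun s => K (y + s *: v - x0) t) (K' s t).
  move=> hs ht; rewrite (_ : (fun s => _) = \sum_j
      ((fun s : R => (y + s *: v - x0) 0 j) * (fun s : R => W j (x0 + t *: (y - x0) + s *: (t *: v))))).
    apply: is_derive_sum => j.
    have d1 : is_derive s 1 (fun s : R => (y + s *: v - x0) 0 j) (v 0 j).
      rewrite (_ : (fun s => _) = (fun s : R => (y - x0) 0 j + s * v 0 j)).
        exact: is_derive_affine.
      by apply/funext => u; rewrite !mxE addrAC.
    have d2 : is_derive s 1 (fun s : R => W j (x0 + t *: (y - x0) + s *: (t *: v)))
        (t * 'D_v (W j) (x0 + t *: (y + s *: v - x0))).
      apply: is_derive_line; rewrite -lineE; split.
        exact/diff_derivable/dW/inB.
      have dWz := dW j _ (inB s t hs ht).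
      by rewrite !deriveE // linearZ.
    apply: is_derive_eq; rewrite [RHS]addrC -lineE; congr (_ + _).
    by rewrite [RHS]mulrC.
  apply/funext => u; rewrite fct_sumE; apply: eq_bigr => j _.
  by rewrite /= lineE.
have dKt Y t : ball x0 r (x0 + t *: Y) ->
    is_derive t 1 (K Y) (\sum_j Y 0 j * 'D_Y (W j) (x0 + t *: Y)).
  move=> hB; rewrite (_ : K Y = \sum_j (fun t => Y 0 j *: W j (x0 + t *: Y))); last first.
    by apply/funext => u; rewrite fct_sumE.
  apply: is_derive_sum => j; apply: is_deriveZ; apply: is_derive_line.
  exact/derivableP/diff_derivable/dW.
have cK s : - d < s < d -> {within `[0, 1], continuous (K (y + s *: v - x0))}.
  move=> hs; apply: derivable_within_continuous => t; rewrite in_itv /= => ht.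
  by have [] := dKt _ _ (inB s t hs ht).
pose A := closed_ball_ Num.Def.normr x0 rho.
have cA : compact A.
  apply: bounded_closed_compact; last first.
    by rewrite /A -closed_ballE //; exact: closed_ball_closed.
  exists (`|x0| + rho); split; first exact: num_real.
  move=> b hb z /= Az; rewrite (le_trans _ (ltW hb)) //.
  rewrite -lerBlDl (le_trans (lerB_dist _ _)) // distrC; exact: Az.
(* Dominates |K' s t| at the point z of the ray; being continuous, it is bounded on the compact
   ball, which provides M. *)
pose H (z : 'rV[R]_m) : R := \sum_j (`|v 0 j| * `|W j z| + rho * `|'D_v (W j) z|).
have [z Az|M M0 HM] := compact_normr_bound (h := H) cA.
  have zB : ball x0 r z by rewrite -ball_normE /=; exact: le_lt_trans Az rhor.
  have oB : open (ball x0 r) by exact: ball_open.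
  have norm_c (h : 'rV[R]_m -> R) : CkS 0 (ball x0 r) h -> CkS 0 (ball x0 r) (fun z => `|h z|).
    move=> ch u uB; apply: (@continuous_comp _ _ _ h Num.norm); first exact: ch.
    exact: norm_continuous.
  have CH : CkS 0 (ball x0 r) H.
    apply: CkS_sum => // j _; apply: CkS_D => //; apply: CkS_M => //; try exact: CkS_cst.
      by apply: norm_c => u uB; exact: cW.
    by apply: norm_c => u uB; exact: cDW.
  exact: CH.
have MK s t : - d < s < d -> 0 <= t <= 1 -> `|K' s t| <= M.
  move=> hs ht; have := HM _ (inA s t hs ht).
  apply: le_trans; rewrite (le_trans (ler_norm_sum _ _ _)) // (le_trans _ (ler_norm _)) //.
  apply: ler_sum => j _; rewrite (le_trans (ler_normD _ _)) // !normrM lerD // mulrA.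
  rewrite ler_wpM2r //; case/andP: (ht) => t0 t1; rewrite (ger0_norm t0).
  by rewrite -[leRHS]mulr1 ler_pM // (le_trans (normr_coord _ _)) // Yrho.
apply: is_derive_lineP.
have := Leibniz_integral d0 dK cK MK; congr is_derive.
pose Y := y - x0.
(* K' at s = 0 is the derivative of P, so the integral is P 1 - P 0. *)
pose P t := t * \sum_j v 0 j * W j (x0 + t *: Y).
have dP (t : R) : 0 <= t <= 1 -> is_derive t 1 P (K' 0 t).
  move=> ht; have tB : ball x0 r (x0 + t *: Y) by have := inB 0 t z0 ht; rewrite scale0r addr0.
  have dS : is_derive t 1 (\sum_j (fun t : R => v 0 j *: W j (x0 + t *: Y)))
      (\sum_j v 0 j *: 'D_Y (W j) (x0 + t *: Y)).
    apply: is_derive_sum => j; apply: is_deriveZ; apply: is_derive_line.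
    exact/derivableP/diff_derivable/dW.
  rewrite (_ : P = id * \sum_j (fun t : R => v 0 j *: W j (x0 + t *: Y))); last first.
    by apply/funext => u; rewrite /P !fctE fct_sumE.
  apply: is_derive_eq; rewrite fct_sumE /K' scale0r [y + 0]addr0 -/Y big_split /= [LHS]addrC.
  congr (_ + _); first by rewrite [LHS]mulr1.
  transitivity (t * \sum_j v 0 j * 'D_Y (W j) (x0 + t *: Y)); first by [].
  rewrite -clDW // mulr_sumr; apply: eq_bigr => j _; exact: mulrCA.
rewrite /Rintegral (@continuous_FTC2 _ (K' 0) P) //.
- by rewrite /P mul0r mul1r sube0 /= scale1r addrC subrK.
- apply: continuous_in_subspaceT => t; rewrite inE /= in_itv /= => ht.
  have tB := inB 0 t z0 ht.
  pose p (t : R) := x0 + t *: (y + 0 *: v - x0).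
  have cp : {for t, continuous p}.
    exact: (continuousD (@cst_continuous _ _ x0 t) (@scalel_continuous _ _ _ t)).
  have cpW (h : 'rV[R]_m -> R) : {for p t, continuous h} -> {for t, continuous (h \o p)}.
    exact: continuous_comp.
  apply: (@cvg_big _ _ +%R 0 xpredT (@add_continuous _)) => j _.
  apply: (@continuousD _ _ _ (cst (v 0 j) \* (W j \o p))
    (cst ((y + 0 *: v - x0) 0 j) \* (id \* ('D_v (W j) \o p)))).
    by apply: continuousM; [exact: cst_continuous|exact/cpW/cW].
  apply: continuousM; first exact: cst_continuous.
  by apply: continuousM; [exact: cvg_id|exact/cpW/cDW].
- have cP (t : R) : 0 <= t <= 1 -> {for t, continuous P}.
    move=> /dP[dPt _]; apply/differentiable_continuous; exact/derivable1_diffP.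
  split.
  + move=> t; rewrite in_itv /= => /andP[t0 t1].
    by have [] := dP t; rewrite ?ltW.
  + by apply: cvg_at_right_filter; apply: cP; rewrite lexx ler01.
  + by apply: cvg_at_left_filter; apply: cP; rewrite lexx ler01.
- move=> t; rewrite in_itv /= => /andP[t0 t1].
  have t01 : 0 <= t <= 1 by rewrite !ltW.
  by rewrite derive1E; have [_ ->] := dP t t01.
Qed.

End Primitive.

(** * Clifford-valued functions *)

Section CliffordCalculus.
Variables (R : realType) (n : nat).

Section Derivative.
Variable V : normedModType R.
Implicit Types (u w : V -> cliff R n) (x v : V).

(** Taken coefficient by coefficient, as in [is_mx_derivative], which dispenses with a norm on the
    Clifford algebra. *)
Definition is_clderive x v u (u' : cliff R n) :=
  forall S, is_derive x v (fun y => clcoef (u y) S) (clcoef u' S).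

Lemma is_clderive_unique x v u a b : is_clderive x v u a -> is_clderive x v u b -> a = b.
Proof.
by move=> ua ub; apply: cliffP => S; have [_ <-] := ua S; have [_ <-] := ub S.
Qed.

Lemma near_is_clderive x v u w a : (\near x, u x = w x) ->
  is_clderive x v u a -> is_clderive x v w a.
Proof.
move=> uw ua S; apply: near_eq_is_derive (ua S).
by apply: filterS uw => y ->.
Qed.

Lemma is_clderive_cst x v a : is_clderive x v (fun=> a) 0.
Proof. by move=> S; rewrite clcoef0; exact: is_derive_cst. Qed.

Lemma is_clderiveD x v u w (u' w' : cliff R n) : is_clderive x v u u' -> is_clderive x v w w' ->
  is_clderive x v (fun y => u y + w y) (u' + w').
Proof.
move=> du dw S; rewrite clcoefD.
under eq_fun do rewrite clcoefD.
exact: (is_deriveD (du S) (dw S)).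
Qed.

Lemma is_clderiveN x v u (u' : cliff R n) : is_clderive x v u u' -> is_clderive x v (fun y => - u y) (- u').
Proof.
move=> du S; rewrite clcoefN.
under eq_fun do rewrite clcoefN.
exact: (is_deriveN (du S)).
Qed.

Lemma is_derive_fsum (I : finType) (F : I -> V -> R) (F' : I -> R) x v :
  (forall i, is_derive x v (F i) (F' i)) ->
  is_derive x v (fun y => \sum_i F i y) (\sum_i F' i).
Proof.
move=> dF; have dsum (s : seq I) : is_derive x v (fun y => \sum_(i <- s) F i y) (\sum_(i <- s) F' i).
  elim: s => [|i s IH].
    rewrite big_nil; under eq_fun do rewrite big_nil.
    exact: is_derive_cst.
  rewrite big_cons; under eq_fun do rewrite big_cons.
  exact: (is_deriveD (dF i) IH).
exact: dsum.
Qed.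

Lemma is_clderiveM x v u w (u' w' : cliff R n) : is_clderive x v u u' -> is_clderive x v w w' ->
  is_clderive x v (fun y => u y * w y) (u' * w x + u x * w').
Proof.
move=> du dw S; rewrite clcoefD !clcoefM -big_split /=.
under eq_fun do rewrite clcoefM.
apply: is_derive_fsum => T.
have := is_deriveM (is_deriveZ (clsign R T (sdiff T S)) (du T)) (dw (sdiff T S)).
rewrite !fctE => /is_derive_eq; apply.
by rewrite /GRing.scale /= /GRing.scale /=; ring.
Qed.

Lemma is_clderive_vec x v (f : V -> 'rV[R]_n) f' : is_derive x v f f' ->
  is_clderive x v (fun y => clvec (f y)) (clvec f').
Proof.
move=> /is_derive_rVP df S; rewrite /clcoef ffunE.
under eq_fun do rewrite /clcoef ffunE.
apply: is_derive_fsum => i; case: (S == _); last exact: is_derive_cst.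
exact: df.
Qed.

End Derivative.

Section Smoothness.
Variable m : nat.
Implicit Types (U : set 'rV[R]_m) (u w : 'rV[R]_m -> cliff R n).

Definition smoothS U (h : 'rV[R]_m -> R) := forall k, CkS k U h.
Definition smoothcl U u := forall S, smoothS U (fun x => clcoef (u x) S).

Lemma smoothcl_cst U a : smoothcl U (fun=> a).
Proof. by move=> S k; exact: CkS_cst. Qed.

Lemma smoothclD U u w : open U -> smoothcl U u -> smoothcl U w -> smoothcl U (fun x => u x + w x).
Proof.
move=> oU su sw S k; apply: CkS_ext (CkS_D oU (su S k) (sw S k)) => // x _.
by rewrite clcoefD.
Qed.

Lemma smoothclN U u : open U -> smoothcl U u -> smoothcl U (fun x => - u x).
Proof.
by move=> oU su S k; apply: CkS_ext (CkS_N oU (su S k)) => // x _; rewrite clcoefN.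
Qed.

Lemma smoothclM U u w : open U -> smoothcl U u -> smoothcl U w -> smoothcl U (fun x => u x * w x).
Proof.
move=> oU su sw S k; apply: (CkS_ext oU (h := fun x => \sum_T clsign R T (sdiff T S) *
  clcoef (u x) T * clcoef (w x) (sdiff T S))).
  by move=> x _; rewrite clcoefM.
apply: CkS_sum => // T _; apply: CkS_M => //; last exact: sw.
by apply: CkS_M => //; [exact: CkS_cst|exact: su].
Qed.

Lemma smoothcl_vec U (f : 'rV[R]_m -> 'rV[R]_n) : open U ->
  (forall j, smoothS U (fun x => f x 0 j)) -> smoothcl U (fun x => clvec (f x)).
Proof.
move=> oU sf S k.
apply: (CkS_ext oU (h := fun x => \sum_i f x 0 i * (S == [set i]%SET)%:R)).
  by move=> x _; rewrite /clcoef ffunE; apply: eq_bigr => i _; rewrite mulr_natr.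
by apply: CkS_sum => // i _; apply: CkS_M => //; [exact: sf|exact: CkS_cst].
Qed.

Lemma smoothcl_tr U u : open U -> smoothcl U u -> smoothcl U (fun x => cltr (u x)).
Proof.
move=> oU su S k; apply: CkS_ext (CkS_M oU (CkS_cst k U ((-1) ^+ 'C(#|S|, 2))) (su S k)) => // x _.
by rewrite clcoef_tr.
Qed.

Lemma smoothS_continuous U h x : smoothS U h -> U x -> {for x, continuous h}.
Proof. by move=> sh; exact: (sh 0%N). Qed.

Lemma smoothS_differentiable U h x : smoothS U h -> U x -> differentiable h x.
Proof. by move=> sh Ux; case: (sh 1%N) => + _; apply. Qed.

Lemma smoothS_derive U h v : smoothS U h -> smoothS U ('D_v h).
Proof. by move=> sh k; case: (sh k.+1) => _; apply. Qed.

Lemma smoothS_clquot U u w : open U -> smoothcl U u -> smoothcl U w ->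
  (forall x, U x -> clnorm (w x) != 0) ->
  forall j, smoothS U (fun x => clquot (u x) (w x) 0 j).
Proof.
move=> oU su sw w0 j k.
have sw' := smoothcl_tr oU sw.
have s1 := smoothclM oU sw sw' finset.set0 k.
have s2 := smoothclM oU su sw' [set j]%SET k.
apply: CkS_ext (CkS_M oU (CkS_V oU w0 s1) s2) => // x _.
by rewrite !mxE.
Qed.
End Smoothness.

Implicit Types (g : 'M[cliff R n]_2) (b : bool).

Lemma smoothcl_chu b U : open U -> smoothcl U (@chu R n b).
Proof.
move=> oU; case: b; first exact: smoothcl_cst.
by apply: smoothcl_vec => // j k; exact: CkS_coord.
Qed.

Lemma smoothcl_chw b U : open U -> smoothcl U (@chw R n b).
Proof.
move=> oU; case: b; last exact: smoothcl_cst.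
by apply/smoothclN/smoothcl_vec => // j k; exact: CkS_coord.
Qed.

Lemma smoothcl_action_row g b (i : 'I_2) U : open U ->
  smoothcl U (fun x => g i 0 * chu b x + g i 1 * chw b x).
Proof.
move=> oU; apply: smoothclD => //; apply: smoothclM => //; try exact: smoothcl_cst.
  exact: smoothcl_chu.
exact: smoothcl_chw.
Qed.

Definition trdom g b b' : set 'rV[R]_n := [set v | clnorm (trden g b b' v) != 0].

Lemma trden_smooth g b b' U : open U -> smoothcl U (trden g b b').
Proof. by move=> oU; rewrite /trden /chden; case: b'; exact: smoothcl_action_row. Qed.

Lemma trnum_smooth g b b' U : open U -> smoothcl U (trnum g b b').
Proof.
move=> oU; rewrite /trnum /chnum; case: b'; last exact: smoothcl_action_row.
by apply: smoothclN => //; exact: smoothcl_action_row.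
Qed.

Lemma open_trdom g b b' : open (trdom g b b').
Proof.
have sT := trden_smooth g b b' openT.
have s1 := smoothclM openT sT (smoothcl_tr openT sT) finset.set0.
rewrite (_ : trdom g b b' = (fun v => clnorm (trden g b b' v)) @^-1` [set~ 0]); last first.
  by apply/seteqP; split=> v /eqP.
apply: open_comp; last exact/closed_openC/closed_eq.
by move=> v _; exact: (smoothS_continuous s1).
Qed.

Lemma smoothS_transition g b b' j : smoothS (trdom g b b') (fun v => transition g b b' v 0 j).
Proof.
have oU : open (trdom g b b') by exact: open_trdom.
exact: (smoothS_clquot oU (trnum_smooth g b b' oU) (trden_smooth g b b' oU)).
Qed.

Lemma differentiable_transition g b b' v : trdom g b b' v -> differentiable (transition g b b') v.
Proof.
move=> dv; apply/differentiable_rVP => j; exact: (smoothS_differentiable (@smoothS_transition g b b' j) dv).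
Qed.
End CliffordCalculus.

(** * Maps from a manifold to the sphere *)

Lemma closed_set1_rV (R : realType) n (x : 'rV[R]_n) : closed [set x].
Proof.
apply: accessible_closed_set1; apply: hausdorff_accessible; exact: norm_hausdorff.
Qed.

Section SphereTopology.
Variables (R : realType) (n : nat).

Lemma open_cdom_schart b : open (cdom (schart R n b)).
Proof.
rewrite openE => -[x|] /=; last first.
  (* A neighbourhood of infinity is given by the complement of a closed compact set, here the
     origin. *)
  case: b => //= _; exists [set 0].
    split; first exact: compact_set1.
    exact: closed_set1_rV.
  by move=> [y|] [] // [z /= zn0 [<-]] [].
case: b => /= H; last first.
  by change (nbhs x [set y : 'rV[R]_n | Some y <> None]); apply: filterE.
have : nbhs x [set~ 0].
  apply: near_open; last by move=> x0; apply: H; rewrite x0.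
  exact/closed_openC/closed_set1_rV.
change (nbhs x [set~ 0] -> nbhs x [set y : 'rV[R]_n | Some y <> Some 0]).
by apply: filterS => y /= y0 [].
Qed.
End SphereTopology.

Section ManifoldCalculus.
Variables (R : realType) (m : nat) (M : manifold R m).
Implicit Types (c : chart R M m) (q : M) (O : set M).

Lemma chartK c q : atlas c -> cdom c q -> cinv c (cmap c q) = q.
Proof. by move=> ac qc; apply: (atlas_cancel ac); exact: mem_set. Qed.

Lemma near_cinv c q O : atlas c -> cdom c q -> nbhs q O ->
  \forall x \near cmap c q, (cmap c @` cdom c) x /\ O (cinv c x).
Proof.
move=> ac qc nO.
have xi : (cmap c @` cdom c) (cmap c q) by exists q.
apply: filterI; first exact: near_open (atlas_img ac) xi.
have := atlas_cinv_cont ac xi; apply.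
by rewrite chartK.
Qed.

Lemma near_cmap c q (P : set 'rV[R]_m) : atlas c -> cdom c q -> nbhs (cmap c q) P ->
  \forall q' \near q, cdom c q' /\ P (cmap c q').
Proof.
move=> ac qc nP; apply: filterI; first exact: near_open (atlas_dom ac) qc.
exact: (atlas_cmap_cont ac qc).
Qed.

Lemma chart_image_open c O : atlas c -> open O -> open (cmap c @` (cdom c `&` O)).
Proof.
move=> ac oO; rewrite openE => x [q [qc Oq] <-].
have := near_cinv ac qc (near_open oO Oq); apply: filterS => y [[r rc <-]].
by rewrite chartK // => Or; exists r.
Qed.

Section Map.
Variable n : nat.
Variables (f : M -> sphere R n) (sf : smooth_map f).
Hypothesis n_gt0 : (0 < n)%N.

Lemma smooth_map_chart c b : atlas c -> forall j,
  smoothS (cmap c @` (cdom c `&` f @^-1` cdom (schart R n b)))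
    (fun x => (cmap (schart R n b) (f (cinv c x))) 0 j).
Proof.
move=> ac j k; have [cf /(_ c _ ac (schart_atlas R n b) k)] := sf.
move/CkP; apply; apply: chart_image_open => //.
by apply: open_comp; [move=> ? _; exact: cf|exact: open_cdom_schart].
Qed.

(** For [b = false], the set of points that T moves to finite values of f. Outside [mdom], [mmap]
    has the default value 0 of the chart. *)
Definition mdom (T : 'M[cliff R n]_2) b : set M := [set q | cdom (schart R n b) (act T (f q))].
Definition mmap (T : 'M[cliff R n]_2) b (q : M) := cmap (schart R n b) (act T (f q)).

Variables (T : 'M[cliff R n]_2) (ST : SLGamma T).

Lemma near_cdom q b : cdom (schart R n b) (f q) -> \forall q' \near q, cdom (schart R n b) (f q').
Proof.
move=> qb; have [cf _] := sf; apply: cf.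
exact: near_open (@open_cdom_schart R n b) qb.
Qed.

Lemma chart_map_differentiable c q b : atlas c -> cdom c q -> cdom (schart R n b) (f q) ->
  differentiable (fun x => cmap (schart R n b) (f (cinv c x))) (cmap c q).
Proof.
move=> ac qc qb; apply/differentiable_rVP => j.
by apply: (smoothS_differentiable (smooth_map_chart b ac j)); exists q.
Qed.

Lemma mdom_open b' : open (mdom T b').
Proof.
rewrite openE => q dq; have [b qb] := cover_schart (f q).
have [c ac qc] := atlas_cover q.
have dg := chart_map_differentiable ac qc qb.
have tr : trdom T b b' (cmap (schart R n b) (f q)) by apply/transition_dom.
have nb : \forall x \near cmap c q, trdom T b b' (cmap (schart R n b) (f (cinv c x))).
  have /differentiable_continuous := dg; apply; rewrite chartK //.
  exact: near_open (@open_trdom R n T b b') tr.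
have := near_cmap ac qc nb; have := near_cdom qb; apply: filterS2 => r rb [rc].
by rewrite chartK // => /(transition_dom b' ST rb).
Qed.

Lemma mmapE q b b' : cdom (schart R n b) (f q) -> mdom T b' q ->
  mmap T b' q = transition T b b' (cmap (schart R n b) (f q)).
Proof. exact: transitionE. Qed.

(** Near each point the map is a rational [transition] applied to f in some chart of the sphere;
    [CkS_local] assembles these local descriptions. *)
Lemma mmap_smooth c b' : atlas c -> forall j,
  smoothS (cmap c @` (cdom c `&` mdom T b')) (fun x => mmap T b' (cinv c x) 0 j).
Proof.
move=> ac j k; apply: CkS_local => x [q [qc dq] <-].
have [b qb] := cover_schart (f q).
pose U' := cmap c @` (cdom c `&` (mdom T b' `&` f @^-1` cdom (schart R n b))).
exists U'; first by exists q.
have oU : open U'.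
  apply: chart_image_open => //; apply: openI; first exact: mdom_open.
  by have [cf _] := sf; apply: open_comp; [move=> ? _; exact: cf|exact: open_cdom_schart].
have H : CkS k U' ((fun v => transition T b b' v 0 j) \o
    (fun x => cmap (schart R n b) (f (cinv c x)))).
  apply: (CkS_comp oU _ _ (@smoothS_transition R n T b b' j k)).
    by move=> y [r [rc [rd rb]] <-]; rewrite chartK //; apply/transition_dom.
  move=> i; apply: CkS_sub (smooth_map_chart b ac i k).
  by move=> y [r [rc [rd rb]] <-]; exists r.
apply: CkS_ext H => // y [r [rc [rd rb]] <-] /=.
by rewrite chartK // (mmapE rb rd).
Qed.

Lemma mmap_differentiable c q b' : atlas c -> cdom c q -> mdom T b' q ->
  differentiable (fun x => mmap T b' (cinv c x)) (cmap c q).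
Proof.
move=> ac qc dq; apply/differentiable_rVP => j.
by apply: (smoothS_differentiable (mmap_smooth b' ac j)); exists q.
Qed.

(** The chain rule for the motion T; it turns velocities on the sphere, read in an arbitrary chart,
    into velocities in R^n. *)
Lemma dchart_mmap c q b b' X : atlas c -> cdom c q -> cdom (schart R n b) (f q) -> mdom T b' q ->
  dchart c q (mmap T b') X =
  'd (transition T b b') (cmap (schart R n b) (f q)) (dsphere c q f X (schart R n b)).
Proof.
move=> ac qc qb dq.
have tr : trdom T b b' (cmap (schart R n b) (f q)) by apply/transition_dom.
have dg := chart_map_differentiable ac qc qb.
pose g x := cmap (schart R n b) (f (cinv c x)).
have gq : g (cmap c q) = cmap (schart R n b) (f q) by rewrite /g chartK.
have dt := differentiable_transition tr; rewrite -gq in dt.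
rewrite /dchart (@near_eq_derive _ _ _ _ (transition T b b' \o g)); last first.
  have nO : nbhs q (mdom T b' `&` f @^-1` cdom (schart R n b)).
    by apply: filterI; [exact: near_open (@mdom_open b') dq|exact: near_cdom].
  apply: filterS (near_cinv ac qc nO) => y [_ [yd yb]].
  exact: mmapE.
rewrite deriveE; last exact: differentiable_comp.
rewrite diff_comp; [|exact: dg|exact: dt].
by rewrite /dsphere /dchart deriveE; [rewrite -gq|exact: dg].
Qed.

(** The opposite passage, by the chain rule for f = T^-1 (T f). In particular a kernel vector of the
    moved differential is one of the original. *)
Lemma dsphere_mmap c q b X : atlas c -> cdom c q -> cdom (schart R n b) (f q) ->
  mdom T false q ->
  dsphere c q f X (schart R n b) =
  'd (transition (adj2 T) false b) (mmap T false q) (dchart c q (mmap T false) X).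
Proof.
move=> ac qc qb dq.
have sT : SLGamma (adj2 T) by exact: SL_adj2.
have fE r : mdom T false r -> f r = act (adj2 T) (fin_pt (mmap T false r)).
  move=> rd; rewrite -(actK n_gt0 ST (f r)); congr act.
  by rewrite -[LHS](schartK (b := false)).
have tr : trdom (adj2 T) false b (mmap T false q).
  apply/(transition_dom (s := fin_pt (mmap T false q)) b sT) => //.
  by rewrite -fE.
have dt := differentiable_transition tr.
pose g x := mmap T false (cinv c x).
have gq : g (cmap c q) = mmap T false q by rewrite /g chartK.
rewrite -gq in dt; have dg := mmap_differentiable ac qc dq.
rewrite /dsphere /dchart (@near_eq_derive _ _ _ _ (transition (adj2 T) false b \o g)); last first.
  have nO : nbhs q (mdom T false `&` f @^-1` cdom (schart R n b)).
    by apply: filterI; [exact: near_open (@mdom_open false) dq|exact: near_cdom].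
  apply: filterS (near_cinv ac qc nO) => y [_ [yd yb]] /=.
  by rewrite {1}fE // (transitionE (b := false)) // -fE.
rewrite deriveE; last exact: differentiable_comp.
rewrite diff_comp; [|exact: dg|exact: dt].
by rewrite deriveE; [rewrite -gq|exact: dg].
Qed.

End Map.
End ManifoldCalculus.

Section Inversion.
Variables (R : realType) (n : nat).

Lemma clvec_inversion (v : 'rV[R]_n) : v != 0 ->
  clvec v * - clvec (inversion v) = 1 /\ - clvec (inversion v) * clvec v = 1.
Proof.
move=> v0; rewrite mulrN mulNr inversion_clvec // opprK.
rewrite -dotv_eq0 in v0; split=> //.
by rewrite /inversion linearZ -scalerAr clvec_sqr scalerA mulrN mulVf // scaleN1r opprK.
Qed.

Lemma rinv_clvec (v : 'rV[R]_n) : v != 0 -> rinv (clvec v) = - clvec (inversion v).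
Proof. by move=> /clvec_inversion[h1 h2]; exact: rinvE. Qed.

Lemma smoothS_inversion (U : set 'rV[R]_n) j : open U -> (forall v, U v -> v != 0) ->
  smoothS U (fun v => inversion v 0 j).
Proof.
move=> oU U0 k.
have s1 : CkS k U (fun v : 'rV[R]_n => dotv v v).
  by apply: CkS_sum => // i _; apply: CkS_M => //; exact: CkS_coord.
have d0 x : U x -> dotv x x != 0 by rewrite dotv_eq0; exact: U0.
apply: CkS_ext (CkS_M oU (CkS_V oU d0 s1) (CkS_coord k U j)) => // x _.
by rewrite mxE.
Qed.

Lemma differentiable_inversion (v : 'rV[R]_n) : v != 0 -> differentiable (@inversion R n) v.
Proof.
move=> v0; apply/differentiable_rVP => j.
have oU : open ([set~ 0] : set 'rV[R]_n) by exact/closed_openC/closed_set1_rV.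
have s := @smoothS_inversion [set~ 0] j oU (fun v => @introN _ _ eqP).
by apply: (smoothS_differentiable s) => /eqP; rewrite (negbTE v0).
Qed.

End Inversion.

(** * Curves in SL(Gamma_n) and their velocities *)

Section Curves.
Variables (R : realType) (n : nat).
Implicit Types (g T : 'M[cliff R n]_2) (b : bool).

Lemma near_line (V : normedModType R) (x v : V) (P : set V) : nbhs x P ->
  \forall t \near (0 : R), P (x + t *: v).
Proof.
move=> nP; have c : {for (0 : R), continuous (fun t : R => x + t *: v)}.
  exact: (continuousD (@cst_continuous _ _ x 0) (@scalel_continuous _ _ _ 0)).
by apply: c; rewrite scale0r addr0.
Qed.

Lemma near_clneq0 (u : R -> cliff R n) u' : is_clderive (0 : R) (1 : R) u u' -> u 0 != 0 ->
  \forall t \near (0 : R), u t != 0.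
Proof.
move=> du u0; have [S uS] : exists S, clcoef (u 0) S != 0.
  apply: contrapT => h; move/eqP: u0; apply; apply: cliffP => S.
  rewrite clcoef0; apply/eqP; apply: contrapT => /negP uS; apply: h.
  by exists S.
have [dS _] := du S.
have /differentiable_continuous c : differentiable (fun t => clcoef (u t) S) (0 : R).
  exact/derivable1_diffP.
have nz : nbhs (clcoef (u 0) S) [set~ 0].
  by apply: near_open; [exact/closed_openC/closed_eq|move=> h; rewrite h eqxx in uS].
have cnz : nbhs (0 : R) [set t | clcoef (u t) S <> 0] by exact: c _ nz.
move: cnz; apply: filterS => t /= h; apply/eqP => ut.
by apply: h; rewrite ut clcoef0.
Qed.

Lemma is_mx_derivativeM T (gam : R -> 'M[cliff R n]_2) A :
  is_mx_derivative gam A -> is_mx_derivative (fun t => T * gam t) (T * A).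
Proof.
move=> dg i j.
change (is_clderive (0 : R) (1 : R) (fun t => (T * gam t) i j) ((T * A) i j)).
under eq_fun do rewrite mulmx2E.
rewrite mulmx2E.
have H := is_clderiveD (is_clderiveM (is_clderive_cst (0 : R) (1 : R) (T i 0)) (dg 0 j))
  (is_clderiveM (is_clderive_cst (0 : R) (1 : R) (T i 1)) (dg 1 j)).
by rewrite !mul0r !add0r in H.
Qed.

(** The point whose image under g has column j of g as homogeneous coordinates. *)
Definition basept (j : 'I_2) : sphere R n := if j == 0 then infty R n else fin_pt 0.

Lemma hcoord_basept g j : SLGamma g -> hcoord (g 0 j) (g 1 j) (act g (basept j)).
Proof.
move=> sg; case: (ord2P j) => ->.
  by have := act_hcoord sg (hcoord_infty R n); rewrite !mulr1 !mulr0 !addr0.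
by have := act_hcoord sg (hcoord_fin 0); rewrite linear0 !mulr1 !mulr0 !add0r.
Qed.

Section Velocity.
Variables (gam : R -> 'M[cliff R n]_2) (A : 'M[cliff R n]_2) (T : 'M[cliff R n]_2).
Variables (j : 'I_2) (b : bool) (v : chart R (sphere R n) n -> 'rV[R]_n) (z : 'rV[R]_n).
Hypotheses (gamS : \forall t \near 0, SLGamma (gam t)) (dgam : is_mx_derivative gam A).
Hypothesis ST : SLGamma T.
Let s (t : R) := act (gam t) (basept j).
Hypotheses (vs : is_velocity s v) (sb : cdom (schart R n b) (s 0)) (sz : act T (s 0) = fin_pt z).
Let zd := 'd (transition T b false) (cmap (schart R n b) (s 0)) (v (schart R n b)).
Let h t := T * gam t.
Let B := T * A.

(** Near 0, column j of T gam satisfies h0 = z(t) h1, where z(t) in R^n is the moved point; the last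
    equation is the derivative of this relation at 0. *)
Lemma curve_velocity : Gamma (h 0 1 j) /\ h 0 0 j = clvec z * h 0 1 j /\
  B 0 j = clvec zd * h 0 1 j + clvec z * B 1 j.
Proof.
have S0 : SLGamma (gam 0) by exact: nbhs_singleton gamS.
have hh t : SLGamma (gam t) -> hcoord (h t 0 j) (h t 1 j) (act T (s t)).
  by move=> St; have := act_hcoord ST (hcoord_basept j St); rewrite -!mulmx2E.
have dh : is_mx_derivative h B by exact: is_mx_derivativeM.
have := hh 0 S0; rewrite sz => -[G1 h01].
split => //; split => //.
pose zt t := cmap (schart R n false) (act T (s t)).
have z0 : zt 0 = z by rewrite /zt sz.
(* [is_velocity] sees s only through a chart map with default values off its domain. That s stays in
   the chart comes instead from a denominator, nonzero near 0 because gam is continuous there. *)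
have nden : \forall t \near (0 : R), chden b (gam t 0 j) (gam t 1 j) != 0.
  have := hcoord_chartP b (hcoord_basept j S0).
  case: eqP => [_ /(_ sb)//|/eqP d0 _]; move: d0.
  by case: (b); apply: near_clneq0; exact: dgam.
have nh : \forall t \near (0 : R), h t 1 j != 0.
  by apply: (near_clneq0 (dh 1 j)); exact: Gamma_neq0.
have dom : \forall t \near (0 : R), [/\ SLGamma (gam t), cdom (schart R n b) (s t) &
    cdom (schart R n false) (act T (s t))].
  near=> t.
  have St : SLGamma (gam t) by near: t.
  split; first exact: St.
    have := hcoord_chartP b (hcoord_basept j St).
    by rewrite ifN; [case|near: t].
  have := hcoord_chartP false (hh t St).
  by rewrite ifN; [case|near: t].
have dzt : is_derive (0 : R) (1 : R) zt zd.
  have tr : trdom T b false (cmap (schart R n b) (s 0)).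
    by apply/transition_dom => //; rewrite sz.
  have dv := vs (schart_atlas R n b) sb.
  have [dv1 dv2] := dv.
  have dc : differentiable (cmap (schart R n b) \o s) (0 : R) by exact/derivable1_diffP.
  have dt := differentiable_transition tr.
  have H : is_derive (0 : R) (1 : R) (transition T b false \o (cmap (schart R n b) \o s)) zd.
    have dd : differentiable (transition T b false \o (cmap (schart R n b) \o s)) (0 : R).
      exact: differentiable_comp.
    split; first exact: diff_derivable.
    rewrite deriveE // diff_comp; [|exact: dc|exact: dt].
    by rewrite /zd -dv2 deriveE.
  apply: near_eq_is_derive H.
  apply: filterS dom => t [_ d1 d2] /=.
  by rewrite /zt (transitionE (b := b)).
have E : \forall t \near (0 : R), clvec (zt t) * h t 1 j = h t 0 j.
  apply: filterS dom => t [St _ d2]; have := hcoord_chartP false (hh t St).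
  by case: ifP => [_ /(_ d2) []|_ [_ _ /esym]].
have D1 := is_clderiveM (is_clderive_vec dzt) (dh 1 j).
have D2 := near_is_clderive E D1.
by have := is_clderive_unique (dh 0 j) D2; rewrite z0.
Unshelve. all: by end_near. Qed.

End Velocity.
End Curves.

(** * Representatives of tangent vectors *)

Section Tangent.
Variables (R : realType) (n : nat).
Implicit Types (g T : 'M[cliff R n]_2) (b : bool) (s : sphere R n).

(** Uniqueness of the representative: the result involves only the points and velocities moved by T,
    not the curve gam. Column 1 of T gam follows z and column 0 follows zh. *)
Lemma tangent_repr_frame T b bh s sh (v vh : chart R (sphere R n) n -> 'rV[R]_n)
    (z zh : 'rV[R]_n) xi :
  SLGamma T -> cdom (schart R n b) s -> cdom (schart R n bh) sh ->
  act T s = fin_pt z -> act T sh = fin_pt zh -> zh - z != 0 ->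
  tangent_repr s sh v vh xi ->
  T * xi * adj2 T = frame_tangent (clvec z) (clvec zh) (rinv (clvec (zh - z)))
    (clvec ('d (transition T b false) (cmap (schart R n b) s) (v (schart R n b))))
    (clvec ('d (transition T bh false) (cmap (schart R n bh) sh) (vh (schart R n bh)))).
Proof.
move=> ST sb shb; move=> + + zz0 [gam [A [[gS dg] [gs gsh] vs vsh ->]]].
rewrite -gs -gsh in sb shb * => Ts Tsh.
have S0 : SLGamma (gam 0) by exact: nbhs_singleton gS.
have [G1 [E1 D1]] := curve_velocity (j := 1) gS dg ST vs sb Ts.
have [G0 [E0 D0]] := curve_velocity (j := 0) gS dg ST vsh shb Tsh.
have [iz zi] : clvec (zh - z) * rinv (clvec (zh - z)) = 1 /\
    rinv (clvec (zh - z)) * clvec (zh - z) = 1 by apply: Gamma_rinv; exact: Gamma_vec.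
rewrite linearB /= in iz zi *.
have [c1 c2] := Gamma_rinv G0; have [d1 d2] := Gamma_rinv G1.
have gi := SL_rinv S0; have gg := SL_adj2r S0; have gg' := SL_adj2l S0.
have TT := SL_adj2r ST; have TT' := SL_adj2l ST.
have hk : T * gam 0 * (rinv (gam 0) * adj2 T) = 1.
  by rewrite gi mulrA -(mulrA T) gg mulr1 TT.
have kh : (rinv (gam 0) * adj2 T) * (T * gam 0) = 1.
  by rewrite gi mulrA -(mulrA (adj2 (gam 0))) TT' mulr1 gg'.
rewrite -(frame_ppart iz zi hk kh E0 E1 c1 c2 d1 d2 D0 D1).
by rewrite -(mulrA (rinv (gam 0)) (adj2 T)) (mulrA (adj2 T)) TT' mul1r !mulrA.
Qed.

Lemma SL_translation (x : 'rV[R]_n) : SLGamma (mat2 1 (clvec x) 0 1).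
Proof.
rewrite /SLGamma !mat2_entry linear0 cltr1 !mulr0 !mulr1 !mul1r subr0; split=> //.
- split; [left; exact: Gamma_1|exact: Gamma0_vec|by right|left; exact: Gamma_1].
- by split; try exact: is_vec0; exists x.
Qed.

Lemma SL_cotranslation (x : 'rV[R]_n) : SLGamma (mat2 1 0 (clvec x) 1).
Proof.
rewrite /SLGamma !mat2_entry cltr1 cltr_vec !mulr0 !mul0r !mulr1 !mul1r subr0; split=> //.
- split; [left; exact: Gamma_1|by right|exact: Gamma0_vec|left; exact: Gamma_1].
- by split; try exact: is_vec0; exists x.
Qed.

(** A map fixing 0 and sending infinity to zh - z, followed by the translation by z. When zh - z is
    nonzero it is [frame z zh] with its first column divided by zh - z on the right, which brings it
    into SL(Gamma_n). *)
Definition pairframe (z zh : 'rV[R]_n) : 'M[cliff R n]_2 :=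
  mat2 1 (clvec z) 0 1 * mat2 1 0 (- clvec (inversion (zh - z))) 1.

Lemma pairframeE z zh : pairframe z zh = mat2 (1 + clvec z * - clvec (inversion (zh - z)))
  (clvec z) (- clvec (inversion (zh - z))) 1.
Proof. by rewrite /pairframe mat2M !(mulr0, mul0r, mulr1, mul1r, addr0, add0r). Qed.

Lemma pairframe_SL (z zh : 'rV[R]_n) : (0 < n)%N -> SLGamma (pairframe z zh).
Proof.
move=> n0; rewrite /pairframe -linearN.
by apply: SLGammaM => //; [exact: SL_translation|exact: SL_cotranslation].
Qed.

Lemma pairframe0 z zh : (0 < n)%N -> act (pairframe z zh) (fin_pt 0) = fin_pt z.
Proof.
move=> n0; apply: (hcoord_inj (hcoord_basept 1 (pairframe_SL z zh n0))).
by rewrite pairframeE !mat2_entry; exact: hcoord_fin.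
Qed.

Lemma pairframe_infty z zh : (0 < n)%N -> zh - z != 0 ->
  act (pairframe z zh) (infty R n) = fin_pt zh.
Proof.
move=> n0 zz0; apply: (hcoord_inj (hcoord_basept 0 (pairframe_SL z zh n0))).
rewrite pairframeE !mat2_entry; split.
  rewrite -linearN; apply: Gamma_vec; rewrite oppr_eq0.
  by apply: contraNneq zz0 => h; rewrite -(inversionK (zh - z)) h /inversion scaler0.
have [h _] := clvec_inversion zz0.
by rewrite -h -mulrDl -linearD subrK.
Qed.

Lemma transition_velocity T b (z zd : 'rV[R]_n) : SLGamma T ->
  cdom (schart R n b) (act T (fin_pt z)) ->
  is_derive (0 : R) (1 : R) (fun t : R => cmap (schart R n b) (act T (fin_pt (z + t *: zd))))
    ('d (transition T false b) z zd).
Proof.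
move=> ST zb.
have tr : trdom T false b z by apply/(transition_dom (b := false) (s := fin_pt z) b ST).
have dt := differentiable_transition tr.
have H : is_derive (0 : R) (1 : R) (fun t : R => transition T false b (z + t *: zd))
    ('d (transition T false b) z zd).
  apply: is_derive_line; rewrite scale0r addr0; exact: differentiable_is_derive.
apply: near_eq_is_derive H.
have := near_line zd (near_open (@open_trdom R n T false b) tr); apply: filterS => t td.
have fd : cdom (schart R n false) (fin_pt (z + t *: zd)) by [].
have td' : cdom (schart R n b) (act T (fin_pt (z + t *: zd))).
  exact/(transition_dom b ST fd).
exact: esym (transitionE ST fd td').
Qed.

(** Existence of a representative for arbitrary velocities zd, zhd: both points move affinely, and
    the curve is T times their [pairframe]. *)
Lemma tangent_repr_exists T (z zh zd zhd : 'rV[R]_n) (v vh : chart R (sphere R n) n -> 'rV[R]_n) :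
  (0 < n)%N -> SLGamma T -> zh - z != 0 ->
  (forall b, cdom (schart R n b) (act T (fin_pt z)) ->
    v (schart R n b) = 'd (transition T false b) z zd) ->
  (forall b, cdom (schart R n b) (act T (fin_pt zh)) ->
    vh (schart R n b) = 'd (transition T false b) zh zhd) ->
  exists xi, tangent_repr (act T (fin_pt z)) (act T (fin_pt zh)) v vh xi.
Proof.
move=> n0 ST zz0 vE vhE.
pose gam (t : R) := T * pairframe (z + t *: zd) (zh + t *: zhd).
pose y := zh - z; pose yd := zhd - zd.
have lineE (t : R) : (zh + t *: zhd) - (z + t *: zd) = y + t *: yd.
  by rewrite opprD addrACA -scalerBr.
pose dinv := - clvec ('d (@inversion R n) y yd).
have dz : is_clderive (0 : R) (1 : R) (fun t : R => clvec (z + t *: zd)) (clvec zd).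
  apply: is_clderive_vec; apply: (@is_derive_line _ _ _ id); exact: is_derive_id.
have di : is_clderive (0 : R) (1 : R)
    (fun t : R => - clvec (inversion ((zh + t *: zhd) - (z + t *: zd)))) dinv.
  apply: is_clderiveN; apply: is_clderive_vec.
  under eq_fun do rewrite lineE.
  apply: is_derive_line; rewrite scale0r addr0.
  by apply: differentiable_is_derive; exact: differentiable_inversion.
(* Any derivative will do, since [tangent_repr] quantifies it existentially. *)
have dframe : exists A, is_mx_derivative (fun t => pairframe (z + t *: zd) (zh + t *: zhd)) A.
  pose D := mat2 (clvec zd * - clvec (inversion (zh + 0 *: zhd - (z + 0 *: zd))) +
    clvec (z + 0 *: zd) * dinv) (clvec zd) dinv 0.
  exists D => i j.
  change (is_clderive (0 : R) (1 : R)
    (fun t => pairframe (z + t *: zd) (zh + t *: zhd) i j) (D i j)).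
  have E k l w (e : forall t, pairframe (z + t *: zd) (zh + t *: zhd) k l = w t) w' :
      is_clderive (0 : R) (1 : R) w w' -> is_clderive (0 : R) (1 : R)
        (fun t => pairframe (z + t *: zd) (zh + t *: zhd) k l) w'.
    by apply: near_is_clderive; apply: filterE => t; rewrite e.
  case: (ord2P i) => ->; case: (ord2P j) => ->; rewrite /D mat2_entry.
  - apply: E => [t|]; first by rewrite pairframeE mat2_entry.
    have := is_clderiveD (is_clderive_cst (0 : R) (1 : R) 1) (is_clderiveM dz di).
    by rewrite add0r.
  - by apply: E dz => t; rewrite pairframeE mat2_entry.
  - by apply: E di => t; rewrite pairframeE mat2_entry.
  - apply: E (is_clderive_cst _ _ 1) => t; by rewrite pairframeE mat2_entry.
have [A dA] := dframe.
(* [pairframe] lies in SL(Gamma_n) for every t, but its image of infinity is known to be the moved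
   zh only while the gap is nonzero. *)
have near0 : \forall t \near (0 : R), (zh + t *: zhd) - (z + t *: zd) != 0.
  have oU : open ([set~ 0] : set 'rV[R]_n) by exact/closed_openC/closed_set1_rV.
  have yU : [set~ 0] y by move=> /eqP; rewrite (negbTE zz0).
  have := near_line yd (near_open oU yU); apply: filterS => t /= h.
  by rewrite lineE; apply/eqP.
have SP t : SLGamma (pairframe (z + t *: zd) (zh + t *: zhd)) by exact: pairframe_SL.
have gE t : act (gam t) (fin_pt 0) = act T (fin_pt (z + t *: zd)).
  by rewrite actM // ?pairframe0 //; exact: SLGammaM.
have ghE t : zh + t *: zhd - (z + t *: zd) != 0 ->
    act (gam t) (infty R n) = act T (fin_pt (zh + t *: zhd)).
  by move=> h; rewrite actM // ?pairframe_infty //; exact: SLGammaM.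
have Sg t : SLGamma (gam t) by exact: SLGammaM.
have dgam : is_mx_derivative gam (T * A) by exact: is_mx_derivativeM.
have z0 : z + 0 *: zd = z by rewrite scale0r addr0.
have zh0 : zh + 0 *: zhd = zh by rewrite scale0r addr0.
clearbody gam.
have gz0 : act (gam 0) (fin_pt 0) = act T (fin_pt z) by rewrite gE z0.
have gh0 : act (gam 0) (infty R n) = act T (fin_pt zh) by move: (ghE 0); rewrite zh0 z0; apply.
eexists; exists gam, (T * A); split.
- by split; first exact: filterE.
- by split; [exact: gz0|exact: gh0].
- move=> psi /sphere_atlasP[b ->]; rewrite gz0 => zb; rewrite (vE b zb).
  apply: near_eq_is_derive (transition_velocity zd ST zb).
  apply: filterE => t.
  change (cmap (schart R n b) (act T (fin_pt (z + t *: zd))) =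
    cmap (schart R n b) (act (gam t) (fin_pt 0))).
  by rewrite gE.
- move=> psi /sphere_atlasP[b ->]; rewrite gh0 => zb; rewrite (vhE b zb).
  apply: near_eq_is_derive (transition_velocity zhd ST zb).
  apply: filterS near0 => t h.
  change (cmap (schart R n b) (act T (fin_pt (zh + t *: zhd))) =
    cmap (schart R n b) (act (gam t) (infty R n))).
  by rewrite ghE.
- reflexivity.
Qed.
End Tangent.

(** The matrix (1 0; x 1) with x nonzero sends only the point [inversion x] to infinity, so x is
    taken longer than the inversions of both points, with 0 as inversion of infinity. *)
Lemma SL_to_finite (R : realType) n (s s' : sphere R n) : (0 < n)%N -> exists T,
  [/\ SLGamma T, cdom (schart R n false) (act T s) & cdom (schart R n false) (act T s')].
Proof.
move=> n0; pose p (s : sphere R n) : 'rV[R]_n := if s is Some y then inversion y else 0.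
pose r := `|p s| + `|p s'| + 1.
pose x : 'rV[R]_n := r *: delta_mx 0 (Ordinal n0).
have xr : r <= `|x|.
  apply: le_trans (normr_coord x (Ordinal n0)).
  by rewrite !mxE !eqxx mulr1 ler_norm.
have ps : `|p s| < `|x| by apply: lt_le_trans xr; rewrite /r -addrA ltrDl ltr_wpDl.
have ps' : `|p s'| < `|x|.
  by apply: lt_le_trans xr; rewrite /r [`|p s| + _]addrC -addrA ltrDl ltr_wpDl.
have key t : `|p t| < `|x| -> cdom (schart R n false) (act (mat2 1 0 (clvec x) 1) t).
  move=> pt; have St := SL_cotranslation x.
  move: pt; case: t => [y|] /= pt.
    have := hcoord_chartP false (act_hcoord St (hcoord_fin y)).
    rewrite /chden !mat2_entry mulr1; case: eqP => [e|_ []//].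
    exfalso; move: e => /eqP; rewrite addr_eq0 => /eqP e.
    have y0 : y != 0.
      apply/eqP => y0; move/eqP: e; rewrite y0 linear0 mulr0 eq_sym oppr_eq0.
      by rewrite oner_eq0.
    have [h _] := clvec_inversion y0.
    have xE : x = inversion y.
      apply: clvec_inj; apply: oppr_inj; rewrite -[RHS]mul1r -[1]opprK -e mulNr -mulrA h.
      by rewrite mulr1.
    by rewrite xE ltxx in pt.
  have := hcoord_chartP false (act_hcoord St (hcoord_infty R n)).
  rewrite /chden !mat2_entry mulr1 mulr0 addr0 clvec_eq0.
  by case: eqP => [x0|_ []//]; move: pt; rewrite x0 ltxx.
by exists (mat2 1 0 (clvec x) 1); split; [exact: SL_cotranslation|exact: key|exact: key].
Qed.

(** * The dimension of the domain *)

Section Dimension.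
Variables (R : realFieldType) (m n : nat).
Variables (a : {linear 'rV[R]_m -> 'rV[R]_n}) (H : 'rV[R]_m -> cliff R n).
Hypothesis a_inj : forall X, a X = 0 -> X = 0.
Hypothesis H_reg : forall X, X != 0 -> forall y, y * H X = 0 -> y = 0.
Hypothesis aH : forall X Y, clvec (a X) * H Y = clvec (a Y) * H X.

(** Multiplied by H X on the right, the left side becomes - |a X|^2 times a Y H Z, which is
    symmetric in Y and Z by [aH]; H X can then be cancelled. *)
Lemma triple_symmetric X Y Z :
  clvec (a Y) * clvec (a X) * clvec (a Z) = clvec (a Z) * clvec (a X) * clvec (a Y).
Proof.
have [->|X0] := eqVneq X 0; first by rewrite linear0 linear0 !mulr0 !mul0r.
apply/eqP; rewrite -subr_eq0; apply/eqP/(H_reg X0).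
have sq U : clvec (a X) * clvec (a U) * H X = (- dotv (a X) (a X)) *: H U.
  by rewrite -mulrA (aH U X) mulrA clvec_sqr -scalerAl mul1r.
by rewrite mulrBl -!mulrA !(mulrA (clvec (a X))) !sq -!scalerAr (aH Y Z) subrr.
Qed.

Lemma clvec_swap0 (u v : 'rV[R]_n) : dotv u v = 0 -> clvec u * clvec v = - (clvec v * clvec u).
Proof. by move=> uv; rewrite clvec_swap uv mul0rn scale0r subr0. Qed.

(** A Gram-Schmidt step for the inner product pulled back by a. *)
Let proj (X Y : 'rV[R]_m) : 'rV[R]_m :=
  Y + (- (dotv (a Y) (a X) / dotv (a X) (a X))) *: X.

Let proj_orth X Y : dotv (a X) (a X) != 0 -> dotv (a (proj X Y)) (a X) = 0.
Proof. by move=> h; rewrite linearD linearZ dotvDl dotvZl mulNr divfK // subrr. Qed.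

Let proj_orthW X Y u : dotv (a X) u = 0 -> dotv (a Y) u = 0 -> dotv (a (proj X Y)) u = 0.
Proof. by move=> h k; rewrite linearD linearZ dotvDl dotvZl h k mulr0 addr0. Qed.

Let projE (X Y : 'rV[R]_m) k : X 0 k = 0 -> (proj X Y) 0 k = Y 0 k.
Proof. by move=> h; rewrite mxE mxE h mulr0 addr0. Qed.

(* Three orthogonal vectors u, v, w of the image of a would satisfy
   v u w = w u v = - v u w. *)
Lemma dim_le2 : (m <= 2)%N.
Proof.
rewrite leqNgt; apply/negP => m3.
pose k (i : 'I_3) := widen_ord m3 i.
pose e (i : 'I_3) : 'rV[R]_m := delta_mx 0 (k i).
have eE i j : e i 0 (k j) = (i == j)%:R.
  by rewrite mxE eqxx eq_sym.
have nz (X : 'rV[R]_m) j : X 0 j = 1 -> dotv (a X) (a X) != 0.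
  move=> Xj; rewrite dotv_eq0; apply/eqP => /a_inj X0.
  by move/eqP: Xj; rewrite X0 mxE eq_sym oner_eq0.
(* Gram-Schmidt applied to three basis vectors. Coordinate [k i] of the vector coming from [e i]
   remains 1, so that its image under the injective a is nonzero. *)
pose X1 := e 0; pose X2 := proj X1 (e 1); pose X3 := proj X2 (proj X1 (e ord_max)).
have u0 : dotv (a X1) (a X1) != 0 by apply: (nz _ (k 0)); rewrite eE.
have v0 : dotv (a X2) (a X2) != 0 by apply: (nz _ (k 1)); rewrite projE eE.
have w0 : dotv (a X3) (a X3) != 0.
  by apply: (nz _ (k ord_max)); rewrite projE ?projE eE.
have d21 : dotv (a X2) (a X1) = 0 by exact: proj_orth.
have d31 : dotv (a X3) (a X1) = 0 by apply: proj_orthW => //; exact: proj_orth.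
have d32 : dotv (a X3) (a X2) = 0 by exact: proj_orth.
move: X1 X2 X3 u0 v0 w0 d21 d31 d32 => X1 X2 X3 u0 v0 w0 d21 d31 d32.
have t := triple_symmetric X1 X2 X3.
have t2 : clvec (a X3) * clvec (a X1) * clvec (a X2) = - (clvec (a X2) * clvec (a X1) * clvec (a X3)).
  rewrite (clvec_swap0 d31) mulNr -(mulrA (clvec (a X1))) (clvec_swap0 d32) mulrN opprK mulrA.
  by rewrite (clvec_swap0 (_ : dotv (a X1) (a X2) = 0)) ?mulNr // dotvC.
have z : clvec (a X2) * clvec (a X1) * clvec (a X3) = 0.
  apply: (@scalerI _ _ (2 : R)); first by rewrite pnatr_eq0.
  by rewrite scaler0 scaler_nat mulr2n {1}t t2 addNr.
(* Multiplying the vanishing product again by its three factors leaves minus the product of their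
   squared lengths. *)
have z1 : (dotv (a X2) (a X2) * dotv (a X1) (a X1) * dotv (a X3) (a X3)) *: (1 : cliff R n) = 0.
  have := congr1 (fun y => clvec (a X1) * (clvec (a X2) * y) * clvec (a X3)) z.
  rewrite !mulr0 mul0r !mulrA -!(mulrA _ (clvec (a X3))) clvec_sqr -!scalerAr mulr1.
  rewrite -!mulrA (mulrA (clvec (a X2))) clvec_sqr -scalerAl mul1r -scalerAr clvec_sqr.
  rewrite !scalerA => h; apply: oppr_inj; rewrite oppr0 -[RHS]h -scaleNr; congr (_ *: _).
  ring.
have /eqP := congr1 (fun y => clcoef y finset.set0) z1.
rewrite clcoefZ clcoef1 eqxx mulr1 clcoef0 !mulf_eq0.
by rewrite (negbTE u0) (negbTE v0) (negbTE w0).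
Qed.
End Dimension.

(** A ball is the union of the segments joining its centre to its points. *)
Lemma connected_ball_rV (R : realType) m (x : 'rV[R]_m) r : connected (ball x r).
Proof.
have [r0|r0] := ltP 0 r; last first.
  rewrite (_ : ball x r = set0); first exact: connected0.
  by rewrite -subset0 => y; rewrite -ball_normE /= => /(le_lt_trans (normr_ge0 _))/lt_geF; rewrite r0.
pose seg (y : 'rV[R]_m) := (fun t : R => x + t *: (y - x)) @` `[0, 1].
have cp y : continuous (fun t : R => x + t *: (y - x)).
  by move=> t; exact: (continuousD (@cst_continuous _ _ x t) (@scalel_continuous _ _ _ t)).
have segB y : ball x r y -> seg y `<=` ball x r.
  rewrite -ball_normE /= => yr _ [t + <-]; rewrite /= in_itv /= => /andP[t0 t1].
  rewrite /= opprD addrA subrr sub0r normrN normrZ ger0_norm // distrC.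
  by rewrite distrC (le_lt_trans _ yr) // [`|x - y|]distrC ler_piMl.
rewrite (_ : ball x r = \bigcup_(y in ball x r) seg y); last first.
  apply/seteqP; split=> [y yB|y [z zB zy]]; last exact: segB zy.
  by exists y => //; exists 1; rewrite /= ?in_itv /= ?lexx ?ler01 // scale1r addrC subrK.
apply: bigcup_connected.
  by exists x => y _; exists 0; rewrite /= ?in_itv /= ?lexx ?ler01 // scale0r addr0.
move=> y _; apply: connected_continuous_connected; first exact: segment_connected.
exact: continuous_subspaceT.
Qed.

Lemma smoothS_primitive (R : realType) m (U : set 'rV[R]_m) (F : 'rV[R]_m -> R) W : open U ->
  (forall j, smoothS U (W j)) ->
  (forall y v, U y -> is_derive y v F (\sum_j v 0 j * W j y)) -> smoothS U F.
Proof.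
move=> oU sW dF k; apply: CkS_W; split=> [x Ux|v].
  apply: (C1_differentiable (W := W) oU Ux) => // j.
  exact: (smoothS_continuous (sW j) Ux).
apply: (CkS_ext oU (h := fun x => \sum_j v 0 j * W j x)).
  by move=> x Ux; have [_ ->] := dF x v Ux.
by apply: CkS_sum => // j _; apply: CkS_M => //; [exact: CkS_cst|exact: sW].
Qed.

Section Charts.
Variables (R : realType) (m : nat) (M : manifold R m).

Lemma chart_change_smooth (c c' : chart R M m) : atlas c -> atlas c' -> forall j,
  smoothS (cmap c @` (cdom c `&` cdom c')) (fun x => cmap c' (cinv c x) 0 j).
Proof.
move=> ac ac' j k; have /CkP := atlas_compat ac ac' k; apply.
by apply: chart_image_open => //; exact: atlas_dom ac'.
Qed.

(** The dual will be built in a single chart, whereas its relation with f is required in all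
    charts. *)
Lemma dchart_change n (c c' : chart R M m) q (h : M -> 'rV[R]_n) X : atlas c -> atlas c' ->
  cdom c q -> cdom c' q -> differentiable (h \o cinv c) (cmap c q) ->
  dchart c' q h X = dchart c q h (dchart c' q (cmap c) X).
Proof.
move=> ac ac' qc qc' dh.
have dg : differentiable (fun x => cmap c (cinv c' x)) (cmap c' q).
  apply/differentiable_rVP => j.
  by apply: (smoothS_differentiable (chart_change_smooth ac' ac j)); exists q.
rewrite /dchart (@near_eq_derive _ _ _ _ ((h \o cinv c) \o (fun x => cmap c (cinv c' x)))).
  have dh' : differentiable (h \o cinv c) (cmap c (cinv c' (cmap c' q))) by rewrite chartK.
  rewrite deriveE; last exact: differentiable_comp.
  rewrite diff_comp; [|exact: dg|exact: dh'].
  by rewrite chartK // deriveE // [X in 'd _ _ X = _](_ : _ = 'D_X (cmap c \o cinv c') (cmap c' q)) // deriveE.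
have nc : nbhs q (cdom c) by exact: near_open (atlas_dom ac) qc.
by apply: filterS (near_cinv ac' qc' nc) => x [_ xc]; rewrite /= chartK.
Qed.
End Charts.

Lemma wedge_unit_eq0 (A : nzRingType) (V : Type) (alpha beta : V -> A) (i g : A) X Y : i * g = 1 ->
  wedge alpha (fun Z => i * beta Z * i) X Y = 0 <->
  alpha X * i * beta Y = alpha Y * i * beta X.
Proof.
move=> ig; rewrite /wedge !mulrA -mulrBl; split => [|->]; last by rewrite subrr mul0r.
move=> /(congr1 (fun y => y * g)).
by rewrite mul0r -[_ * i * g]mulrA ig mulr1 => /subr0_eq.
Qed.

Lemma cltr_rinv_clvec (R : realType) n (w : 'rV[R]_n) : w != 0 ->
  cltr (rinv (clvec w)) = rinv (clvec w).
Proof. by move=> w0; rewrite rinv_clvec // -linearN cltr_vec. Qed.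

(** Transposition reverses products and fixes vectors and i. Hence the second equation from a
    vanishing bracket follows from the first. *)
Lemma transpose_triple (R : realType) n (i : cliff R n) (a b a' b' : 'rV[R]_n) : cltr i = i ->
  clvec a * i * clvec b' = clvec a' * i * clvec b ->
  clvec b * i * clvec a' = clvec b' * i * clvec a.
Proof.
by move=> itr /(congr1 (@cltr R n)); rewrite !cltrM itr !cltr_vec !mulrA => ->.
Qed.

(** * Brackets and the Darboux relation at a point *)

Section Pointwise.
Variables (R : realType) (m n : nat) (M : manifold R m) (f fh : M -> sphere R n).
Hypotheses (sf : smooth_map f) (sfh : smooth_map fh) (f_fh : forall p, f p <> fh p).
Hypothesis n_gt0 : (0 < n)%N.
Variables (T : 'M[cliff R n]_2) (ST : SLGamma T).
Let f0 := mmap f T false.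
Let fh0 := mmap fh T false.

Lemma mmap_fin (h : M -> sphere R n) q : mdom h T false q ->
  act T (h q) = fin_pt (mmap h T false q).
Proof. by move=> d; exact: esym (schartK (b := false) d). Qed.

Variables (q : M) (dq : mdom f T false q) (dhq : mdom fh T false q).

Lemma gap_neq0 : fh0 q - f0 q != 0.
Proof.
rewrite subr_eq0; apply/eqP => e; apply: (f_fh (p := q)).
apply: (can_inj (actK n_gt0 ST)); rewrite (mmap_fin dq) (mmap_fin dhq).
by congr fin_pt.
Qed.

Let i := rinv (clvec (fh0 q - f0 q)).

Lemma gap_inv : (clvec (fh0 q) - clvec (f0 q)) * i = 1 /\ i * (clvec (fh0 q) - clvec (f0 q)) = 1.
Proof. by rewrite -linearB; apply: Gamma_rinv; apply: Gamma_vec; exact: gap_neq0. Qed.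

Lemma wedge0P (c : chart R M m) X Y : wedge (dcl c q f0) (fun Z => i * dcl c q fh0 Z * i) X Y = 0 <->
  dcl c q f0 X * i * dcl c q fh0 Y = dcl c q f0 Y * i * dcl c q fh0 X.
Proof. by have [_ h2] := gap_inv; exact: wedge_unit_eq0 h2. Qed.

(** Conjugation by T preserves the vanishing of brackets, so all is read in R^n. The implication to
    the right needs a representative for each X; both need that every representative is the expected
    [frame_tangent]. *)
Lemma darboux_at (c : chart R M m) : atlas c -> cdom c q ->
  (forall xi eta, dphi_image f fh c q xi -> dphi_image f fh c q eta -> lie xi eta = 0) <->
  (forall X Y, wedge (dcl c q f0) (fun Z => i * dcl c q fh0 Z * i) X Y = 0).
Proof.
move=> ac qc; have [b qb] := cover_schart (f q); have [bh qbh] := cover_schart (fh q).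
have [iz zi] := gap_inv.
have frE X xi : tangent_repr (f q) (fh q) (dsphere c q f X) (dsphere c q fh X) xi ->
    T * xi * adj2 T = frame_tangent (clvec (f0 q)) (clvec (fh0 q)) i (dcl c q f0 X) (dcl c q fh0 X).
  move=> /(tangent_repr_frame ST qb qbh (mmap_fin dq) (mmap_fin dhq) gap_neq0) ->.
  have e1 := dchart_mmap sf ST X ac qc qb dq.
  have e2 := dchart_mmap sfh ST X ac qc qbh dhq.
  by rewrite /dcl e1 e2.
have TT := SL_adj2l ST.
have lieE xi eta : lie xi eta = 0 <-> lie (T * xi * adj2 T) (T * eta * adj2 T) = 0.
  rewrite (lie_conj _ _ TT); split=> [->|H]; first by rewrite mulr0 mul0r.
  have := congr1 (fun y => adj2 T * y * T) H.
  by rewrite !mulrA TT mul1r -mulrA TT mulr1 mulr0 mul0r.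
split=> [H X Y|H xi eta [X /frE xiE] [Y /frE etaE]].
  have fz : act (adj2 T) (fin_pt (f0 q)) = f q by rewrite -mmap_fin // actK.
  have fhz : act (adj2 T) (fin_pt (fh0 q)) = fh q by rewrite -mmap_fin // actK.
  have ex Z : exists xi, dphi_image f fh c q xi /\ T * xi * adj2 T =
      frame_tangent (clvec (f0 q)) (clvec (fh0 q)) i (dcl c q f0 Z) (dcl c q fh0 Z).
    have [||xi] := @tangent_repr_exists R n (adj2 T) (f0 q) (fh0 q) (dchart c q f0 Z)
      (dchart c q fh0 Z) (dsphere c q f Z) (dsphere c q fh Z) n_gt0 (SL_adj2 n_gt0 ST) gap_neq0.
    - by move=> b'; rewrite fz => qb'; exact: dsphere_mmap.
    - by move=> b'; rewrite fhz => qb'; exact: dsphere_mmap.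
    - by rewrite fz fhz => xiE; exists xi; split; [exists Z|exact: frE].
  have [xi [xiI xiE]] := ex X; have [eta [etaI etaE]] := ex Y.
  apply/wedge0P; have /lieE := H xi eta xiI etaI; rewrite xiE etaE.
  by case/(lie_frame_tangent iz zi).
apply/lieE; rewrite xiE etaE; apply/(lie_frame_tangent iz zi).
have e := (wedge0P c X Y).1 (H X Y); split; first exact: e.
exact: transpose_triple (cltr_rinv_clvec gap_neq0) e.
Qed.
End Pointwise.

(** * Christoffel duals *)

(** With a for dz, h for dzh and i = g^-1, these are the derivatives of i h_w i along v and of i h_v
    i along w. Terms quadratic in h are symmetric in v and w; the hypotheses exchange the mixed
    ones. *)
Lemma antisymmetric_part (A : nzRingType) (i hv hw av aw hvw : A) :
  av * i * hw = aw * i * hv -> hw * i * av = hv * i * aw ->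
  - (i * (hv - av) * i * hw * i) + i * hvw * i - i * hw * i * (hv - av) * i =
  - (i * (hw - aw) * i * hv * i) + i * hvw * i - i * hv * i * (hw - aw) * i.
Proof.
move=> D1 D2.
have d1 : i * av * i * hw * i = i * aw * i * hv * i.
  by rewrite -(mulrA i) -(mulrA i) D1 !mulrA.
have d2 : i * hw * i * av * i = i * hv * i * aw * i.
  by rewrite -(mulrA i) -(mulrA i) D2 !mulrA.
rewrite !mulrBr !mulrBl d1 d2; move: (_ * i) (_ * i) (_ * i) (_ * i) (_ * i) => p s C q t.
rewrite !opprB [LHS]addrAC [RHS]addrAC; congr (_ + _).
rewrite [LHS]addrACA [RHS]addrACA; congr (_ + _); exact: addrC.
Qed.

Lemma sandwich_derivative (A : nzRingType) (i g h h' : A) :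
  (- (i * g * i) * h + i * h') * i + i * h * - (i * g * i) =
  - (i * g * i * h * i) + i * h' * i - i * h * i * g * i.
Proof. by rewrite mulrDl !mulNr mulrN !mulrA. Qed.

Section ChristoffelForm.
Variables (R : realType) (m n : nat) (V : set 'rV[R]_m) (phi psi : 'rV[R]_m -> 'rV[R]_n).
Hypotheses (oV : open V).
Hypotheses (sphi : forall j, smoothS V (fun x => phi x 0 j)).
Hypotheses (spsi : forall j, smoothS V (fun x => psi x 0 j)).
Hypothesis gap : forall x, V x -> psi x - phi x != 0.

(** The Clifford inverse of the gap, by a formula to which the smoothness lemmas apply. *)
Definition gapinv (x : 'rV[R]_m) : cliff R n := - clvec (inversion (psi x - phi x)).

Lemma smooth_rV_differentiable (h : 'rV[R]_m -> 'rV[R]_n) x :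
  (forall j, smoothS V (fun x => h x 0 j)) -> V x -> differentiable h x.
Proof.
move=> sh Vx; apply/differentiable_rVP => i; exact: smoothS_differentiable (sh i) Vx.
Qed.

Lemma smooth_rV_is_derive (h : 'rV[R]_m -> 'rV[R]_n) x v :
  (forall j, smoothS V (fun x => h x 0 j)) -> V x -> is_derive x v h ('D_v h x).
Proof.
by move=> sh Vx; apply/derivableP/diff_derivable; exact: smooth_rV_differentiable sh Vx.
Qed.

Lemma smooth_rV_derive (h : 'rV[R]_m -> 'rV[R]_n) v : (forall j, smoothS V (fun x => h x 0 j)) ->
  forall j, smoothS V (fun x => ('D_v h x) 0 j).
Proof.
move=> sh j k; apply: CkS_ext (smoothS_derive v (sh j) k) => // x Vx.
by rewrite derive_rV //; case: (smooth_rV_is_derive v sh Vx).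
Qed.

Lemma Schwarz_rV (h : 'rV[R]_m -> 'rV[R]_n) x v w :
  (forall j, smoothS V (fun x => h x 0 j)) -> V x -> 'D_v ('D_w h) x = 'D_w ('D_v h) x.
Proof.
move=> sh Vx; apply/rowP => j.
have E u u' : ('D_u ('D_u' h) x) 0 j = 'D_u ('D_u' (fun y => h y 0 j)) x.
  rewrite derive_rV; last by case: (smooth_rV_is_derive u (smooth_rV_derive u' sh) Vx).
  apply: near_eq_derive; apply: filterS (near_open oV Vx) => y Vy.
  by rewrite derive_rV //; case: (smooth_rV_is_derive u' sh Vy).
have S := @Schwarz R m V _ x v w oV (sh j 2%N) Vx.
exact: etrans (E v w) (etrans S (esym (E w v))).
Qed.

Lemma gapinvP x : V x -> (clvec (psi x) - clvec (phi x)) * gapinv x = 1 /\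
  gapinv x * (clvec (psi x) - clvec (phi x)) = 1.
Proof. by move=> /gap/clvec_inversion; rewrite linearB. Qed.

Lemma smooth_gap j : smoothS V (fun x => (psi x - phi x) 0 j).
Proof.
move=> k; apply: CkS_ext (CkS_D oV (spsi j k) (CkS_N oV (sphi j k))) => // x _.
by rewrite !mxE.
Qed.

Lemma smooth_inversion_gap j : smoothS V (fun x => inversion (psi x - phi x) 0 j).
Proof.
move=> k; have o0 : open ([set~ 0] : set 'rV[R]_n) by exact/closed_openC/closed_set1_rV.
have s := @smoothS_inversion R n [set~ 0] j o0 (fun v => @introN _ _ eqP).
apply: (CkS_comp (h := fun v => inversion v 0 j) oV _ _ (s k)); last by move=> i; exact: smooth_gap.
by move=> x Vx; apply/eqP/gap.
Qed.

Lemma smooth_gapinv : smoothcl V gapinv.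
Proof.
by apply: smoothclN => //; apply: smoothcl_vec => //; exact: smooth_inversion_gap.
Qed.

(** The formula for the inversion shows that a derivative exists; its value follows by
    differentiating g g^-1 = 1. *)
Lemma gapinv_derive x v : V x -> is_clderive x v gapinv
  (- (gapinv x * (clvec ('D_v psi x) - clvec ('D_v phi x)) * gapinv x)).
Proof.
move=> Vx.
have [d dinv] : exists d, is_clderive x v gapinv d.
  exists (- clvec ('D_v (fun y => inversion (psi y - phi y)) x)).
  apply: is_clderiveN; apply: is_clderive_vec.
  exact: smooth_rV_is_derive smooth_inversion_gap Vx.
have dg : is_clderive x v (fun y => clvec (psi y) + - clvec (phi y))
    (clvec ('D_v psi x) + - clvec ('D_v phi x)).
  apply: is_clderiveD; first by apply: is_clderive_vec; exact: smooth_rV_is_derive spsi Vx.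
  by apply: is_clderiveN; apply: is_clderive_vec; exact: smooth_rV_is_derive sphi Vx.
have E : \forall y \near x, (fun=> 1) y = (clvec (psi y) + - clvec (phi y)) * gapinv y.
  by apply: filterS (near_open oV Vx) => y /gapinvP[->].
have := is_clderive_unique (is_clderiveM dg dinv) (near_is_clderive E (is_clderive_cst x v 1)).
have [_ iV] := gapinvP Vx.
move=> /(congr1 (fun z => gapinv x * z)).
rewrite mulr0 mulrDr (mulrA _ (_ + _) d) iV mul1r => /eqP; rewrite addrC addr_eq0 => /eqP dE.
by move: dinv; rewrite dE mulrA.
Qed.

Definition dual_form v x : cliff R n := gapinv x * clvec ('D_v psi x) * gapinv x.

Lemma is_vec_dual_form v x : is_vec (dual_form v x).
Proof.
by rewrite /dual_form /gapinv mulrN !mulNr opprK clvec_conj; exact: is_vec_clvec.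
Qed.

Lemma smooth_dual_form v : smoothcl V (dual_form v).
Proof.
have s := smoothcl_vec oV (smooth_rV_derive v spsi).
exact: (smoothclM oV (smoothclM oV smooth_gapinv s) smooth_gapinv).
Qed.

Lemma dual_form_derive x v w : V x -> is_clderive x v (dual_form w)
  (- (gapinv x * (clvec ('D_v psi x) - clvec ('D_v phi x)) * gapinv x * clvec ('D_w psi x) * gapinv x) +
   gapinv x * clvec ('D_v ('D_w psi) x) * gapinv x -
   gapinv x * clvec ('D_w psi x) * gapinv x * (clvec ('D_v psi x) - clvec ('D_v phi x)) * gapinv x).
Proof.
move=> Vx; have di := gapinv_derive v Vx.
have ddp : is_clderive x v (fun y => clvec ('D_w psi y)) (clvec ('D_v ('D_w psi) x)).
  apply: is_clderive_vec; exact: smooth_rV_is_derive (smooth_rV_derive w spsi) Vx.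
rewrite -sandwich_derivative; exact: is_clderiveM (is_clderiveM di ddp) di.
Qed.

Hypothesis darboux : forall x X Y, V x ->
  clvec ('D_X phi x) * gapinv x * clvec ('D_Y psi x) =
  clvec ('D_Y phi x) * gapinv x * clvec ('D_X psi x).

(** On constant vector fields the exterior derivative is the difference of these two derivatives.
    They agree by the symmetry of second derivatives of psi and by the Darboux relation with its
    transpose. *)
Lemma dual_form_closed x v w : V x ->
  exists2 d, is_clderive x v (dual_form w) d & is_clderive x w (dual_form v) d.
Proof.
move=> Vx; eexists; first exact: dual_form_derive.
have D1 := darboux v w Vx.
have itr : cltr (gapinv x) = gapinv x by rewrite /gapinv -linearN cltr_vec.
have D2 := transpose_triple itr D1.
rewrite (antisymmetric_part _ D1 (esym D2)) (Schwarz_rV v w spsi Vx).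
exact: dual_form_derive.
Qed.
End ChristoffelForm.

Lemma Christoffel_dual_ball (R : realType) (m n : nat) (V : set 'rV[R]_m)
    (phi psi : 'rV[R]_m -> 'rV[R]_n) (x0 : 'rV[R]_m) r :
  open V -> ball x0 r `<=` V ->
  (forall j, smoothS V (fun x => phi x 0 j)) -> (forall j, smoothS V (fun x => psi x 0 j)) ->
  (forall x, V x -> psi x - phi x != 0) ->
  (forall x X Y, V x -> clvec ('D_X phi x) * gapinv phi psi x * clvec ('D_Y psi x) =
    clvec ('D_Y phi x) * gapinv phi psi x * clvec ('D_X psi x)) ->
  exists F : 'rV[R]_m -> 'rV[R]_n,
    (forall j, smoothS (ball x0 r) (fun x => F x 0 j)) /\
    (forall x v, ball x0 r x -> clvec ('D_v F x) = dual_form phi psi v x).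
Proof.
move=> oV BV sphi spsi gap darboux.
(* The coefficients on singletons determine the form, since its values are vectors. *)
pose W (k : 'I_n) (j : 'I_m) x := clcoef (dual_form phi psi (delta_mx 0 j) x) [set k]%SET.
have sW k j : smoothS (ball x0 r) (W k j).
  move=> l; apply: CkS_sub BV _.
  exact: (smooth_dual_form oV sphi spsi gap (delta_mx 0 j) [set k]%SET l).
have clW k i j x : ball x0 r x -> 'D_(delta_mx 0 i) (W k j) x = 'D_(delta_mx 0 j) (W k i) x.
  move=> /BV Vx.
  have [d d1 d2] := dual_form_closed oV sphi spsi gap darboux (delta_mx 0 i) (delta_mx 0 j) Vx.
  have [_ e1] := d1 [set k]%SET; have [_ e2] := d2 [set k]%SET.
  exact: etrans e1 (esym e2).
have /choice[F HF] : forall k, exists F, forall y v, ball x0 r y ->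
    is_derive y v F (\sum_j v 0 j * W k j y).
  by move=> k; apply: Poincare => [j|i j x]; [exact: sW|exact: clW].
exists (fun x => \row_k F k x); split.
  move=> k; have s := smoothS_primitive (ball_open x0 r) (sW k) (HF k).
  by under eq_fun do rewrite mxE.
move=> x v xB; have [u uE] := is_vec_dual_form phi psi v x.
rewrite uE; congr clvec; apply/rowP => k.
have dF : is_derive x v (fun x => \row_k F k x) (\row_k \sum_j v 0 j * W k j x).
  apply/is_derive_rVP => j; rewrite mxE.
  under eq_fun do rewrite mxE.
  exact: HF.
have [_ eF] := dF; apply: etrans (congr1 (fun M : 'rV[R]_n => M 0 k) eF) _; rewrite mxE.
have -> : u 0 k = clcoef (dual_form phi psi v x) [set k]%SET.
  by rewrite uE -[in LHS](clvecK u) mxE.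
have dpsi := smooth_rV_differentiable spsi (BV x xB).
(* Linearity in the direction matches the value on v with the sum over basis directions given by
   [Poincare]. *)
have -> : dual_form phi psi v x = \sum_j v 0 j *: dual_form phi psi (delta_mx 0 j) x.
  rewrite /dual_form deriveE // [X in 'd psi x X]row_sum_delta !linear_sum mulr_sumr mulr_suml.
  apply: eq_bigr => j _; rewrite !linearZ -scalerAr -scalerAl; congr (_ *: (_ * _ * _)).
  by rewrite deriveE.
by rewrite clcoef_sum; apply: eq_bigr => j _; rewrite clcoefZ.
Qed.

Section ChristoffelDual.
Variables (R : realType) (m n : nat) (M : manifold R m) (f fh : M -> sphere R n).
Hypotheses (sf : smooth_map f) (sfh : smooth_map fh) (f_fh : forall p, f p <> fh p).
Hypotheses (n_gt0 : (0 < n)%N) (m_gt0 : (0 < m)%N).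
Variables (T : 'M[cliff R n]_2) (ST : SLGamma T).
Let f0 := mmap f T false.
Let fh0 := mmap fh T false.
Let O : set M := mdom f T false `&` mdom fh T false.
Hypothesis darboux : forall q c, O q -> atlas c -> cdom c q -> forall X Y,
  wedge (dcl c q f0) (fun Z => rinv (clvec (fh0 q - f0 q)) * dcl c q fh0 Z *
    rinv (clvec (fh0 q - f0 q))) X Y = 0.
Hypothesis fh0_imm : forall q c X, O q -> atlas c -> cdom c q -> dchart c q fh0 X = 0 -> X = 0.

Lemma Christoffel_dual p : O p -> exists (U : set M) (fc : M -> 'rV[R]_n),
  [/\ [/\ open U, connected U & U p], U `<=` O, smooth_on U fc, nonconstant_on U fc &
    forall q c, U q -> atlas c -> cdom c q -> forall X Y, wedge (dcl c q f0) (dcl c q fc) X Y = 0].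
Proof.
move=> Op; have [c ac pc] := atlas_cover p.
have oO : open O by apply: openI; exact: mdom_open.
pose V := cmap c @` (cdom c `&` O).
have oV : open V by exact: chart_image_open.
pose phi x := f0 (cinv c x); pose psi x := fh0 (cinv c x).
have VO x : V x -> [/\ O (cinv c x), cdom c (cinv c x) & cmap c (cinv c x) = x].
  by move=> [q [qc Oq] <-]; rewrite chartK.
have sphi j : smoothS V (fun x => phi x 0 j).
  move=> k; apply: CkS_sub (mmap_smooth sf ST false ac j k).
  by move=> x [q [qc [Oq _]] <-]; exists q.
have spsi j : smoothS V (fun x => psi x 0 j).
  move=> k; apply: CkS_sub (mmap_smooth sfh ST false ac j k).
  by move=> x [q [qc [_ Oq]] <-]; exists q.
have gap x : V x -> psi x - phi x != 0.
  by move=> /VO[[d1 d2] _ _]; exact: (gap_neq0 f_fh n_gt0 ST d1 d2).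
have invE q : O q -> rinv (clvec (fh0 q - f0 q)) = - clvec (inversion (fh0 q - f0 q)).
  by move=> [d1 d2]; rewrite rinv_clvec //; exact: (gap_neq0 f_fh n_gt0 ST d1 d2).
have dar x X Y : V x -> clvec ('D_X phi x) * gapinv phi psi x * clvec ('D_Y psi x) =
    clvec ('D_Y phi x) * gapinv phi psi x * clvec ('D_X psi x).
  move=> /VO[Oq qc xE].
  have := (wedge0P f_fh n_gt0 ST Oq.1 Oq.2 c X Y).1 (darboux Oq ac qc X Y).
  rewrite [rinv _](invE _ Oq) /dcl /dchart xE; exact.
have Vp : V (cmap c p) by exists p.
have [r /= r0 BV] := (nbhs_ballP _ _).1 (near_open oV Vp).
have [F [sF dF]] := Christoffel_dual_ball oV BV sphi spsi gap dar.
pose B := ball (cmap c p) r.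
have Bp : B (cmap c p) by exact: ballxx.
(* The image of a ball is connected, as the definition of isothermic demands. *)
pose U : set M := cinv c @` B.
have UE q : U q <-> cdom c q /\ B (cmap c q).
  split=> [[x Bx <-]|[qc Bq]]; last by exists (cmap c q) => //; rewrite chartK.
  by have [_ ? ->] := VO x (BV x Bx).
have UO : U `<=` O by move=> q [x /BV/VO[Oq _ _] <-].
pose fc q := F (cmap c q).
have oU : open U.
  rewrite openE => q /UE[qc Bq].
  have := near_cmap ac qc (near_open (ball_open (cmap c p) r) Bq).
  by apply: filterS => q' h; exact/UE.
have dF_B x : B x -> differentiable F x by exact: smooth_rV_differentiable sF.
have fcE x : B x -> \forall y \near x, F y = (fc \o cinv c) y.
  move=> Bx; apply: filterS (near_open (ball_open (cmap c p) r) Bx) => y By /=.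
  by rewrite /fc; have [_ _ ->] := VO y (BV y By).
have dfc q Z : U q -> dcl c q fc Z = dual_form phi psi Z (cmap c q).
  move=> /UE[qc Bq]; rewrite /dcl /dchart -(near_eq_derive Z (fcE _ Bq)); exact: dF.
exists U, fc; split.
- split; [exact: oU| |by apply/UE; split].
  apply: connected_continuous_connected; first exact: connected_ball_rV.
  apply: continuous_in_subspaceT => x /set_mem Bx.
  by have [_ qc xE] := VO x (BV x Bx); apply: (atlas_cinv_cont ac); exists (cinv c x).
- exact: UO.
- move=> c' ac' k; apply/CkP => [|j]; first exact: chart_image_open.
  apply: (CkS_comp (h := fun x => F x 0 j) (g := fun x => cmap c (cinv c' x)) _ _ _ (sF j k)).
  + exact: chart_image_open.
  + by move=> x [q [qc' /UE[_ Bq]] <-]; rewrite chartK.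
  + move=> l; apply: CkS_sub (chart_change_smooth ac' ac l k).
    by move=> x [q [qc' /UE[qc _]] <-]; exists q.
(* If the dual were constant its form would vanish at p; multiplying by the gap on both sides, so
   would the differential of [fh0], which is injective on a nonzero tangent space. *)
- apply: contrapT => nconst.
  have const q : U q -> fc q = fc p.
    move=> Uq; apply: contrapT => ne; apply: nconst; exists q, p; split => //.
    by apply/UE; split.
  pose v : 'rV[R]_m := delta_mx 0 (Ordinal m_gt0).
  have v0 : v != 0.
    apply/eqP => /(congr1 (fun w : 'rV[R]_m => w 0 (Ordinal m_gt0))) /eqP.
    by rewrite !mxE !eqxx oner_eq0.
  have DF0 : 'D_v F (cmap c p) = 0.
    rewrite (@near_eq_derive _ _ _ _ (cst (fc p))) ?derive_cst //.
    apply: filterS (near_open (ball_open (cmap c p) r) Bp) => y By.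
    have [_ qc yE] := VO y (BV y By).
    by rewrite -{1}yE; apply: (const (cinv c y)); exists y.
  have := dF (cmap c p) v Bp; rewrite DF0 linear0 /dual_form.
  have [i1 i2] := gapinvP gap Vp; move=> /esym form0.
  have : clvec ('D_v psi (cmap c p)) = 0.
    have := congr1 (fun y => (clvec (psi (cmap c p)) - clvec (phi (cmap c p))) * y *
      (clvec (psi (cmap c p)) - clvec (phi (cmap c p)))) form0.
    by rewrite mulr0 mul0r !mulrA i1 mul1r -mulrA i2 mulr1.
  move/eqP; rewrite clvec_eq0 => /eqP h0.
  by move/eqP: v0; apply; exact: fh0_imm Op ac pc h0.
(* Both differentials in c' are those in c after the same change of tangent components, so the
   relation carries over from c. *)
- move=> q c' Uq ac' qc' X Y; have [qc Bq] := (UE q).1 Uq.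
  have [Oq _ _] := VO _ (BV _ Bq); rewrite chartK // in Oq.
  have d1 := mmap_differentiable sf ST ac qc Oq.1.
  have d2 : differentiable (fc \o cinv c) (cmap c q).
    exact: near_eq_differentiable (fcE _ Bq) (dF_B _ Bq).
  have E1 Z : dcl c' q f0 Z = clvec ('D_(dchart c' q (cmap c) Z) phi (cmap c q)).
    by rewrite /dcl (dchart_change Z ac ac' qc qc' d1).
  have E2 Z : dcl c' q fc Z = dual_form phi psi (dchart c' q (cmap c) Z) (cmap c q).
    have e1 := dchart_change Z ac ac' qc qc' d2.
    have e2 := dfc q (dchart c' q (cmap c) Z) Uq.
    rewrite -e2.
    rewrite /dcl.
    by rewrite e1.
  have [_ i2] := gapinvP gap (BV _ Bq).
  have := (wedge_unit_eq0 (fun Z => clvec ('D_(dchart c' q (cmap c) Z) phi (cmap c q)))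
    (fun Z => clvec ('D_(dchart c' q (cmap c) Z) psi (cmap c q))) X Y i2).2 (dar _ _ _ (BV _ Bq)).
  by rewrite /wedge (E1 X) (E1 Y) (E2 X) (E2 Y).
Qed.
End ChristoffelDual.

(** * The equivalence *)

Lemma rinv_clvecB (R : realType) n (v w : 'rV[R]_n) : w - v != 0 ->
  rinv (clvec (w - v)) = - rinv (clvec (v - w)).
Proof.
move=> h; have h' : v - w != 0 by rewrite -opprB oppr_eq0.
have [e1 e2] := Gamma_rinv (Gamma_vec h').
by apply: rinvE; rewrite -(opprB v) linearN mulrNN.
Qed.

(** Exchanging the two maps transposes the relation and reverses the gap; the resulting sign appears
    on both sides. *)
Lemma transpose_gap (R : realType) n (v w a b a' b' : 'rV[R]_n) : w - v != 0 ->
  clvec a * rinv (clvec (w - v)) * clvec b' = clvec a' * rinv (clvec (w - v)) * clvec b ->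
  clvec b * rinv (clvec (v - w)) * clvec a' = clvec b' * rinv (clvec (v - w)) * clvec a.
Proof.
move=> gap /(transpose_triple (cltr_rinv_clvec gap)).
by rewrite (rinv_clvecB gap) !mulrN !mulNr => /oppr_inj.
Qed.

Lemma mulr_units_eq0 (A : nzRingType) (i g h k y : A) : i * g = 1 -> h * k = 1 ->
  y * (i * h) = 0 -> y = 0.
Proof.
move=> ig hk yh; rewrite -[y]mulr1 -ig -[i]mulr1 -hk.
by rewrite !mulrA -(mulrA y) yh !mul0r.
Qed.

Section Immersions.
Variables (R : realType) (m n : nat) (M : manifold R m) (f : M -> sphere R n).
Hypotheses (m_gt0 : (0 < m)%N) (M_nonempty : [set: M] !=set0) (f_imm : immersion f).

Let e0 : 'rV[R]_m := delta_mx 0 (Ordinal m_gt0).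

Lemma delta_neq0 : e0 <> 0.
Proof.
move=> /(congr1 (fun w : 'rV[R]_m => w 0 (Ordinal m_gt0))) /eqP.
by rewrite !mxE !eqxx oner_eq0.
Qed.

(** If n = 0 every differential vanishes, while [0 < m] provides a nonzero tangent vector. *)
Lemma immersion_dim : (0 < n)%N.
Proof.
rewrite lt0n; apply/eqP => n0.
have [p _] := M_nonempty; have [c ac pc] := atlas_cover p; have [b pb] := cover_schart (f p).
have [_ /(_ p c _ ac pc (schart_atlas R n b) pb e0) inj] := f_imm.
apply: delta_neq0; apply: inj; apply/rowP => j.
by exfalso; case: j => j; rewrite n0.
Qed.

Lemma immersion_nonconstant : nonconstant_on setT f.
Proof.
apply: contrapT => const.
have [p _] := M_nonempty; have [c ac pc] := atlas_cover p; have [b pb] := cover_schart (f p).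
have [_ /(_ p c _ ac pc (schart_atlas R n b) pb e0) inj] := f_imm.
apply: delta_neq0; apply: inj; rewrite /dsphere /dchart.
rewrite (_ : (cmap (schart R n b) \o f) \o cinv c = cst (cmap (schart R n b) (f p))).
  exact: derive_cst.
apply/funext => x /=; congr (cmap _ _); apply: contrapT => ne.
by apply: const; exists (cinv c x), p.
Qed.

Lemma immersion_mmap (T : 'M[cliff R n]_2) c q X : SLGamma T -> atlas c -> cdom c q ->
  mdom f T false q -> dchart c q (mmap f T false) X = 0 -> X = 0.
Proof.
move=> ST ac qc dq X0; have [sf inj] := f_imm; have [b qb] := cover_schart (f q).
apply: (inj q c _ ac qc (schart_atlas R n b) qb).
by rewrite (dsphere_mmap sf immersion_dim ST X ac qc qb dq) X0 linear0.
Qed.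
End Immersions.

(** The relation for every T, whereas [darboux_pair] offers one T near each point; curved flatness,
    which does not mention T, links the two. *)
Definition darboux_transforms (R : realType) (m n : nat) (M : manifold R m) (g h : M -> sphere R n) := forall T, SLGamma T ->
  forall q c, mdom g T false q -> mdom h T false q -> atlas c -> cdom c q -> forall X Y,
  wedge (dcl c q (mmap g T false)) (fun Z => rinv (clvec (mmap h T false q - mmap g T false q)) *
    dcl c q (mmap h T false) Z * rinv (clvec (mmap h T false q - mmap g T false q))) X Y = 0.

(** The dual of f is built from fh, and that fh is an immersion makes it non-constant. *)
Lemma darboux_isothermic (R : realType) (m n : nat) (M : manifold R m) (f fh : M -> sphere R n) :
  (0 < n)%N -> m = 2%N -> (forall p, f p <> fh p) -> immersion f -> immersion fh ->
  [set: M] !=set0 -> darboux_transforms f fh -> isothermic f.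
Proof.
move=> n_gt0 m2 f_fh f_imm fh_imm M0 D; split; [exact: m2|exact: f_imm|] => p.
have m_gt0 : (0 < m)%N by rewrite m2.
have [T [ST d1 d2]] := SL_to_finite (f p) (fh p) n_gt0.
have imm q c X : (mdom f T false `&` mdom fh T false) q -> atlas c -> cdom c q ->
    dchart c q (mmap fh T false) X = 0 -> X = 0.
  by move=> [_ dq] ac qc; exact: (immersion_mmap m_gt0 M0 fh_imm ST ac qc dq).
have [U [fc [[oU cU Up] UO sfc nfc w]]] := Christoffel_dual f_imm.1 fh_imm.1 f_fh n_gt0 m_gt0 ST
  (fun q c Oq ac qc => D T ST q c Oq.1 Oq.2 ac qc) imm (conj d1 d2).
exists U, T, (mmap f T false), fc; split => //.
by split => // q /UO[dq _]; exact: mmap_fin.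
Qed.

Section Main.
Variables (R : realType) (m n : nat) (M : manifold R m) (f fh : M -> sphere R n).
Hypotheses (m_ge2 : (1 < m)%N) (M_nonempty : [set: M] !=set0).
Hypotheses (f_fh : forall p, f p <> fh p) (f_imm : immersion f) (fh_imm : immersion fh).

Let m_gt0 : (0 < m)%N := ltnW m_ge2.
Let n_gt0 : (0 < n)%N := immersion_dim m_gt0 M_nonempty f_imm.
Let sf : smooth_map f := f_imm.1.
Let sfh : smooth_map fh := fh_imm.1.

Lemma curved_flat_darboux : curved_flat f fh -> darboux_transforms f fh.
Proof.
move=> [_ H] T ST q c d1 d2 ac qc.
by apply/(darboux_at sf sfh f_fh n_gt0 ST d1 d2 ac qc); exact: H.
Qed.

Lemma darboux_transforms_sym : darboux_transforms f fh -> darboux_transforms fh f.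
Proof.
move=> D T ST q c d1 d2 ac qc X Y.
have hf p : fh p <> f p by move=> /esym; exact: f_fh.
apply/(wedge0P hf n_gt0 ST d1 d2).
have e := (wedge0P f_fh n_gt0 ST d2 d1 c X Y).1 (D T ST q c d2 d1 ac qc X Y).
exact: transpose_gap (gap_neq0 f_fh n_gt0 ST d2 d1) e.
Qed.

Lemma darboux_dim : darboux_transforms f fh -> m = 2%N.
Proof.
move=> D; have [p _] := M_nonempty; have [c ac pc] := atlas_cover p.
have [T [ST d1 d2]] := SL_to_finite (f p) (fh p) n_gt0.
apply/eqP; rewrite eqn_leq m_ge2 andbT.
pose i := rinv (clvec (mmap fh T false p - mmap f T false p)).
have df := mmap_differentiable sf ST ac pc d1.
pose a : {linear 'rV[R]_m -> 'rV[R]_n} := 'd (fun x => mmap f T false (cinv c x)) (cmap c p).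
have aE X : dchart c p (mmap f T false) X = a X by rewrite /dchart deriveE.
have [gi ig] := gap_inv f_fh n_gt0 ST d1 d2.
(* The right factor is (fh - f)^-1 dfh(X); for X nonzero it is a product of two units because fh is
   an immersion. *)
apply: (@dim_le2 R m n a (fun X => i * dcl c p (mmap fh T false) X)).
- by move=> X; rewrite -aE; exact: (immersion_mmap m_gt0 M_nonempty f_imm ST ac pc d1).
- move=> X X0 y yH.
  have h0 : dchart c p (mmap fh T false) X != 0.
    apply: contra_neq X0; exact: (immersion_mmap m_gt0 M_nonempty fh_imm ST ac pc d2).
  have [hh _] := clvec_inversion h0.
  exact: mulr_units_eq0 ig hh yH.
- move=> X Y; have := (wedge0P f_fh n_gt0 ST d1 d2 c X Y).1 (D T ST p c d1 d2 ac pc X Y).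
  rewrite /dcl (aE X) (aE Y) => e.
  exact: etrans (mulrA _ _ _) (etrans e (esym (mulrA _ _ _))).
Qed.

Lemma darboux_transforms_pair : darboux_transforms f fh -> darboux_pair f fh.
Proof.
move=> D; split; [exact: immersion_nonconstant f_imm|exact: immersion_nonconstant fh_imm|exact: f_fh|].
move=> p; have [T [ST d1 d2]] := SL_to_finite (f p) (fh p) n_gt0.
exists (mdom f T false `&` mdom fh T false), T, (mmap f T false), (mmap fh T false).
split.
- by split; [apply: openI; exact: mdom_open|split].
- exact: ST.
- by move=> q [dq _]; exact: mmap_fin.
- by move=> q [_ dq]; exact: mmap_fin.
- move=> q c [dq dhq] ac qc; split; first exact: (gap_neq0 f_fh n_gt0 ST dq dhq).
  exact: D.
Qed.

Lemma darboux_pair_curved_flat : darboux_pair f fh -> curved_flat f fh.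
Proof.
move=> [_ _ _ D]; split.
  split; [exact: sf|exact: sfh|exact: f_fh|].
  move=> p c psi psih ac pc apsi psip _ _ X X0 _; have [_ inj] := f_imm.
  exact: inj ac pc apsi psip X X0.
move=> p c ac pc; have [U [T [f0 [fh0 [[oU Up] ST ff0 ffh0 Dar]]]]] := D p.
have mE (h : M -> sphere R n) h0 : finite_via U T h h0 -> forall q, U q ->
    mdom h T false q /\ mmap h T false q = h0 q.
  by move=> fin q Uq; rewrite /mdom /mmap /= fin.
have [d1 e1] := mE f f0 ff0 p Up; have [d2 e2] := mE fh fh0 ffh0 p Up.
apply/(darboux_at sf sfh f_fh n_gt0 ST d1 d2 ac pc) => X Y.
(* The given Euclidean maps agree with [mmap] on U only; since U is open, the differentials at p
   agree too. *)
have dE (h : M -> sphere R n) h0 : finite_via U T h h0 -> forall Z,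
    dcl c p (mmap h T false) Z = dcl c p h0 Z.
  move=> fin Z; rewrite /dcl /dchart; congr clvec; apply: near_eq_derive.
  apply: filterS (near_cinv ac pc (near_open oU Up)) => x [_ Ux].
  by have [_ e] := mE h h0 fin _ Ux; exact: e.
have [_ /(_ X Y)] := Dar p c Up ac pc.
rewrite e1 e2 /wedge (dE f f0 ff0 X) (dE f f0 ff0 Y) (dE fh fh0 ffh0 X) (dE fh fh0 ffh0 Y).
exact.
Qed.
End Main.

(** The bounds exclude degenerate cases: for m = 1 all brackets vanish although a curve is not a
    surface, and on an empty manifold the bracket condition is vacuous while no map is
    non-constant. *)
Theorem theorem3p3 (R : realType) (m n : nat) (M : manifold R m)
    (f fh : M -> sphere R n)
    (m_ge2 : (1 < m)%N) (M_nonempty : [set: M] !=set0)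
    (f_fh : forall p, f p <> fh p)
    (f_imm : immersion f) (fh_imm : immersion fh) :
  curved_flat f fh <->
  [/\ darboux_pair f fh, isothermic f & isothermic fh].
Proof.
split=> [flat|[D _ _]]; last exact: (darboux_pair_curved_flat m_ge2 M_nonempty).
have D := curved_flat_darboux m_ge2 M_nonempty f_fh f_imm fh_imm flat.
have m2 := darboux_dim m_ge2 M_nonempty f_fh f_imm fh_imm D.
have n_gt0 := immersion_dim (ltnW m_ge2) M_nonempty f_imm.
split.
- exact: (darboux_transforms_pair m_ge2 M_nonempty).
- exact: (darboux_isothermic n_gt0 m2 f_fh f_imm fh_imm M_nonempty D).
- have hf p : fh p <> f p by move=> /esym; exact: f_fh.
  apply: (darboux_isothermic n_gt0 m2 hf fh_imm f_imm M_nonempty).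
  exact: (darboux_transforms_sym m_ge2 M_nonempty).
Qed.
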